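(* Let $d\in\{2,3\}$, $\Omega=(-\pi,\pi)^d$, $0<\delta<1$, and let the kernels $\omega_\delta,\tilde\omega_\delta,\hat\omega_\delta$ satisfy the kernel assumption (K) stated in the context, with constants $0<m<M$. Let $\mathbf f\in[L^2(\Omega)]^d$ and $g\in L^2(\Omega)$ be $\Omega$-periodic with $\int_\Omega \mathbf f\,d\mathbf x=\mathbf 0$ and $\int_\Omega g\,d\mathbf x=0$. Then there exists a unique $\Omega$-periodic solution $(\mathbf u_\delta,p_\delta)$ of the nonlocal Stokes system $$-\mathcal L_\delta \mathbf u_\delta+\mathcal G_\delta p_\delta=\mathbf f,\qquad \mathcal D_\delta\mathbf u_\delta-\delta^2\mathcal R_\delta p_\delta=g\qquad\text{in }\Omega,$$ with $\int_\Omega\mathbf u_\delta\,d\mathbf x=\mathbf 0$ and $\int_\Omega p_\delta\,d\mathbf x=0$. It is given by its Fourier series with coefficients, for $\boldsymbol\xi\in\mathbb Z^d\setminus\{0\}$, $$\begin{pmatrix}\hat{\mathbf u}_\delta(\boldsymbol\xi)\\ \hat p_\delta(\boldsymbol\xi)\end{pmatrix}=(A_\delta(\boldsymbol\xi))^{-1}\begin{pmatrix}\hat{\mathbf f}(\boldsymbol\xi)\\ \hat g(\boldsymbol\xi)\end{pmatrix},\qquad (A_\delta(\boldsymbol\xi))^{-1}=\begin{pmatrix}\dfrac{1}{\lambda_\delta(\boldsymbol\xi)}\Bigl(I_d-\dfrac{\mathbf b_\delta(\boldsymbol\xi)\otimes\mathbf b_\delta(\boldsymbol\xi)}{q_\delta(\boldsymbol\xi)}\Bigr)&\dfrac{-i\,\mathbf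 b_\delta(\boldsymbol\xi)}{q_\delta(\boldsymbol\xi)}\\[2mm] \dfrac{-i\,\mathbf b_\delta(\boldsymbol\xi)^T}{q_\delta(\boldsymbol\xi)}&\dfrac{\lambda_\delta(\boldsymbol\xi)}{q_\delta(\boldsymbol\xi)}\end{pmatrix},$$ where $q_\delta(\boldsymbol\xi)=|\mathbf b_\delta(\boldsymbol\xi)|^2+\delta^2c_\delta(\boldsymbol\xi)\lambda_\delta(\boldsymbol\xi)$. In addition, there is a constant $C>0$ depending only on $m$ (and independent of $\delta,\mathbf f,g$ and of the kernels) such that $$\|\mathbf u_\delta\|_{[L^2(\Omega)]^d}\le C\bigl(\|\mathbf f\|_{[L^2(\Omega)]^d}+\|g\|_{L^2(\Omega)}\bigr)\quad\text{and}\quad \|p_\delta\|_{L^2(\Omega)}\le C\bigl(\|\mathbf f\|_{[L^2(\Omega)]^d}+\|g\|_{L^2(\Omega)}\bigr).$$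
   Context: All functions are periodic with period cell $\Omega=(-\pi,\pi)^d$, $d=2$ or $3$; $\mathbf u$ and $\mathbf f$ are vector valued ($d$ components), $p$ and $g$ are scalar. Fourier coefficients: $\hat v(\boldsymbol\xi)=\int_\Omega v(\mathbf x)e^{-i\boldsymbol\xi\cdot\mathbf x}\,d\mathbf x$, $\boldsymbol\xi\in\mathbb Z^d$, so that $v(\mathbf x)=(2\pi)^{-d}\sum_{\boldsymbol\xi}\hat v(\boldsymbol\xi)e^{i\boldsymbol\xi\cdot\mathbf x}$. Kernel assumption (K): $\omega_\delta(|\mathbf x|),\tilde\omega_\delta(|\mathbf x|),\hat\omega_\delta(|\mathbf x|)$ are non-negative, radially symmetric, supported in the ball $B(0,\delta)$, and are rescalings $$\omega_\delta(|\mathbf x|)=\frac1{\delta^{d+2}}\omega\Bigl(\frac{|\mathbf x|}{\delta}\Bigr),\quad \tilde\omega_\delta(|\mathbf x|)=\frac1{\delta^{d+2}}\tilde\omega\Bigl(\frac{|\mathbf x|}{\delta}\Bigr),\quad \hat\omega_\delta(|\mathbf x|)=\frac1{\delta^{d+1}}\hat\omega\Bigl(\frac{|\mathbf x|}{\delta}\Bigr)$$ of kernels $\omega,\tilde\omega,\hat\omega$ supported in the unit ball, with $$\frac12\int_{\mathbb R^d}\omega_\delta(|\mathbf x|)|\mathbf x|^2d\mathbf x=\int_{\mathbb R^d}\hat\omega_\delta(|\mathbf x|)|\mathbf x|\,d\mathbf x=d,\qquad m\le\int_{\mathbb R^d}\tilde\omega_\delta(|\mathbf x|)|\mathbf x|^2d\mathbf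 x\le M$$ for constants $0<m<M$. (The hat in $\hat\omega$ is part of the kernel's name, not a Fourier transform.) Nonlocal operators, with vector kernel $\boldsymbol\omega_\delta(\mathbf x)=\hat\omega_\delta(|\mathbf x|)\,\mathbf x/|\mathbf x|$: $$\mathcal L_\delta\mathbf u(\mathbf x)=\int_{\mathbb R^d}\omega_\delta(|\mathbf y-\mathbf x|)(\mathbf u(\mathbf y)-\mathbf u(\mathbf x))d\mathbf y,\qquad \mathcal G_\delta p(\mathbf x)=\int_{\mathbb R^d}\boldsymbol\omega_\delta(\mathbf y-\mathbf x)(p(\mathbf y)-p(\mathbf x))d\mathbf y,$$ $$\mathcal D_\delta\mathbf u(\mathbf x)=\int_{\mathbb R^d}\boldsymbol\omega_\delta(\mathbf y-\mathbf x)\cdot(\mathbf u(\mathbf y)-\mathbf u(\mathbf x))d\mathbf y,\qquad \mathcal R_\delta p(\mathbf x)=\int_{\mathbb R^d}\tilde\omega_\delta(|\mathbf y-\mathbf x|)(p(\mathbf y)-p(\mathbf x))d\mathbf y.$$ On periodic functions they act as Fourier multipliers (which is how they are understood in general): $\widehat{\mathcal L_\delta\mathbf u}=-\lambda_\delta\hat{\mathbf u}$, $\widehat{\mathcal G_\delta p}=i\mathbf b_\delta\hat p$, $\widehat{\mathcal D_\delta\mathbf u}=i\mathbf b_\delta^T\hat{\mathbf u}$, $\widehat{\mathcal R_\delta p}=-c_\delta\hat p$, where $$\lambda_\delta(\boldsymbol\xi)=\int_{|\mathbf s|\le\delta}\omega_\delta(|\mathbf s|)(1-\cos(\boldsymbol\xi\cdot\mathbf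 s))d\mathbf s,\quad \mathbf b_\delta(\boldsymbol\xi)=\int_{|\mathbf s|\le\delta}\hat\omega_\delta(|\mathbf s|)\frac{\mathbf s}{|\mathbf s|}\sin(\boldsymbol\xi\cdot\mathbf s)d\mathbf s,\quad c_\delta(\boldsymbol\xi)=\int_{|\mathbf s|\le\delta}\tilde\omega_\delta(|\mathbf s|)(1-\cos(\boldsymbol\xi\cdot\mathbf s))d\mathbf s.$$ Accordingly the system is equivalent to $A_\delta(\boldsymbol\xi)\,(\hat{\mathbf u}_\delta(\boldsymbol\xi),\hat p_\delta(\boldsymbol\xi))^T=(\hat{\mathbf f}(\boldsymbol\xi),\hat g(\boldsymbol\xi))^T$ for all $\boldsymbol\xi\in\mathbb Z^d\setminus\{0\}$, with $$A_\delta(\boldsymbol\xi)=\begin{pmatrix}\lambda_\delta(\boldsymbol\xi)I_d&i\mathbf b_\delta(\boldsymbol\xi)\\ i\mathbf b_\delta(\boldsymbol\xi)^T&\delta^2c_\delta(\boldsymbol\xi)\end{pmatrix}.$$ *)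

(* Defs.v *)
From HB Require Import structures.
From mathcomp Require Import all_boot all_order all_algebra finmap.
From mathcomp Require Import all_classical all_reals all_analysis.
From mathcomp Require Import complex.
From mathcomp Require showcase.summability.

Set Implicit Arguments.
Unset Strict Implicit.
Unset Printing Implicit Defensive.
Import Order.TTheory GRing.Theory Num.Theory.
Import numFieldNormedType.Exports.

Local Open Scope classical_set_scope.
Local Open Scope ring_scope.
Local Open Scope complex_scope.

(* R^d is the type of d-tuples, with the product sigma-algebra.  Only the
   one-dimensional Lebesgue measure is in the library: the d-dimensional one is
   built by iterating binary products. *)
Notation Rspace R d := (d.-tuple (measurableTypeR R)).
Notation freq d := (d.-tuple int).

Section lebesgue_measure_tuple.
Variable R : realType.

Definition tuple_cons n (z : measurableTypeR R * Rspace R n) : Rspace R n.+1 :=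
  [tuple of z.1 :: z.2].

Definition tuple_uncons n (t : Rspace R n.+1) : measurableTypeR R * Rspace R n :=
  (thead t, [tuple of behead t]).

Lemma tuple_consK n : cancel (@tuple_cons n) (@tuple_uncons n).
Proof.
case=> a t; rewrite /tuple_uncons /tuple_cons /= theadE.
by congr pair; exact/val_inj.
Qed.

Lemma tuple_unconsK n : cancel (@tuple_uncons n) (@tuple_cons n).
Proof. by move=> t; rewrite /tuple_cons /= -tuple_eta. Qed.

Lemma measurable_tuple_cons n : measurable_fun [set: _] (@tuple_cons n).
Proof. exact: measurable_cons. Qed.

Lemma measurable_tuple_uncons n : measurable_fun [set: _] (@tuple_uncons n).
Proof.
apply: measurable_fun_pair; last exact: measurable_behead.
exact: (measurable_tnth ord0).
Qed.

Section cons_measure.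
Variables (n : nat) (mu : {sigma_finite_measure set (Rspace R n) -> \bar R}).

Definition cons_measure : set (Rspace R n.+1) -> \bar R :=
  pushforward (lebesgue_measure \x mu)%E (@tuple_cons n).

Let cons_measure0 : cons_measure set0 = 0%E.
Proof. by rewrite /cons_measure /pushforward preimage_set0 measure0. Qed.

Let cons_measure_ge0 A : (0 <= cons_measure A)%E.
Proof. by apply: integral_ge0 => x _; exact: measure_ge0. Qed.

Let cons_measure_sigma_additive : semi_sigma_additive cons_measure.
Proof.
move=> F mF tF mUF; rewrite /cons_measure /pushforward preimage_bigcup.
have mc B : measurable B -> measurable (@tuple_cons n @^-1` B).
  by move=> mB; rewrite -[X in measurable X]setTI; exact: measurable_tuple_cons.
apply: measure_semi_sigma_additive.
- by move=> k; exact: (mc _ (mF k)).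
- apply/trivIsetP => /= i j _ _ ij; rewrite -preimage_setI.
  by move/trivIsetP : tF => /(_ _ _ _ _ ij) ->//; rewrite preimage_set0.
- by rewrite -preimage_bigcup; exact: (mc _ mUF).
Qed.

HB.instance Definition _ := isMeasure.Build _ _ _ cons_measure
  cons_measure0 cons_measure_ge0 cons_measure_sigma_additive.

Let cons_measure_sigma_finite : sigma_finite setT cons_measure.
Proof.
have /sigma_finiteP[F [TF ndF Foo]] := sigma_finiteT (@lebesgue_measure R).
have /sigma_finiteP[G [TG ndG Goo]] := sigma_finiteT mu.
exists (fun k => @tuple_uncons n @^-1` (F k `*` G k)).
  rewrite -preimage_bigcup (_ : \bigcup_k _ = setT) ?preimage_setT//.
  rewrite -setXTT TF TG predeqE => -[x y]; split=> [[k _ []/= ? ?]|].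
    by split; exists k.
  move=> [/= [k _ Fkx] [l _ Gly]]; exists (maxn k l) => //; split.
  - by move: x Fkx; exact/subsetPset/ndF/leq_maxl.
  - by move: y Gly; exact/subsetPset/ndG/leq_maxr.
move=> k; have [mF Fk] := Foo k; have [mG Gk] := Goo k; split.
  rewrite -[X in measurable X]setTI.
  by apply: measurable_tuple_uncons => //; exact: measurableX.
rewrite /cons_measure /pushforward -comp_preimage (_ : _ \o _ = id); last first.
  by apply/funext => z; exact: tuple_consK.
by rewrite preimage_id product_measure1E// lte_mul_pinfty// ge0_fin_numE.
Qed.

HB.instance Definition _ := Measure_isSigmaFinite.Build _ _ _ cons_measure
  cons_measure_sigma_finite.

End cons_measure.

Fixpoint lebesgue_tuple n : {sigma_finite_measure set (Rspace R n) -> \bar R} :=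
  match n with
  | 0 => \d_([tuple] : Rspace R 0)
  | k.+1 => cons_measure (lebesgue_tuple k)
  end.

End lebesgue_measure_tuple.

Section setting.
Variables (R : realType) (d : nat).
Local Notation C := R[i].
Local Notation mu := (@lebesgue_tuple R d).

Definition dot (xi : freq d) (x : Rspace R d) : R :=
  \sum_(i < d) (tnth xi i)%:~R * tnth x i.

Definition enorm (x : Rspace R d) : R := Num.sqrt (\sum_(i < d) tnth x i ^+ 2).

Definition vnorm (v : 'cV[R]_d) : R := Num.sqrt (\sum_(i < d) v i ord0 ^+ 2).

Definition freq0 : freq d := [tuple 0 | i < d].

Definition cell : set (Rspace R d) :=
  [set x | forall i, - pi < tnth x i < pi].

Definition cell_periodic (T : Type) (v : Rspace R d -> T) : Prop :=
  forall (k : freq d) (x : Rspace R d),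
    v [tuple tnth x i + 2 * pi * (tnth k i)%:~R | i < d] = v x.

Definition vcomp (v : Rspace R d -> 'cV[R]_d) (i : 'I_d) : Rspace R d -> R :=
  fun x => v x i ord0.

Definition in_L2 (v : Rspace R d -> R) : Prop := v \_ cell \in Lfun mu 2%:E.

Definition L2norm (v : Rspace R d -> R) : \bar R :=
  ('N[mu]_2%:E [EFin \o (v \_ cell)])%E.

Definition in_L2v (v : Rspace R d -> 'cV[R]_d) : Prop :=
  forall i, in_L2 (vcomp v i).

Definition L2normv (v : Rspace R d -> 'cV[R]_d) : \bar R := L2norm (vnorm \o v).

Definition mean_zero (v : Rspace R d -> R) : Prop :=
  \int[mu]_(x in cell) v x = 0.

Definition mean_zerov (v : Rspace R d -> 'cV[R]_d) : Prop :=
  forall i, mean_zero (vcomp v i).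

Definition expi (t : R) : C := cos t +i* sin t.

Definition cintegral (D : set (Rspace R d)) (h : Rspace R d -> C) : C :=
  (\int[mu]_(x in D) complex.Re (h x)) +i* (\int[mu]_(x in D) complex.Im (h x)).

Definition fourier (v : Rspace R d -> R) (xi : freq d) : C :=
  cintegral cell (fun x => (v x)%:C * expi (- dot xi x)).

Definition fourierv (v : Rspace R d -> 'cV[R]_d) (xi : freq d) : 'cV[C]_d :=
  \col_i fourier (vcomp v i) xi.

Definition fourier_partial_sum (c : freq d -> C) (F : {fset (freq d)})
    (x : Rspace R d) : C :=
  ((2 * pi) ^- d)%:C * \sum_(xi <- F) c xi * expi (dot xi x).

(* Unconditional convergence in L^2, along the finite sets of frequencies
   ordered by inclusion. *)
Definition is_fourier_series (v : Rspace R d -> R) (c : freq d -> C) : Prop :=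
  (fun F => L2norm (fun x =>
     ComplexField.Normc.normc ((v x)%:C - fourier_partial_sum c F x)))
  @ summability.totally --> 0%E.

(* A radial kernel is given by its profile r |-> k r on [0, +oo[; its rescaling
   is r |-> delta^-e * k (r / delta).  Below om, omt and omh are the profiles of
   the kernels with no accent, a tilde and a hat; the names ending in an
   underscore are the delta-dependent objects. *)
Definition rescale (e : nat) (delta : R) (k : R -> R) : R -> R :=
  fun r => delta ^- e * k (r / delta).

Definition profile (k : R -> R) : Prop :=
  [/\ measurable_fun [set r : R | 0 <= r] k,
      (forall r, 0 <= r -> 0 <= k r) &
      (forall r, 1 < r -> k r = 0)].

Section multipliers.
Variables (delta : R) (om omt omh : R -> R).

Definition om_ : R -> R := rescale d.+2 delta om.
Definition omt_ : R -> R := rescale d.+2 delta omt.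
Definition omh_ : R -> R := rescale d.+1 delta omh.

Definition kernel_assumption (m M : R) : Prop :=
  [/\ profile om, profile omt, profile omh,
      ((2^-1)%:E * \int[mu]_x (om_ (enorm x) * enorm x ^+ 2)%:E = d%:R%:E)%E &
      (\int[mu]_x (omh_ (enorm x) * enorm x)%:E = d%:R%:E)%E /\
      (m%:E <= \int[mu]_x (omt_ (enorm x) * enorm x ^+ 2)%:E <= M%:E)%E].

Definition cball : set (Rspace R d) := [set s | enorm s <= delta].

Definition lambda_ (xi : freq d) : R :=
  \int[mu]_(s in cball) (om_ (enorm s) * (1 - cos (dot xi s))).

Definition b_ (xi : freq d) : 'cV[R]_d :=
  \col_i \int[mu]_(s in cball)
    (omh_ (enorm s) * (tnth s i / enorm s) * sin (dot xi s)).

Definition c_ (xi : freq d) : R :=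
  \int[mu]_(s in cball) (omt_ (enorm s) * (1 - cos (dot xi s))).

Definition q_ (xi : freq d) : R :=
  vnorm (b_ xi) ^+ 2 + delta ^+ 2 * c_ xi * lambda_ xi.

Definition bC (xi : freq d) : 'cV[C]_d := map_mx (real_complex R) (b_ xi).

(* For a square-integrable u the distribution L_delta u need not be a function
   (the kernels may be non-integrable), so the nonlocal operators take values in
   periodic distributions, represented by their Fourier coefficients. *)
Definition opL (u : Rspace R d -> 'cV[R]_d) (xi : freq d) : 'cV[C]_d :=
  - ((lambda_ xi)%:C *: fourierv u xi).

Definition opG (p : Rspace R d -> R) (xi : freq d) : 'cV[C]_d :=
  ('i * fourier p xi) *: bC xi.

Definition opD (u : Rspace R d -> 'cV[R]_d) (xi : freq d) : C :=
  'i * ((bC xi)^T *m fourierv u xi) ord0 ord0.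

Definition opR (p : Rspace R d -> R) (xi : freq d) : C :=
  - ((c_ xi)%:C * fourier p xi).

Definition solution (f : Rspace R d -> 'cV[R]_d) (g : Rspace R d -> R)
    (u : Rspace R d -> 'cV[R]_d) (p : Rspace R d -> R) : Prop :=
  [/\ cell_periodic u /\ cell_periodic p,
      in_L2v u /\ in_L2 p,
      mean_zerov u /\ mean_zero p &
      forall xi : freq d,
        - opL u xi + opG p xi = fourierv f xi /\
        opD u xi - (delta ^+ 2)%:C * opR p xi = fourier g xi].

Definition A_ (xi : freq d) : 'M[C]_(d + 1) :=
  block_mx (lambda_ xi)%:C%:M ('i *: bC xi)
           ('i *: (bC xi)^T) (delta ^+ 2 * c_ xi)%:C%:M.

Definition Ainv_ (xi : freq d) : 'M[C]_(d + 1) :=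
  block_mx
    ((lambda_ xi)%:C^-1 *: (1%:M - (q_ xi)%:C^-1 *: (bC xi *m (bC xi)^T)))
    ((- 'i / (q_ xi)%:C) *: bC xi)
    ((- 'i / (q_ xi)%:C) *: (bC xi)^T)
    ((lambda_ xi / q_ xi)%:C)%:M.

End multipliers.

End setting.

(* Main.v *)
Require Import Defs.
From mathcomp Require Import all_boot all_order all_algebra finmap.
From mathcomp Require Import all_classical all_reals all_analysis.
From mathcomp Require Import measurable_realfun.
From mathcomp Require Import complex ring lra zify.
From mathcomp Require showcase.summability.

Set Implicit Arguments.
Unset Strict Implicit.
Unset Printing Implicit Defensive.
Import Order.TTheory GRing.Theory Num.Theory.
Import numFieldNormedType.Exports.

Local Open Scope classical_set_scope.
Local Open Scope ring_scope.
Local Open Scope complex_scope.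

(** Fourier multipliers decouple the system: at each frequency xi <> 0 it is the
    linear saddle-point system with matrix A(xi), and the stated inverse is
    checked by a block computation as soon as lambda(xi) and q(xi) do not vanish.
    The theorem rests on bounds for these numbers that depend on m only
    ([multiplier_bounds]): 1 / lambda <= 16, and 1 / q and lambda / q are at most
    K = 16 (1 + 288 / m).  They yield |uhat(xi)|^2 and |phat(xi)|^2 at most
    2 K^2 (|fhat(xi)|^2 + |ghat(xi)|^2), because I - b b^T / q is a contraction and
    |b|^2 <= q.  Summing over xi gives the estimate with C = 2 K.

    The bounds on the multipliers.  The integral of k(|s|) (1 - cos(a.s)) is easy
    to bound below when |a| delta <= 1, since then 1 - cos y >= y^2 / 8 for all
    the relevant y.  For larger a, this integral is invariant under the rotations
    R of a, and 1 - cos (x - y) <= 2 (1 - cos x) + 2 (1 - cos y); so its value at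
    a is at least a quarter of its value at a - R a, and R can be chosen to give
    a - R a any prescribed small length tau ([weight_cos_ge]).  With tau = 1 this
    bounds lambda; with tau = 1 / (delta sqrt d) it bounds delta^2 c when
    delta |xi| >= 1, whence q >= (m / 288) lambda.  When delta |xi| <= 1, the
    inequality y sin y >= y^2 / 2 gives b.xi >= |xi|^2 / 2, hence
    q >= |b|^2 >= |xi|^2 / 4, while lambda <= |xi|^2.  That the measure is invariant
    under rotations follows from Tonelli's theorem, because a plane rotation is
    a product of three shears ([preserving_rot]).

    Existence and uniqueness in L^2.  The coefficients of the solution are square
    summable and satisfy the symmetry of the coefficients of real functions;
    partial sums over an exhaustion of the frequencies form a Cauchy sequence,
    whose limit has the prescribed coefficients ([Riesz_Fischer]).  Uniqueness
    and the Parseval identity both come from the completeness of the characters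
    ([annihilated_ae0]): if v is orthogonal to all of them, then the bounded
    functions psi by which one can multiply without losing orthogonality to the
    characters form an algebra that is closed under bounded limits.  It contains
    cos (x_i - c), hence the indicators of the half-spaces x_i < a as limits of
    polynomials in such cosines, hence the indicators of all measurable sets, and
    the integral of v over each of them vanishes. *)

(** * Coordinate translations preserve the measure *)

Section measure_preserving.
Variable R : realType.

Lemma lebesgue_measure_shift (c : R) (A : set (measurableTypeR R)) :
  measurable A -> lebesgue_measure ((fun x => x + c) @^-1` A) = lebesgue_measure A.
Proof.
move=> mA.
have mf : measurable_fun setT (fun x : measurableTypeR R => (x + c : measurableTypeR R)).
  by apply: measurable_funD.
suff /(_ A mA) -> : forall A, measurable A ->
  lebesgue_measure A = pushforward lebesgue_measure (fun x : measurableTypeR R => x + c) A by [].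
apply: (lebesgue_measure_unique (mu :=
  measure_function_pushforward__canonical__measure_function_Measure _ mf)).
move=> X [[a b] _ <-].
rewrite /= /pushforward.
have -> : (fun x => x + c) @^-1` `]a, b]%classic = `](a - c), (b - c)]%classic.
  by apply/seteqP; split=> x /=; rewrite !in_itv/= ltrBlDr lerBrDr.
rewrite !lebesgue_measure_itv/= !lte_fin ltrD2r; case: ifPn => // _.
by rewrite -!EFinD; congr (_%:E); ring.
Qed.

Lemma integral_shift (c : R) (F : measurableTypeR R -> \bar R) :
  measurable_fun setT F -> (forall x, 0 <= F x)%E ->
  (\int[lebesgue_measure]_x F (x + c)%R = \int[lebesgue_measure]_x F x)%E.
Proof.
move=> mF F0.
have mf : measurable_fun setT (fun x : measurableTypeR R => (x + c : measurableTypeR R)).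
  by apply: measurable_funD.
have := @ge0_integral_pushforward _ _ _ _ R _ mf lebesgue_measure setT F measurableT mF.
rewrite preimage_setT => /(_ (fun y _ => F0 y)) <-.
by apply: eq_measure_integral => A mA _; exact: lebesgue_measure_shift.
Qed.

Lemma tonelli_cons n (F : Rspace R n.+1 -> \bar R) :
  measurable_fun setT F -> (forall x, 0 <= F x)%E ->
  (\int[lebesgue_tuple R n.+1]_x F x =
   \int[lebesgue_measure \x lebesgue_tuple R n]_z F (tuple_cons z))%E.
Proof.
move=> mF F0.
have := @ge0_integral_pushforward _ _ _ _ R _ (@measurable_tuple_cons R n)
  (lebesgue_measure \x lebesgue_tuple R n)%E setT F measurableT mF.
by rewrite preimage_setT => /(_ (fun y _ => F0 y)) <-.
Qed.

(** Stated for non-negative integrands, where Tonelli's theorem applies without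
    any integrability condition. *)
Definition preserving n (T : Rspace R n -> Rspace R n) : Prop :=
  measurable_fun setT T /\
  forall F : Rspace R n -> \bar R,
    measurable_fun setT F -> (forall x, 0 <= F x)%E ->
    (\int[lebesgue_tuple R n]_x F (T x) = \int[lebesgue_tuple R n]_x F x)%E.

Lemma preserving_comp n (S T : Rspace R n -> Rspace R n) :
  preserving S -> preserving T -> preserving (S \o T).
Proof.
move=> [mS pS] [mT pT]; split; first exact: measurableT_comp.
move=> F mF F0; rewrite -[RHS]pS// -[RHS]pT//.
exact: measurableT_comp.
Qed.

Definition add_at n (i : 'I_n) (c : Rspace R n -> R) (x : Rspace R n) : Rspace R n :=
  [tuple tnth x k + (if k == i then c x else 0) | k < n].

Lemma measurable_add_at n (i : 'I_n) c : measurable_fun setT c ->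
  measurable_fun setT (add_at i c).
Proof.
move=> mc; apply/measurable_fun_tnthP => k.
rewrite (_ : _ \o _ = (fun x => tnth x k + (if k == i then c x else 0))); last first.
  by apply/funext => x /=; rewrite tnth_mktuple.
by case: (k == i); apply: measurable_funD => //; exact: measurable_tnth.
Qed.

(** By Tonelli's theorem the integral over the i-th coordinate can be computed
    with the others frozen, and then c is a constant: translation invariance on
    the line concludes.  The measure peels off the first coordinate only, hence
    the induction on n. *)
Lemma preserving_add_at n (i : 'I_n) (c : Rspace R n -> R) :
  measurable_fun setT c ->
  (forall x y, (forall k, k != i -> tnth x k = tnth y k) -> c x = c y) ->
  preserving (add_at i c).
Proof.
move=> mc ci; split; first exact: measurable_add_at.
elim: n i c mc ci => [[]//|n IH] i c mc ci F mF F0.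
have mcons := @measurable_tuple_cons R n.
have mFa : measurable_fun setT (fun x => F (add_at i c x)).
  by apply: measurableT_comp => //; exact: measurable_add_at.
rewrite (tonelli_cons mFa)// (tonelli_cons mF)//.
have mb (b : R) : measurable_fun setT (fun t : Rspace R n => (tuple_cons (b : measurableTypeR R, t))).
  by apply: (measurableT_comp mcons); apply: measurable_fun_pair.
case: (unliftP ord0 i) => [j ij|i0].
- have mF1 : measurable_fun setT (fun z => F (tuple_cons z) : \bar R) by apply: measurableT_comp.
  have mF2 : measurable_fun setT (fun z => F (add_at i c (tuple_cons z)) : \bar R)
    by exact: (measurableT_comp mFa).
  rewrite (fubini_tonelli1 _ mF2)//.
  rewrite (fubini_tonelli1 _ mF1)//.
  apply: eq_integral => b _; rewrite /fubini_F.
  have cE t : add_at i c (tuple_cons (b, t)) =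
     tuple_cons (b, add_at j (fun t => c (tuple_cons (b, t))) t).
    apply/eq_from_tnth => k; rewrite tnth_mktuple ij.
    case: (unliftP ord0 k) => [k' ->|->].
      by rewrite !tnthS !tnth_mktuple (inj_eq lift_inj).
    by rewrite !tnth0 (negbTE (neq_lift _ _)) addr0.
  under eq_integral do rewrite cE.
  apply: (IH j (fun t => c (tuple_cons (b, t))) _ _ (fun t => F (tuple_cons (b, t)))) => //.
  + exact: measurableT_comp.
  + move=> x y xy; apply: ci => k.
    case: (unliftP ord0 k) => [k' ->|->] ki; last by rewrite !tnth0.
    rewrite !tnthS; apply: xy; apply: contra ki => /eqP ->.
    by rewrite ij.
  + exact: measurableT_comp.
- subst i.
  have mF1 : measurable_fun setT (fun z => F (tuple_cons z) : \bar R) by apply: measurableT_comp.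
  have mF2 : measurable_fun setT (fun z => F (add_at ord0 c (tuple_cons z)) : \bar R)
    by exact: (measurableT_comp mFa).
  rewrite (fubini_tonelli2 _ mF2)//.
  rewrite (fubini_tonelli2 _ mF1)//.
  apply: eq_integral => t _; rewrite /fubini_G.
  have cE b : add_at ord0 c (tuple_cons (b, t)) = tuple_cons (b + c (tuple_cons (0, t)), t).
    apply/eq_from_tnth => k; rewrite tnth_mktuple.
    case: (unliftP ord0 k) => [k' ->|->].
      by rewrite !tnthS eq_sym (negbTE (neq_lift _ _)) addr0.
    rewrite !tnth0 eqxx; congr (_ + _); apply: ci => k'.
    by case: (unliftP ord0 k') => [k'' ->|->]; rewrite ?tnthS// eqxx.
  under eq_integral do rewrite cE.
  apply: (@integral_shift (c (tuple_cons (0, t))) (fun b => F (tuple_cons (b, t)))) => //.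
  apply: (measurableT_comp mF); apply: (measurableT_comp mcons).
  exact: measurable_fun_pair.
Qed.

End measure_preserving.

(** * Elementary inequalities and finite sums of integrals *)

Section real_inequalities.
Variable R : realType.

(** Half of the Lagrange identity. *)
Lemma sum_Cauchy_Schwarz (I : finType) (a b : I -> R) :
  (\sum_i a i * b i) ^+ 2 <= (\sum_i a i ^+ 2) * (\sum_i b i ^+ 2).
Proof.
have : 0 <= \sum_i \sum_j (a i * b j - a j * b i) ^+ 2.
  by apply: sumr_ge0 => i _; apply: sumr_ge0 => j _; exact: sqr_ge0.
have -> : \sum_i \sum_j (a i * b j - a j * b i) ^+ 2 =
   2 * ((\sum_i a i ^+ 2) * (\sum_i b i ^+ 2)) - 2 * (\sum_i a i * b i) ^+ 2.
  transitivity (\sum_i \sum_j (a i ^+ 2 * b j ^+ 2 + b i ^+ 2 * a j ^+ 2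
      - 2 * ((a i * b i) * (a j * b j)))).
    by apply: eq_bigr => i _; apply: eq_bigr => j _; ring.
  under eq_bigr => i _ do rewrite big_split sumrN -mulr_sumr big_split/= -!mulr_sumr.
  rewrite big_split sumrN big_split/= -mulr_sumr -!mulr_suml -expr2; ring.
lra.
Qed.

Lemma sin_MVT (y : R) : 0 <= y -> exists2 c : R, 0 <= c <= y & sin y = cos c * y.
Proof.
move=> y0; have [|c] := @MVT_segment R sin cos 0 y y0 (fun x _ => is_derive_sin x).
  by apply: continuous_subspaceT; exact: continuous_sin.
by rewrite in_itv/= sin0 !subr0 => cy ->; exists c.
Qed.

Lemma normr_sin_le (y : R) : `|sin y| <= `|y|.
Proof.
wlog y0 : y / 0 <= y.
  move=> H; have [/H//|/ltW y0] := leP 0 y.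
  by rewrite -(normrN y) -(normrN (sin y)) -sinN; apply: H; rewrite oppr_ge0.
have [c _ ->] := sin_MVT y0.
by rewrite normrM ler_piMl// cos_max.
Qed.

Lemma one_cosE (y : R) : 1 - cos y = 2 * sin (y / 2) ^+ 2.
Proof.
have {1}-> : y = (y / 2) *+ 2 by rewrite -mulr_natr; field.
by rewrite cos_mulr2n -mulr_natr sin2cos2; ring.
Qed.

Lemma one_cos_ge0 (y : R) : 0 <= 1 - cos y.
Proof. by rewrite subr_ge0 cos_le1. Qed.

Lemma one_cos_le (y : R) : 1 - cos y <= y ^+ 2 / 2.
Proof.
have := normr_sin_le (y / 2).
rewrite -(@ler_sqr _ `|sin _|) ?nnegrE// -!normrX !ger0_norm ?sqr_ge0// one_cosE; lra.
Qed.

Lemma sin_ge_half (y : R) : 0 <= y <= 1 -> y / 2 <= sin y.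
Proof.
move=> /andP[y0 y1]; have [c /andP[c0 cy] ->] := sin_MVT y0.
have := one_cos_le c.
have : c ^+ 2 <= 1 by rewrite expr_le1// (le_trans cy).
nra.
Qed.

Lemma one_cos_ge (y : R) : y ^+ 2 <= 1 -> y ^+ 2 / 8 <= 1 - cos y.
Proof.
wlog y0 : y / 0 <= y.
  move=> H; have [/H//|/ltW y0] := leP 0 y.
  by rewrite -cosN -sqrrN; apply: H; rewrite ?oppr_ge0.
rewrite expr_le1// => y1; rewrite one_cosE.
have : 0 <= y / 2 <= 1 by lra.
move/sin_ge_half; nra.
Qed.

Lemma mul_sin_ge (y : R) : y ^+ 2 <= 1 -> y ^+ 2 / 2 <= y * sin y.
Proof.
wlog y0 : y / 0 <= y.
  move=> H; have [/H//|/ltW y0] := leP 0 y.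
  by have := H (- y); rewrite sqrrN sinN mulrNN oppr_ge0; apply.
rewrite expr_le1// => y1.
have /sin_ge_half : 0 <= y <= 1 by lra.
nra.
Qed.

(** With 1 - cos y = 2 sin^2 (y/2), this follows by squaring
    |sin (x - y)| <= |sin x| + |sin y| at half angles. *)
Lemma one_cosB_le (x y : R) : 1 - cos (x - y) <= 2 * (1 - cos x) + 2 * (1 - cos y).
Proof.
rewrite !one_cosE mulrBl sinB.
have := cos2Dsin2 (x / 2); have := cos2Dsin2 (y / 2).
set s := sin _; set c := cos _; set s' := sin _; set c' := cos _ => h1 h2.
have := sqr_ge0 (s' * c + c' * s).
have h : s' ^+ 2 * c ^+ 2 <= s' ^+ 2 by rewrite ler_piMr ?sqr_ge0//; nra.
have h' : c' ^+ 2 * s ^+ 2 <= s ^+ 2 by rewrite ler_piMl ?sqr_ge0//; nra.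
rewrite !expr2 in h h' *; nra.
Qed.

End real_inequalities.

Section integrals.
Context d (T : measurableType d) (R : realType).
Variable mu : {measure set T -> \bar R}.
Variables (D : set T) (mD : measurable D).

Lemma integrable_bigsum I (s : seq I) (f : I -> T -> R) :
  (forall i, mu.-integrable D (EFin \o f i)) ->
  mu.-integrable D (EFin \o (fun x => \sum_(i <- s) f i x)).
Proof.
move=> fi; rewrite (_ : _ \o _ = fun x => (\sum_(i <- s) (f i x)%:E)%E).
  by apply: integrable_sum => // i _; exact: fi.
by apply/funext => x /=; rewrite sumEFin.
Qed.

Lemma Rintegral_sum I (s : seq I) (f : I -> T -> R) :
  (forall i, mu.-integrable D (EFin \o f i)) ->
  \int[mu]_(x in D) (\sum_(i <- s) f i x) = \sum_(i <- s) \int[mu]_(x in D) f i x.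
Proof.
move=> fi; elim: s => [|i s IH].
  rewrite big_nil; under eq_Rintegral do rewrite big_nil.
  by rewrite Rintegral_cst// mul0r.
rewrite big_cons -IH -RintegralD//; last exact: integrable_bigsum.
by apply: eq_Rintegral => x _; rewrite big_cons.
Qed.

End integrals.

(** * Plane rotations *)

Section rotations.
Variables (R : realType) (d : nat).
Local Notation mu := (@lebesgue_tuple R d).
Implicit Types (i j : 'I_d) (x : Rspace R d).

Lemma preserving_Rintegral (T : Rspace R d -> Rspace R d) (F : Rspace R d -> R) :
  preserving T -> measurable_fun setT F ->
  \int[mu]_x F (T x) = \int[mu]_x F x.
Proof.
move=> [mT pT] mF; rewrite /Rintegral integralE [in RHS]integralE.
have mF' : measurable_fun setT (EFin \o F) by exact/measurable_EFinP.
rewrite -(pT _ (measurable_funepos mF')); last by move=> x; exact: funepos_ge0.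
rewrite -(pT _ (measurable_funeneg mF')); last by move=> x; exact: funeneg_ge0.
by congr (fine (_ - _)); apply: eq_integral => x _;
  rewrite (funeposE, funenegE) [RHS](funeposE, funenegE).
Qed.

Definition shear i j (a : R) : Rspace R d -> Rspace R d :=
  add_at i (fun x => a * tnth x j).

Lemma preserving_shear i j a : i != j -> preserving (shear i j a).
Proof.
move=> ij; apply: preserving_add_at.
  by apply: measurable_funM => //; exact: measurable_tnth.
by move=> x y xy; rewrite xy// eq_sym.
Qed.

(** The rotation of angle theta in the (i, j) plane, t = tan (theta / 2), written
    as a product of three shears: each shear translates one coordinate by a
    function of another one, so that it preserves the measure. *)
Definition plane_rot i j (t : R) : Rspace R d -> Rspace R d :=
  shear i j (- t) \o shear j i (2 * t / (1 + t ^+ 2)) \o shear i j (- t).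

Lemma preserving_rot i j t : i != j -> preserving (plane_rot i j t).
Proof.
move=> ij; have ji : j != i by rewrite eq_sym.
by do 2 (apply: preserving_comp; last exact: preserving_shear); exact: preserving_shear.
Qed.

Lemma rot_coords i j t x : i != j ->
  [/\ tnth (plane_rot i j t x) i =
        (1 - t ^+ 2) / (1 + t ^+ 2) * tnth x i - 2 * t / (1 + t ^+ 2) * tnth x j,
      tnth (plane_rot i j t x) j =
        2 * t / (1 + t ^+ 2) * tnth x i + (1 - t ^+ 2) / (1 + t ^+ 2) * tnth x j &
      forall k, k != i -> k != j -> tnth (plane_rot i j t x) k = tnth x k].
Proof.
move=> ij; have t0 : 1 + t ^+ 2 != 0 by rewrite gt_eqF// ltr_pwDl ?sqr_ge0.
have ji : (j == i) = false by rewrite eq_sym (negbTE ij).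
have tE i' j' a y k : tnth (shear i' j' a y) k =
  tnth y k + (if k == i' then a * tnth y j' else 0) by rewrite tnth_mktuple.
rewrite /plane_rot /=; split.
- by rewrite !tE !eqxx ?ji ?(negbTE ij) ?addr0; field.
- by rewrite !tE !eqxx ?ji ?(negbTE ij) ?addr0; field.
- by move=> k /negbTE ki /negbTE kj; rewrite !tE ki kj !addr0.
Qed.

Definition sqnorm x : R := \sum_(k < d) tnth x k ^+ 2.

Lemma enormE x : enorm x = Num.sqrt (sqnorm x). Proof. by []. Qed.

Lemma sqnorm_ge0 x : 0 <= sqnorm x.
Proof. by apply: sumr_ge0 => k _; exact: sqr_ge0. Qed.

Lemma enorm_sqr x : enorm x ^+ 2 = sqnorm x.
Proof. by rewrite sqr_sqrtr// sqnorm_ge0. Qed.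

Definition lform (a : 'I_d -> R) x : R := \sum_(k < d) a k * tnth x k.

Lemma sum_two (F : 'I_d -> R) i j : i != j ->
  \sum_(k < d) F k = F i + F j + \sum_(k < d | (k != i) && (k != j)) F k.
Proof.
move=> ij; rewrite (bigD1 i)//= (bigD1 j)/=; last by rewrite eq_sym.
by rewrite addrA.
Qed.

Lemma sqnorm_rot i j t x : i != j -> sqnorm (plane_rot i j t x) = sqnorm x.
Proof.
move=> ij; have [hi hj hk] := rot_coords t x ij.
have t0 : 1 + t ^+ 2 != 0 by rewrite gt_eqF// ltr_pwDl ?sqr_ge0.
rewrite /sqnorm !(sum_two _ ij) hi hj; congr (_ + _).
  by field.
by apply: eq_bigr => k /andP[ki kj]; rewrite hk.
Qed.

(** The linear form a - R^T a, whose coefficients lie in the (i, j) plane.  Its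
    squared length is 4 t^2 / (1 + t^2) times that of the projection of a on
    this plane. *)
Lemma lform_rotB a i j t x : i != j ->
  lform a x - lform a (plane_rot i j t x) =
  (2 * t / (1 + t ^+ 2)) *
  ((a i * t - a j) * tnth x i + (a i + a j * t) * tnth x j).
Proof.
move=> ij; have [hi hj hk] := rot_coords t x ij.
have t0 : 1 + t ^+ 2 != 0 by rewrite gt_eqF// ltr_pwDl ?sqr_ge0.
rewrite /lform !(sum_two _ ij) hi hj.
rewrite [in X in _ - X](eq_bigr (fun k => a k * tnth x k)).
  by field.
by move=> k /andP[ki kj]; rewrite hk.
Qed.

Lemma measurable_lform a : measurable_fun setT (lform a).
Proof.
apply: measurable_sum => k; apply: measurable_funM => //; exact: measurable_tnth.
Qed.

Lemma measurable_sqnorm : measurable_fun setT sqnorm.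
Proof.
by apply: measurable_sum => k; apply: measurable_funX; exact: measurable_tnth.
Qed.

Lemma measurable_enorm : measurable_fun setT (@enorm R d).
Proof.
apply: (@measurableT_comp _ _ _ _ _ _ (@Num.sqrt R)); last exact: measurable_sqnorm.
by apply: continuous_measurable_fun; exact: sqrt_continuous.
Qed.

Lemma lform_sqr_le a x : lform a x ^+ 2 <= (\sum_(k < d) a k ^+ 2) * sqnorm x.
Proof. exact: sum_Cauchy_Schwarz. Qed.

End rotations.

(** * Multipliers of radial kernels *)

Section radial_weight.
Variables (R : realType) (d : nat).
Local Notation mu := (@lebesgue_tuple R d).
Variables (w : Rspace R d -> R) (W : R).
Hypothesis mw : measurable_fun setT w.
Hypothesis w_ge0 : forall x, 0 <= w x.
Hypothesis w_rot : forall i j t x, i != j -> w (plane_rot i j t x) = w x.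
Hypothesis w_moment : (\int[mu]_x (w x * sqnorm x)%:E = W%:E)%E.

Let mwX g : measurable_fun setT g -> measurable_fun setT (fun x => w x * g x).
Proof. exact: measurable_funM. Qed.

Let m_tnth (i : 'I_d) : measurable_fun setT (fun x : Rspace R d => tnth x i : R).
Proof. exact: measurable_tnth. Qed.

Lemma weight_integrable (g : Rspace R d -> R) (C : R) :
  measurable_fun setT g -> (forall x, `|g x| <= C * sqnorm x) ->
  mu.-integrable setT (EFin \o (fun x => w x * g x)).
Proof.
move=> mg gC.
have iw : mu.-integrable setT (fun x => C%:E * (w x * sqnorm x)%:E)%E.
  apply: integrableZl => //; apply/integrableP; split.
    by apply/measurable_EFinP; apply: mwX; exact: measurable_sqnorm.
  under eq_integral do
    rewrite gee0_abs ?lee_fin ?mulr_ge0 ?sqnorm_ge0//.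
  by rewrite w_moment ltry.
apply: le_integrable iw => //.
  by apply/measurable_EFinP; exact: mwX.
move=> x _ /=; rewrite lee_fin !normrM (ger0_norm (w_ge0 x)) mulrCA.
apply: ler_wpM2l => //; apply: le_trans (gC x) _.
by rewrite -normrM ler_norm.
Qed.

Lemma tnth_sqr_le i (x : Rspace R d) : tnth x i ^+ 2 <= sqnorm x.
Proof.
rewrite /sqnorm (bigD1 i)//= lerDl.
by apply: sumr_ge0 => k _; exact: sqr_ge0.
Qed.

Lemma tnthM_le i j (x : Rspace R d) : `|tnth x i * tnth x j| <= 1 * sqnorm x.
Proof.
have := tnth_sqr_le i x; have := tnth_sqr_le j x.
rewrite mul1r; set u := tnth x i; set v := tnth x j => hv hu.
have : 0 <= (`|u| - `|v|) ^+ 2 by exact: sqr_ge0.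
rewrite sqrrB !real_normK ?num_real// normrM; lra.
Qed.

Lemma weight_tnthM_integrable i j :
  mu.-integrable setT (EFin \o (fun x => w x * (tnth x i * tnth x j))).
Proof.
by apply: (@weight_integrable _ 1); [exact: measurable_funM|exact: tnthM_le].
Qed.

Lemma rot1_coords i j (x : Rspace R d) : i != j ->
  tnth (plane_rot i j 1 x) i = - tnth x j /\ tnth (plane_rot i j 1 x) j = tnth x i.
Proof.
by move=> ij; have [-> -> _] := rot_coords 1 x ij; split; field.
Qed.

(** The quarter turn of the (i, j) plane changes the sign of x_i x_j. *)
Lemma weight_cross i j : i != j -> \int[mu]_x (w x * (tnth x i * tnth x j)) = 0.
Proof.
move=> ij; set I := Rintegral _ _ _.
suff : I = - I by move=> ?; lra.
rewrite {1}/I -(preserving_Rintegral (preserving_rot 1 ij)); last first.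
  by apply: mwX; exact: measurable_funM.
rewrite /I -mulN1r -RintegralZl//; last exact: weight_tnthM_integrable.
apply: eq_Rintegral => x _; rewrite w_rot//.
by have [-> ->] := rot1_coords x ij; ring.
Qed.

Lemma weight_diag i j :
  \int[mu]_x (w x * (tnth x i * tnth x i)) = \int[mu]_x (w x * (tnth x j * tnth x j)).
Proof.
have [->//|ij] := eqVneq i j.
rewrite -[LHS](preserving_Rintegral (preserving_rot 1 ij)); last first.
  by apply: mwX; exact: measurable_funM.
apply: eq_Rintegral => x _; rewrite w_rot//.
by have [-> _] := rot1_coords x ij; ring.
Qed.

Lemma weight_momentE : \int[mu]_x (w x * sqnorm x) = W.
Proof. by rewrite /Rintegral w_moment. Qed.

Lemma weight_coord i : d%:R * \int[mu]_x (w x * (tnth x i * tnth x i)) = W.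
Proof.
rewrite -weight_momentE.
transitivity (\sum_(k < d) \int[mu]_x (w x * (tnth x k * tnth x k))).
  rewrite (eq_bigr _ (fun k _ => weight_diag k i)) sumr_const card_ord.
  by rewrite mulr_natl.
rewrite -Rintegral_sum//; last by move=> k; exact: weight_tnthM_integrable.
by apply: eq_Rintegral => x _; rewrite /sqnorm mulr_sumr.
Qed.

Lemma weight_lform_integrable a :
  mu.-integrable setT (EFin \o (fun x => w x * lform a x ^+ 2)).
Proof.
apply: (@weight_integrable _ (\sum_k a k ^+ 2)).
  by apply: measurable_funX; exact: measurable_lform.
by move=> x; rewrite ger0_norm ?sqr_ge0//; exact: lform_sqr_le.
Qed.

(** Isotropy: the quarter turns of the coordinate planes show that the matrix of
    the second moments is scalar. *)
Lemma weight_lform a :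
  d%:R * \int[mu]_x (w x * lform a x ^+ 2) = (\sum_(k < d) a k ^+ 2) * W.
Proof.
pose F k l x := a k * a l * (w x * (tnth x k * tnth x l)).
have iF k l : mu.-integrable setT (EFin \o F k l).
  exact: (integrableZl _ (a k * a l) (weight_tnthM_integrable k l)).
transitivity (d%:R * \sum_(k < d) \sum_(l < d) \int[mu]_x (F k l x)).
  congr (_ * _); under eq_bigr do rewrite -Rintegral_sum//.
  rewrite -Rintegral_sum//; last by move=> k; exact: integrable_bigsum.
  apply: eq_Rintegral => x _; rewrite expr2 /lform mulr_suml mulr_sumr.
  apply: eq_bigr => k _; rewrite mulr_sumr mulr_sumr; apply: eq_bigr => l _.
  by rewrite /F; ring.
rewrite mulr_sumr mulr_suml; apply: eq_bigr => k _.
rewrite (bigD1 k)//= big1 ?addr0; last first.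
  move=> l lk; rewrite /F RintegralZl//; last exact: weight_tnthM_integrable.
  by rewrite weight_cross ?mulr0// eq_sym.
rewrite /F RintegralZl//; last exact: weight_tnthM_integrable.
by rewrite mulrCA weight_coord expr2.
Qed.

Lemma weight_cos_integrable a :
  mu.-integrable setT (EFin \o (fun x => w x * (1 - cos (lform a x)))).
Proof.
apply: (@weight_integrable _ (\sum_k a k ^+ 2)).
  apply: measurable_funB => //; apply: measurableT_comp; last exact: measurable_lform.
  by apply: continuous_measurable_fun; exact: continuous_cos.
move=> x; rewrite ger0_norm ?one_cos_ge0//; apply: le_trans (one_cos_le _) _.
apply: le_trans (lform_sqr_le a x); have := sqr_ge0 (lform a x); lra.
Qed.

Lemma weight_cos_ge0 a : 0 <= \int[mu]_x (w x * (1 - cos (lform a x))).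
Proof. by apply: Rintegral_ge0 => x _; rewrite mulr_ge0// one_cos_ge0. Qed.

Lemma weight_cos_le a :
  d%:R * \int[mu]_x (w x * (1 - cos (lform a x))) <= (\sum_(k < d) a k ^+ 2) * W / 2.
Proof.
rewrite -weight_lform -mulrA; apply: ler_wpM2l => //.
rewrite -RintegralZr//; last exact: weight_lform_integrable.
apply: le_Rintegral => //.
- exact: weight_cos_integrable.
- by have := integrableZr _ 2^-1 (weight_lform_integrable a); apply.
- by move=> x _; rewrite -mulrA; apply: ler_wpM2l => //; exact: one_cos_le.
Qed.

(** The multiplier of a radial weight at a is bounded below even when |a| is
    large compared with 1 / delta, where 1 - cos (a.x) is not comparable to
    (a.x)^2 on the support.  Let R be a rotation.  Since 1 - cos (x - y) is at
    most 2 (1 - cos x) + 2 (1 - cos y) and the multiplier takes the same value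
    at a and at R a, its value at e = a - R a is at most 4 times its value at a.
    As soon as the plane of R contains the i-th axis and |a_i| >= tau, the angle
    can be chosen so that |e| = tau; then |e.x| <= delta tau <= 1 on the
    support and the quadratic bound 1 - cos y >= y^2 / 8 applies at e. *)
Lemma weight_cos_ge a (i j : 'I_d) (delta tau : R) : i != j ->
  (forall x, w x != 0 -> sqnorm x <= delta ^+ 2) ->
  (delta * tau) ^+ 2 <= 1 -> 0 < tau -> tau ^+ 2 <= a i ^+ 2 ->
  tau ^+ 2 * W / 32 <= d%:R * \int[mu]_x (w x * (1 - cos (lform a x))).
Proof.
move=> ij wd dt t0 tai.
set P := a i ^+ 2 + a j ^+ 2.
have Pt : tau ^+ 2 <= P by rewrite (le_trans tai)// lerDl sqr_ge0.
have tau2 : 0 < tau ^+ 2 by rewrite exprn_gt0.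
(* The solution of 4 t^2 / (1 + t^2) * P = tau^2, the left-hand side being the
   squared length of e. *)
pose t := tau / Num.sqrt (4 * P - tau ^+ 2).
have D0 : 0 < 4 * P - tau ^+ 2 by lra.
have t2 : t ^+ 2 = tau ^+ 2 / (4 * P - tau ^+ 2).
  by rewrite expr_div_n sqr_sqrtr// ltW.
pose e k := (2 * t / (1 + t ^+ 2)) *
  (if k == i then a i * t - a j else if k == j then a i + a j * t else 0).
have sum_e : \sum_k e k ^+ 2 = tau ^+ 2.
  rewrite (sum_two _ ij) big1 ?addr0; last first.
    by move=> k /andP[/negbTE ki /negbTE kj]; rewrite /e ki kj mulr0 expr0n.
  rewrite /e eqxx eq_sym (negbTE ij) eqxx.
  have -> : (2 * t / (1 + t ^+ 2) * (a i * t - a j)) ^+ 2 +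
     (2 * t / (1 + t ^+ 2) * (a i + a j * t)) ^+ 2 =
     4 * t ^+ 2 / (1 + t ^+ 2) * P.
    by rewrite /P; field; rewrite gt_eqF// ltr_pwDl ?sqr_ge0.
  rewrite t2; field; rewrite !gt_eqF//; lra.
have linE x : lform e x = lform a x - lform a (plane_rot i j t x).
  rewrite lform_rotB// /lform (sum_two _ ij) big1 ?addr0; last first.
    by move=> k /andP[/negbTE ki /negbTE kj]; rewrite /e ki kj mulr0 mul0r.
  by rewrite /e eqxx eq_sym (negbTE ij) eqxx; ring.
have mcos : measurable_fun setT (fun x => w x * (1 - cos (lform a x))).
  by apply/measurable_EFinP; apply: measurable_int (weight_cos_integrable a).
set K := \int[mu]_x _.
have irot : mu.-integrable setT (EFin \o (fun x => w x * (1 - cos (lform a (plane_rot i j t x))))).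
  apply: (@weight_integrable _ (\sum_k a k ^+ 2)).
    apply: measurable_funB => //; apply: measurableT_comp.
      by apply: continuous_measurable_fun; exact: continuous_cos.
    by apply: (measurableT_comp (measurable_lform a)); case: (preserving_rot t ij).
  move=> x; rewrite ger0_norm ?one_cos_ge0//; apply: le_trans (one_cos_le _) _.
  rewrite -(sqnorm_rot t x ij).
  apply: le_trans (lform_sqr_le a _); have := sqr_ge0 (lform a (plane_rot i j t x)); lra.
have KE : K = \int[mu]_x (w x * (1 - cos (lform a (plane_rot i j t x)))).
  rewrite /K -(preserving_Rintegral (preserving_rot t ij) mcos).
  by apply: eq_Rintegral => x _; rewrite w_rot.
have le4 : \int[mu]_x (w x * (1 - cos (lform e x))) <= 4 * K.
  have -> : 4 * K = 2 * K + 2 * \int[mu]_x (w x * (1 - cos (lform a (plane_rot i j t x)))).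
    by rewrite -KE; ring.
  rewrite -RintegralZl//; last exact: weight_cos_integrable.
  rewrite -RintegralZl// -RintegralD//; last 2 first.
  - exact: (integrableZl _ 2 (weight_cos_integrable a)).
  - exact: (integrableZl _ 2 irot).
  apply: le_Rintegral => //.
  - exact: weight_cos_integrable.
  - exact: (integrableD _ (integrableZl _ 2 (weight_cos_integrable a))
                          (integrableZl _ 2 irot)).
  - move=> x _; rewrite linE mulrCA (mulrCA 2) -mulrDr.
    by apply: ler_wpM2l => //; exact: one_cosB_le.
have ge8 : (\int[mu]_x (w x * lform e x ^+ 2)) / 8 <= \int[mu]_x (w x * (1 - cos (lform e x))).
  rewrite -RintegralZr//; last exact: weight_lform_integrable.
  apply: le_Rintegral => //.
  - by have := integrableZr _ 8^-1 (weight_lform_integrable e); apply.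
  - exact: weight_cos_integrable.
  - move=> x _; rewrite -mulrA; have [->|wx] := eqVneq (w x) 0; first by rewrite !mul0r.
    apply: ler_wpM2l => //; apply: one_cos_ge.
    apply: le_trans (lform_sqr_le e x) _; rewrite sum_e.
    apply: le_trans dt; rewrite exprMn mulrC.
    by apply: ler_wpM2r; [exact: ltW|exact: wd].
have := weight_lform e; rewrite sum_e => wl.
have d0 : 0 <= d%:R :> R by [].
have := ler_wpM2l d0 le4; have := ler_wpM2l d0 ge8; rewrite mulrA wl; lra.
Qed.

End radial_weight.

(** * Bounds on the multipliers of the nonlocal operators *)

Section kernel_multipliers.
Variables (R : realType) (d : nat).
Local Notation mu := (@lebesgue_tuple R d).
Variables (delta : R) (om omt omh : R -> R) (m M : R).
Hypothesis d_gt1 : (1 < d)%N.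
Hypothesis delta_gt0 : 0 < delta.
Hypothesis m_gt0 : 0 < m.
Hypothesis hK : kernel_assumption d delta om omt omh m M.
Implicit Types (x : Rspace R d) (xi : freq d).

Let d_gt0 : (0 < d)%N. Proof. exact: ltnW. Qed.
Let dR_gt0 : 0 < d%:R :> R. Proof. by rewrite ltr0n. Qed.

Lemma enorm_ge0 x : 0 <= enorm x. Proof. exact: sqrtr_ge0. Qed.

Lemma rescale_measurable e (k : R -> R) : profile k ->
  measurable_fun setT (fun x : Rspace R d => rescale e delta k (enorm x)).
Proof.
move=> [mk _ _]; apply: measurable_funM => //.
apply: (@measurable_comp _ _ _ _ _ _ [set r : R | 0 <= r] k) => //.
- have -> : [set r : R | 0 <= r] = `[0, +oo[%classic.
    by apply/seteqP; split => r /=; rewrite in_itv/= andbT.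
  exact: measurable_itv.
- by move=> _ [x _ <-] /=; rewrite divr_ge0 ?enorm_ge0// ltW.
- by apply: measurable_funM => //; exact: measurable_enorm.
Qed.

Lemma rescale_ge0 e (k : R -> R) x : profile k -> 0 <= rescale e delta k (enorm x).
Proof.
move=> [_ k0 _]; rewrite mulr_ge0//; first by rewrite invr_ge0 exprn_ge0// ltW.
by rewrite k0// divr_ge0 ?enorm_ge0// ltW.
Qed.

Lemma rescale_support e (k : R -> R) x : profile k ->
  delta < enorm x -> rescale e delta k (enorm x) = 0.
Proof.
by move=> [_ _ k1] xd; rewrite /rescale k1 ?mulr0// ltr_pdivlMr// mul1r.
Qed.

Lemma enorm_plane_rot i j t x : i != j -> enorm (plane_rot i j t x) = enorm x.
Proof. by move=> ij; rewrite !enormE sqnorm_rot. Qed.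

Definition w_om x := om_ d delta om (enorm x).
Definition w_omt x := omt_ d delta omt (enorm x).
(** The profile is divided by |x| so that the first moment of the kernel becomes
    the second moment of this weight. *)
Definition w_omh x := omh_ d delta omh (enorm x) / enorm x.

Let pom : profile om. Proof. by case: hK. Qed.
Let pomt : profile omt. Proof. by case: hK. Qed.
Let pomh : profile omh. Proof. by case: hK. Qed.

Let m_om : measurable_fun setT w_om. Proof. exact: rescale_measurable. Qed.
Let m_omt : measurable_fun setT w_omt. Proof. exact: rescale_measurable. Qed.
Let m_omh : measurable_fun setT w_omh.
Proof.
apply: measurable_funM; first exact: rescale_measurable.
rewrite (_ : (fun x => _) = fun x => enorm x `^ (-1)); last first.
  by apply/funext => x; rewrite powR_inv1 ?enorm_ge0.
apply: (@measurableT_comp _ _ _ _ _ _ (@powR R ^~ (-1))); last exact: measurable_enorm.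
exact: measurable_powR.
Qed.

Let ge0_om x : 0 <= w_om x. Proof. exact: rescale_ge0. Qed.
Let ge0_omt x : 0 <= w_omt x. Proof. exact: rescale_ge0. Qed.
Let ge0_omh x : 0 <= w_omh x.
Proof. by rewrite divr_ge0 ?enorm_ge0//; exact: rescale_ge0. Qed.

Let rot_om i j t x : i != j -> w_om (plane_rot i j t x) = w_om x.
Proof. by move=> ij; rewrite /w_om enorm_plane_rot. Qed.
Let rot_omt i j t x : i != j -> w_omt (plane_rot i j t x) = w_omt x.
Proof. by move=> ij; rewrite /w_omt enorm_plane_rot. Qed.
Let rot_omh i j t x : i != j -> w_omh (plane_rot i j t x) = w_omh x.
Proof. by move=> ij; rewrite /w_omh enorm_plane_rot. Qed.

Let moment_om : (\int[mu]_x (w_om x * sqnorm x)%:E = (2 * d%:R)%:E)%E.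
Proof.
have [_ _ _ + _] := hK.
rewrite (_ : \int[mu]_x (om_ d delta om (enorm x) * enorm x ^+ 2)%:E
   = \int[mu]_x (w_om x * sqnorm x)%:E)%E; last first.
  by apply: eq_integral => x _; rewrite enorm_sqr.
case: (\int[mu]_x _)%E => [r| |].
- by rewrite -EFinM => -[hr]; congr (_%:E); lra.
- by rewrite mulry gtr0_sg ?mul1e// invr_gt0.
- by rewrite mulrNy gtr0_sg ?mul1e// invr_gt0.
Qed.

Let moment_omh : (\int[mu]_x (w_omh x * sqnorm x)%:E = d%:R%:E)%E.
Proof.
have [_ _ _ _ [<- _]] := hK; apply: eq_integral => x _; congr (_%:E).
rewrite -enorm_sqr /w_omh; have [->|x0] := eqVneq (enorm x) 0.
  by rewrite expr0n !mulr0.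
by field.
Qed.

(** The upper bound M serves to make the second moment finite. *)
Lemma moment_omt : exists2 W : R, m <= W &
  (\int[mu]_x (w_omt x * sqnorm x)%:E = W%:E)%E.
Proof.
have [_ _ _ _ [_]] := hK.
rewrite (_ : \int[mu]_x (omt_ d delta omt (enorm x) * enorm x ^+ 2)%:E
   = \int[mu]_x (w_omt x * sqnorm x)%:E)%E; last first.
  by apply: eq_integral => x _; rewrite enorm_sqr.
case: (\int[mu]_x _)%E => [r| |].
- by rewrite !lee_fin => /andP[mr _]; exists r.
- by move=> /andP[_]; rewrite leye_eq.
- by move=> /andP[]; rewrite leeNy_eq.
Qed.

Definition freqR xi (k : 'I_d) : R := (tnth xi k)%:~R.

Definition freq_sqr xi : R := \sum_(k < d) freqR xi k ^+ 2.

Lemma cball_Rintegral (g h : Rspace R d -> R) :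
  (forall x, delta < enorm x -> g x = 0) ->
  \int[mu]_(x in cball delta) (g x * h x) = \int[mu]_x (g x * h x).
Proof.
move=> g0; rewrite Rintegral_mkcond; apply: eq_Rintegral => x _.
rewrite patchE; case: ifPn => //; rewrite notin_setE /cball /= => /negP.
by rewrite -ltNge => xd; rewrite g0// mul0r.
Qed.

Lemma lambdaE xi :
  lambda_ delta om xi = \int[mu]_x (w_om x * (1 - cos (lform (freqR xi) x))).
Proof.
by rewrite /lambda_ cball_Rintegral// => x xd; exact: rescale_support.
Qed.

Lemma cE xi :
  c_ delta omt xi = \int[mu]_x (w_omt x * (1 - cos (lform (freqR xi) x))).
Proof.
by rewrite /c_ cball_Rintegral// => x xd; exact: rescale_support.
Qed.

Lemma bE xi i : b_ delta omh xi i ord0 =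
  \int[mu]_x (w_omh x * (tnth x i * sin (lform (freqR xi) x))).
Proof.
rewrite mxE -(cball_Rintegral (g := w_omh)).
  by apply: eq_Rintegral => x _; rewrite /w_omh -[dot xi x]/(lform (freqR xi) x); ring.
by move=> x xd; rewrite /w_omh /omh_ rescale_support// mul0r.
Qed.

Lemma support_sqnorm e k x : profile k -> rescale e delta k (enorm x) != 0 ->
  sqnorm x <= delta ^+ 2.
Proof.
move=> pk; have [xd _|xd] := leP (enorm x) delta; last first.
  by rewrite rescale_support// eqxx.
by rewrite -enorm_sqr ler_sqr ?nnegrE ?enorm_ge0// ltW.
Qed.

Lemma other_index (i : 'I_d) : exists j : 'I_d, i != j.
Proof.
have [i0|i0] := eqVneq i (Ordinal d_gt0).
  by exists (Ordinal d_gt1); rewrite i0.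
by exists (Ordinal d_gt0).
Qed.

Lemma freq_neq0 xi : xi <> freq0 d -> exists2 k, tnth xi k != 0 & 1 <= freqR xi k ^+ 2.
Proof.
move=> xi0; have /existsP[k k0] : [exists k, tnth xi k != 0].
  apply: contra_notT xi0; rewrite negb_exists => /forallP h.
  by apply/eq_from_tnth => k; rewrite tnth_mktuple; move/negPn/eqP : (h k).
exists k => //; rewrite /freqR -rmorphXn/= -[1]/(1%:~R) ler_int.
by move: k0; rewrite -sqrf_eq0; have := sqr_ge0 (tnth xi k); lia.
Qed.

Lemma freq_sqr_ge1 xi : xi <> freq0 d -> 1 <= freq_sqr xi.
Proof.
move=> /freq_neq0[k _ k1]; rewrite /freq_sqr (bigD1 k)//=.
by rewrite (le_trans k1)// lerDl; apply: sumr_ge0 => j _; exact: sqr_ge0.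
Qed.

(** The second moment is 2 d, and a nonzero frequency has a coordinate of
    absolute value at least 1: tau = 1 is allowed, because delta <= 1. *)
Lemma lambda_ge xi : delta <= 1 -> xi <> freq0 d -> 1 / 16 <= lambda_ delta om xi.
Proof.
move=> d1 /freq_neq0[i _ i1]; have [j ij] := other_index i.
have := @weight_cos_ge R d w_om _ m_om ge0_om rot_om moment_om (freqR xi) i j delta 1 ij.
rewrite -lambdaE expr1n mul1r mulr1 => /(_ (fun x => support_sqnorm pom)).
have dd : delta ^+ 2 <= 1 by rewrite expr_le1// ltW.
move=> /(_ dd ltr01 i1) h.
rewrite -(@ler_pM2l _ d%:R)//; apply: le_trans h; lra.
Qed.

Lemma lambda_le xi : lambda_ delta om xi <= freq_sqr xi.
Proof.
have := @weight_cos_le R d w_om _ m_om ge0_om rot_om moment_om (freqR xi).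
rewrite -lambdaE -/(freq_sqr xi) -(@ler_pM2l _ d%:R _ (lambda_ _ _ _))//; lra.
Qed.

Lemma lambda_ge0 xi : 0 <= lambda_ delta om xi.
Proof. by rewrite lambdaE; exact: weight_cos_ge0. Qed.

Lemma c_ge0 xi : 0 <= c_ delta omt xi.
Proof. by rewrite cE; exact: weight_cos_ge0. Qed.

Lemma large_coord xi : exists i, freq_sqr xi <= d%:R * freqR xi i ^+ 2.
Proof.
pose i := [arg max_(i > Ordinal d_gt0) freqR xi i ^+ 2]%O.
exists i; rewrite mulr_natl -[X in _ *+ X]card_ord -sumr_const.
apply: ler_sum => k _; rewrite /i; case: arg_maxP => // l _; exact.
Qed.

(** Some coordinate satisfies |xi_i| >= |xi| / sqrt d >= 1 / (delta sqrt d), and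
    this last number is a legitimate tau. *)
Lemma c_ge xi : 1 <= delta ^+ 2 * freq_sqr xi ->
  m / (32 * d%:R ^+ 2) <= delta ^+ 2 * c_ delta omt xi.
Proof.
move=> dxi; have [i hi] := large_coord xi; have [j ij] := other_index i.
have [W mW hW] := moment_omt.
have := @weight_cos_ge R d w_omt _ m_omt ge0_omt rot_omt hW (freqR xi) i j delta
  (delta * Num.sqrt d%:R)^-1 ij.
have d2 : 0 < delta ^+ 2 by rewrite exprn_gt0.
have tau2 : (delta * Num.sqrt d%:R)^-1 ^+ 2 = (delta ^+ 2 * d%:R)^-1.
  by rewrite exprVn exprMn sqr_sqrtr.
rewrite -cE exprMn tau2 => /(_ (fun x => support_sqnorm pomt)) h.
have {}h : (delta ^+ 2 * d%:R)^-1 * W / 32 <= d%:R * c_ delta omt xi.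
  apply: h.
  - rewrite invfM mulrA divff ?gt_eqF// mul1r invf_le1// ler1n//.
  - by rewrite invr_gt0 mulr_gt0// sqrtr_gt0.
  - rewrite -[leLHS]mul1r ler_pdivrMr ?mulr_gt0//.
    apply: le_trans dxi _; rewrite [leRHS]mulrC -[leRHS]mulrA.
    by apply: ler_wpM2l; [exact: ltW|].
have -> : delta ^+ 2 * c_ delta omt xi =
    (delta ^+ 2 / d%:R) * (d%:R * c_ delta omt xi).
  by field; rewrite gt_eqF.
apply: (@le_trans _ _ (delta ^+ 2 / d%:R * ((delta ^+ 2 * d%:R)^-1 * W / 32))).
  have -> : delta ^+ 2 / d%:R * ((delta ^+ 2 * d%:R)^-1 * W / 32) = W / (32 * d%:R ^+ 2).
    by field; rewrite !gt_eqF.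
  by rewrite ler_pM2r// invr_gt0 mulr_gt0// exprn_gt0.
by apply: ler_wpM2l => //; rewrite divr_ge0 ?ltW.
Qed.

Lemma vnorm_sqr (v : 'cV[R]_d) : vnorm v ^+ 2 = \sum_(i < d) v i ord0 ^+ 2.
Proof. by rewrite sqr_sqrtr// sumr_ge0// => i _; exact: sqr_ge0. Qed.

Lemma b_integrable (a : 'I_d -> R) i :
  mu.-integrable setT (EFin \o (fun x => w_omh x * (tnth x i * sin (lform a x)))).
Proof.
apply: (@weight_integrable R d _ _ m_omh ge0_omh moment_omh _ (1 + \sum_k a k ^+ 2)).
  apply: measurable_funM; first exact: measurable_tnth.
  apply: measurableT_comp; last exact: measurable_lform.
  by apply: continuous_measurable_fun; exact: continuous_sin.
move=> x; rewrite normrM; have := lform_sqr_le a x; have := tnth_sqr_le i x.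
have := normr_sin_le (lform a x); have := normr_ge0 (sin (lform a x)).
rewrite -(real_normK (num_real (tnth x i))) -(real_normK (num_real (lform a x))).
set u := `|tnth x i|; set v := `|lform a x|; set s := `|sin _|.
have u0 : 0 <= u by exact: normr_ge0.
have v0 : 0 <= v by exact: normr_ge0.
move=> s0 sv hu hv; rewrite mulrDl mul1r.
have : 0 <= (u - v) ^+ 2 by exact: sqr_ge0.
have : u * s <= u * v by exact: ler_wpM2l.
nra.
Qed.

(** On the support |xi.x| <= delta |xi| <= 1, so that (xi.x) sin (xi.x) is at
    least (xi.x)^2 / 2; isotropy evaluates the integral of the latter. *)
Lemma b_dot_ge xi : delta ^+ 2 * freq_sqr xi <= 1 ->
  freq_sqr xi / 2 <= \sum_(i < d) freqR xi i * b_ delta omh xi i ord0.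
Proof.
move=> dxi; set a := freqR xi.
have -> : \sum_(i < d) a i * b_ delta omh xi i ord0 =
    \int[mu]_x (w_omh x * (lform a x * sin (lform a x))).
  rewrite (eq_bigr (fun i => \int[mu]_x (a i * (w_omh x * (tnth x i * sin (lform a x)))))).
    rewrite -Rintegral_sum//; last first.
      by move=> i; exact: (integrableZl _ (a i) (b_integrable a i)).
    apply: eq_Rintegral => x _; rewrite {2}/lform mulr_suml mulr_sumr.
    by apply: eq_bigr => i _; ring.
  by move=> i _; rewrite bE RintegralZl//; exact: b_integrable.
have := @weight_lform R d _ _ m_omh ge0_omh rot_omh moment_omh a.
rewrite -/(freq_sqr xi) mulrC => /(mulIf (lt0r_neq0 dR_gt0)) <-.
rewrite -RintegralZr//; last exact: (@weight_lform_integrable R d _ _ m_omh ge0_omh moment_omh).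
apply: le_Rintegral => //.
- have := integrableZr measurableT 2^-1
   (@weight_lform_integrable R d _ _ m_omh ge0_omh moment_omh a); exact.
- rewrite (_ : (fun x => _) = fun x => \sum_(i < d) a i * (w_omh x * (tnth x i * sin (lform a x)))).
    by apply: integrable_bigsum => // i; exact: (integrableZl _ (a i) (b_integrable a i)).
  apply/funext => x; rewrite {1}/lform mulr_suml mulr_sumr.
  by apply: eq_bigr => i _; ring.
move=> x _; rewrite -mulrA; have [->|wx] := eqVneq (w_omh x) 0; first by rewrite !mul0r.
apply: ler_wpM2l => //; apply: mul_sin_ge.
apply: le_trans (lform_sqr_le a x) _; rewrite -/(freq_sqr xi).
apply: le_trans dxi; rewrite mulrC; apply: ler_wpM2r.
  by apply: sumr_ge0 => k _; exact: sqr_ge0.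
apply: (@support_sqnorm d.+1 omh) => //.
by apply: contra_neq wx => wx; rewrite /w_omh /omh_ wx mul0r.
Qed.

Lemma b_ge xi : xi <> freq0 d -> delta ^+ 2 * freq_sqr xi <= 1 ->
  freq_sqr xi / 4 <= vnorm (b_ delta omh xi) ^+ 2.
Proof.
move=> xi0 dxi; have x1 := freq_sqr_ge1 xi0.
have h := b_dot_ge dxi.
have := sum_Cauchy_Schwarz (freqR xi) (fun i => b_ delta omh xi i ord0).
rewrite -vnorm_sqr -/(freq_sqr xi) => cs.
have x0 : 0 < freq_sqr xi by apply: lt_le_trans x1.
rewrite -(ler_pM2l x0); apply: le_trans cs.
have -> : freq_sqr xi * (freq_sqr xi / 4) = (freq_sqr xi / 2) ^+ 2 by field.
by rewrite ler_sqr// nnegrE; [rewrite divr_ge0// ltW|apply: le_trans h; rewrite divr_ge0// ltW].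
Qed.

(** Two regimes.  If delta |xi| <= 1, the term |b|^2 alone makes q at least
    |xi|^2 / 4, which controls lambda <= |xi|^2.  If delta |xi| >= 1, the
    stabilization delta^2 c is at least m / (32 d^2) >= m / 288, so that q is at
    least m / 288 times lambda.  In both cases lambda / q is bounded, and
    lambda >= 1 / 16 turns this into a bound on 1 / q. *)
Lemma multiplier_bounds xi : (d <= 3)%N -> delta <= 1 -> xi <> freq0 d ->
  let K := 16 * (1 + 288 / m) in
  [/\ 1 / 16 <= lambda_ delta om xi, 0 < q_ delta om omt omh xi,
      (q_ delta om omt omh xi)^-1 <= K &
      lambda_ delta om xi / q_ delta om omt omh xi <= K].
Proof.
move=> d3 d1 xi0 /=; have l16 := lambda_ge d1 xi0.
have kK : 288 / m * (m / 288) = 1 by field; rewrite gt_eqF.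
have Kge : 0 <= 288 / m by apply: divr_ge0; [exact: ler0n|exact: ltW].
have kl := lambda_le xi.
set l := lambda_ delta om xi in l16 kl *; set q := q_ _ _ _ _ _.
have qE : q = vnorm (b_ delta omh xi) ^+ 2 + delta ^+ 2 * c_ delta omt xi * l by [].
have dc0 : 0 <= delta ^+ 2 * c_ delta omt xi by rewrite mulr_ge0 ?c_ge0// sqr_ge0.
have v0 : 0 <= vnorm (b_ delta omh xi) ^+ 2 by exact: sqr_ge0.
have x1 := freq_sqr_ge1 xi0.
set k := 288 / m in kK Kge *.
have l0 : 0 <= l by lra.
have dcl : 0 <= delta ^+ 2 * c_ delta omt xi * l by exact: mulr_ge0.
suff [q0 [q1 q2]] : 0 < q /\ 1 <= 16 * (1 + k) * q /\ l <= 16 * (1 + k) * q.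
  by split => //; rewrite ?ler_pdivrMr// -[q^-1]mul1r ler_pdivrMr.
rewrite -!mulrA mulrDl mul1r; have [dxi|/ltW dxi] := leP (delta ^+ 2 * freq_sqr xi) 1.
- have bge := b_ge xi0 dxi.
  have qge : freq_sqr xi / 4 <= q by lra.
  have q0 : 0 < q by lra.
  (* Here q >= |xi|^2 / 4 >= 1 / 4, and lambda <= |xi|^2 <= 4 q. *)
  have := mulr_ge0 Kge (ltW q0); lra.
- have cge : m / 288 <= delta ^+ 2 * c_ delta omt xi.
    apply: le_trans (c_ge dxi); rewrite ler_pM2l// lef_pV2 ?posrE ?mulr_gt0 ?exprn_gt0//.
    have : d%:R ^+ 2 <= 3%:R ^+ 2 :> R by rewrite ler_sqr ?nnegrE// ler_nat.
    lra.
  have k0 : 0 < m / 288 by apply: divr_gt0 => //; rewrite ltr0n.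
  have qge : m / 288 * l <= q.
    by rewrite qE (le_trans (ler_wpM2r l0 cge))// lerDr.
  have q0 : 0 < q by apply: lt_le_trans qge; rewrite mulr_gt0//; lra.
  have := ler_wpM2l Kge qge.
  have -> : k * (m / 288 * l) = l by rewrite mulrA kK mul1r.
  lra.
Qed.

End kernel_multipliers.

(** * Integrals of cosines over the period cell *)

Section cosines_on_the_cell.
Variable R : realType.
Local Notation pi := (@pi R).
Local Notation Cell := (@cell R _).

Lemma measurable_cell n : measurable (@cell R n).
Proof.
have -> : @cell R n = \bigcap_(i in [set: 'I_n]) ((fun x => tnth x i) @^-1` `]-pi, pi[).
  by apply/seteqP; split=> x h i; [move=> _|]; have := h i; rewrite /= in_itv/=; apply.
apply: fin_bigcap_measurable => [|i _]; first exact: finite_finset.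
by rewrite -[X in measurable X]setTI; exact: measurable_tnth.
Qed.

Lemma measurable_dot n (xi : freq n) : measurable_fun setT (@dot R n xi).
Proof.
by apply: measurable_sum => k; apply: measurable_funM => //; exact: measurable_tnth.
Qed.

Lemma dot_freq0 n (x : Rspace R n) : dot (freq0 n) x = 0.
Proof. by rewrite /dot big1// => i _; rewrite tnth_mktuple mul0r. Qed.

Lemma measurable_cos_phase n (xi : freq n) (theta : R) :
  measurable_fun setT (fun x : Rspace R n => cos (dot xi x + theta)).
Proof.
apply: measurableT_comp.
  by apply: continuous_measurable_fun; exact: continuous_cos.
by apply: measurable_funD => //; exact: measurable_dot.
Qed.

Lemma cos_integer_period (k : int) (y : R) : cos (y + 2 * pi * k%:~R) = cos y.
Proof.
have nat_period (n : nat) z : cos (z + 2 * pi * n%:R) = cos z.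
  have -> : z + 2 * pi * n%:R = z + (pi *+ 2) *+ n.
    by rewrite -[in RHS]mulr_natr -[in RHS]mulr_natl; ring.
  by rewrite (periodicn (@cosD2pi R)).
case: k => n; first exact: nat_period.
rewrite NegzE -(nat_period n.+1); congr cos; rewrite rmorphN/=; ring.
Qed.

Lemma sin_cos_shift (y : R) : sin y = cos (y - pi / 2).
Proof. by rewrite cosBpihalf. Qed.

Lemma sin_integer_period (k : int) (y : R) : sin (y + 2 * pi * k%:~R) = sin y.
Proof.
by rewrite !sin_cos_shift -[in RHS](cos_integer_period k); congr cos; ring.
Qed.

Lemma continuous_cos_affine (k theta : R) : continuous (fun a : R => 1 + cos (k * a + theta)).
Proof.
have h : continuous (fun a : R => k * a + theta).
  by move=> a; apply: cvgD; [exact: mulrl_continuous|exact: cvg_cst].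
have h2 : continuous (cos \o (fun a : R => k * a + theta)).
  by move=> a; apply: continuous_comp; [exact: h|exact: continuous_cos].
by move=> a; apply: cvgD; [exact: cvg_cst|exact: h2].
Qed.

Lemma is_derive_sin_affine (k theta a : R) : k != 0 ->
  is_derive a 1 (fun a => a + k^-1 * sin (k * a + theta)) (1 + cos (k * a + theta)).
Proof.
move=> k0.
have h : is_derive a 1 (fun a : R => k * a + theta) k.
  have := is_deriveD (is_deriveZ k (is_derive_id a (1 : R))) (is_derive_cst theta a (1 : R)).
  by rewrite addr0 /GRing.scale /= mulr1.
have h2 := @is_derive1_comp R sin (fun a => k * a + theta) a _ _ (is_derive_sin _) h.
have := is_deriveD (is_derive_id a (1 : R)) (is_deriveZ (k^-1) h2).
by rewrite /GRing.scale/= mulrCA mulVf// mulr1.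
Qed.

(** The constant 1 makes the integrand non-negative, as Tonelli's theorem
    requires in the next lemmas. *)
Lemma integral_cos_interval (k : int) (theta : R) :
  (\int[lebesgue_measure]_(a in `](- pi)%R, pi[) (1 + cos (k%:~R * a + theta))%:E =
   (2 * pi + (if k == 0 then 2 * pi * cos theta else 0))%:E)%E.
Proof.
have pipi : - pi < pi by rewrite gtrN ?pi_gt0.
have cc := @continuous_cos_affine k%:~R theta.
have mc : measurable_fun setT (fun a : R => (1 + cos (k%:~R * a + theta))%:E).
  by apply/measurable_EFinP; exact: continuous_measurable_fun.
rewrite integral_itv_bndo_bndc; last exact: measurable_funTS.
rewrite integral_itv_obnd_cbnd; last exact: measurable_funTS.
have [k0|k0] := eqVneq k 0.
  rewrite k0; under eq_integral => a _ do rewrite mulr0z mul0r add0r.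
  rewrite integral_cst//= lebesgue_measure_itv/= lte_fin pipi -EFinD -EFinM.
  by congr (_%:E); ring.
have kR : k%:~R != 0 :> R by rewrite intr_eq0.
pose F (a : R) : R := a + k%:~R^-1 * sin (k%:~R * a + theta).
have dF (a : R) : is_derive a 1 F (1 + cos (k%:~R * a + theta)).
  exact: (is_derive_sin_affine theta a kR).
rewrite (@continuous_FTC2 _ _ F)//.
- rewrite -EFinB addr0; congr (_%:E); rewrite /F mulrN.
  have -> : sin (k%:~R * pi + theta) = sin (- (k%:~R * pi) + theta).
    by rewrite -(sin_integer_period k (- (k%:~R * pi) + theta)); congr sin; ring.
  ring.
- by apply: continuous_subspaceT => a; exact: cc.
- have cF : continuous F.
    by move=> a; apply: differentiable_continuous; apply/derivable1_diffP; case: (dF a).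
  split.
  + by move=> a _; case: (dF a).
  + exact/cvg_at_right_filter/cF.
  + exact/cvg_at_left_filter/cF.
- by move=> a _; rewrite derive1E; case: (dF a).
Qed.

Lemma cell_cons n (a : R) (t : Rspace R n) :
  @cell R n.+1 (tuple_cons (a : measurableTypeR R, t)) <-> (- pi < a < pi) /\ Cell t.
Proof.
split=> [h|[ha ht] i].
  split; first by have := h ord0; rewrite tnth0.
  by move=> i; have := h (lift ord0 i); rewrite tnthS.
by case: (unliftP ord0 i) => [j ->|->]; rewrite ?tnthS ?tnth0.
Qed.

Lemma integral_cell_cons n (F : Rspace R n.+1 -> \bar R) :
  measurable_fun setT F -> (forall x, 0 <= F x)%E ->
  (\int[lebesgue_tuple R n.+1]_(x in Cell) F x =
   \int[lebesgue_measure]_(a in `](- pi)%R, pi[)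
     \int[lebesgue_tuple R n]_(t in Cell) F (tuple_cons (a, t)))%E.
Proof.
move=> mF F0; rewrite integral_mkcond tonelli_cons; last 2 first.
- by apply: (measurable_restrictT F (@measurable_cell _)).1; exact: measurable_funTS.
- by move=> x; rewrite patchE; case: ifP.
rewrite fubini_tonelli1; last 2 first.
- apply: measurableT_comp; last exact: measurable_tuple_cons.
  by apply: (measurable_restrictT F (@measurable_cell _)).1; exact: measurable_funTS.
- by move=> x; rewrite patchE; case: ifP.
rewrite [RHS]integral_mkcond; apply: eq_integral => a _; rewrite /fubini_F patchE.
case: ifPn => [|] ha.
  rewrite [RHS]integral_mkcond; apply: eq_integral => t _; rewrite !patchE.
  suff -> : (tuple_cons (a, t) \in Cell) = (t \in Cell) by [].
  apply/idP/idP; rewrite !inE cell_cons; first by case.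
  by move=> ht; split => //; move: ha; rewrite inE/= in_itv.
apply: integral0_eq => t _; rewrite patchE; case: ifPn => //.
by rewrite inE cell_cons => -[ha' _]; move: ha; rewrite notin_setE/= in_itv/= ha'.
Qed.

Lemma freq0_cons n (xi : freq n.+1) :
  (xi == freq0 n.+1) = (tnth xi ord0 == 0) && ([tuple of behead xi] == freq0 n).
Proof.
apply/eqP/andP => [->|[/eqP x0 /eqP xs]].
  split; first by rewrite tnth_mktuple.
  apply/eqP/eq_from_tnth => i.
  by rewrite tnth_behead !tnth_mktuple.
apply/eq_from_tnth => i; rewrite tnth_mktuple.
case: (unliftP ord0 i) => [j ->|-> //].
have := congr1 (fun t => tnth t j) xs; rewrite tnth_mktuple => <-.
by rewrite tnth_behead; congr tnth; apply/val_inj; rewrite /= inordK // ltnS.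
Qed.

Lemma dot_cons n (xi : freq n.+1) (a : R) (t : Rspace R n) :
  dot xi (tuple_cons (a : measurableTypeR R, t)) =
  (tnth xi ord0)%:~R * a + dot [tuple of behead xi] t.
Proof.
rewrite /dot big_ord_recl tnth0; congr (_ + _); apply: eq_bigr => i _.
rewrite tnthS tnth_behead; congr ((tnth _ _)%:~R * _).
by apply/val_inj; rewrite /= inordK // ltnS.
Qed.

(** Integrating over the first coordinate a, which enters the phase as
    xi_0 a + theta, is the one-dimensional case with theta shifted; the phase
    theta is general so that the induction goes through. *)
Lemma integral_one_cos_cell n (xi : freq n) (theta : R) :
  (\int[lebesgue_tuple R n]_(x in Cell) (1 + cos (dot xi x + theta))%:E =
   ((2 * pi) ^+ n + (if xi == freq0 n then (2 * pi) ^+ n * cos theta else 0))%:E)%E.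
Proof.
elim: n xi theta => [|n IH] xi theta.
  have -> : xi = freq0 0 by apply/eq_from_tnth => -[].
  rewrite eqxx expr0 mul1r /= integral_dirac//; last 2 first.
  - exact: (@measurable_cell _).
  - by apply/measurable_EFinP; apply: measurable_funTS; apply: measurable_funD => //;
      exact: measurable_cos_phase.
  rewrite diracE mem_set ?mul1e; last by case.
  by rewrite /dot big_ord0 add0r.
rewrite integral_cell_cons; last 2 first.
- by apply/measurable_EFinP; apply: measurable_funD => //; exact: measurable_cos_phase.
- by move=> x; rewrite lee_fin -lerBlDl sub0r cos_geN1.
(* The inner integral keeps xi_0 a + theta as its phase. *)
under eq_integral => a _ do under eq_integral => t _ do rewrite dot_cons addrAC addrC.
under eq_integral do rewrite IH.
rewrite freq0_cons; case: (_ == freq0 n); rewrite ?andbT ?andbF.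
  under eq_integral do rewrite -[X in (X + _)%:E]mulr1 -mulrDr EFinM.
  rewrite ge0_integralZl_EFin//.
  + rewrite integral_cos_interval -EFinM; congr (_%:E).
    by case: (_ == 0); rewrite exprS; ring.
  + by apply/measurable_EFinP; apply: measurable_funTS;
      apply: continuous_measurable_fun; exact: continuous_cos_affine.
  + by rewrite exprn_ge0// mulr_ge0// pi_ge0.
under eq_integral do rewrite addr0.
rewrite integral_cst//= lebesgue_measure_itv/= lte_fin gtrN ?pi_gt0// -EFinD -EFinM.
by congr (_%:E); rewrite exprS; ring.
Qed.

Lemma cell_measure n : lebesgue_tuple R n Cell = ((2 * pi) ^+ n)%:E.
Proof.
have := integral_one_cos_cell (freq0 n) (pi / 2); rewrite eqxx cos_pihalf mulr0 addr0 => <-.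
rewrite -[LHS]mul1e -integral_cst//; last exact: (@measurable_cell _).
by apply: eq_integral => x _; rewrite dot_freq0 add0r cos_pihalf addr0.
Qed.

Lemma bounded_integrable n (h : Rspace R n -> R) (C : R) :
  measurable_fun Cell h -> (forall x, Cell x -> `|h x| <= C) ->
  (lebesgue_tuple R n).-integrable Cell (EFin \o h).
Proof.
move=> mh hC; apply: measurable_bounded_integrable => //.
- exact: (@measurable_cell _).
- by have := ltry ((2 * pi) ^+ n); rewrite -cell_measure.
- exists C; split; first exact: num_real.
  by move=> y Cy x cx /=; rewrite (le_trans (hC x cx))// ltW.
Qed.

Lemma integral_cos_cell n (xi : freq n) (theta : R) :
  \int[lebesgue_tuple R n]_(x in Cell) cos (dot xi x + theta) =
  if xi == freq0 n then (2 * pi) ^+ n * cos theta else 0.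
Proof.
have i1 : (lebesgue_tuple R n).-integrable Cell (EFin \o (fun=> 1 : R)).
  by apply: (@bounded_integrable _ _ 1) => // x _; rewrite normr1.
have ic : (lebesgue_tuple R n).-integrable Cell (EFin \o (fun x => cos (dot xi x + theta))).
  apply: (@bounded_integrable _ _ 1); last by move=> x _; exact: cos_max.
  apply: measurable_funTS; exact: measurable_cos_phase.
have := RintegralD (@measurable_cell _) i1 ic.
rewrite [X in X = _]/Rintegral integral_one_cos_cell Rintegral_cst; last exact: (@measurable_cell _).
have -> : fine (lebesgue_tuple R n Cell) = (2 * pi) ^+ n by rewrite (@cell_measure n).
by rewrite /= mul1r => h; exact: (addrI _ (esym h)).
Qed.

End cosines_on_the_cell.

(** * Completeness of the space of square-integrable functions *)

Section square_integrable_functions.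
Context d (T : measurableType d) (R : realType).
Variable mu : {measure set T -> \bar R}.
Variables (D : set T) (mD : measurable D) (Doo : (mu D < +oo)%E).
Implicit Types u v w : T -> R.

Definition sqint v : Prop :=
  measurable_fun D v /\ mu.-integrable D (EFin \o (fun x => v x ^+ 2)).

Lemma eq_sqint u v : {in D, u =1 v} -> sqint u -> sqint v.
Proof.
move=> uv [mu_ iu]; split; first by apply: eq_measurable_fun mu_.
by apply: eq_integrable iu => // x xD /=; rewrite uv.
Qed.

Lemma sqint_mul_integrable u v : sqint u -> sqint v ->
  mu.-integrable D (EFin \o (fun x => u x * v x)).
Proof.
move=> [mu_ iu] [mv iv]; apply: le_integrable (integrableD mD iu iv) => //.
  by apply/measurable_EFinP; exact: measurable_funM.
move=> x _; rewrite /= lee_fin [leRHS]ger0_norm ?addr_ge0 ?sqr_ge0//.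
rewrite normrM -(real_normK (num_real (u x))) -(real_normK (num_real (v x))).
have := sqr_ge0 (`|u x| - `|v x|); rewrite sqrrB.
have := normr_ge0 (u x); have := normr_ge0 (v x); nra.
Qed.

Lemma bounded_sqint v (C : R) : measurable_fun D v ->
  (forall x, D x -> `|v x| <= C) -> sqint v.
Proof.
move=> mv vC; split => //; apply: measurable_bounded_integrable => //.
  exact: measurable_funX.
exists (C ^+ 2); split; first exact: num_real.
move=> y Cy x Dx /=; rewrite normrX (le_trans _ (ltW Cy))//.
by rewrite lerXn2r ?nnegrE// ?vC// (le_trans _ (vC x Dx)).
Qed.

Lemma sqint_cst (c : R) : sqint (fun=> c).
Proof. by apply: (@bounded_sqint _ `|c|). Qed.

Lemma sqint_integrable v : sqint v -> mu.-integrable D (EFin \o v).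
Proof.
move=> sv; have := sqint_mul_integrable sv (sqint_cst 1).
by apply: eq_integrable => // x _ /=; rewrite mulr1.
Qed.

Lemma sqintD u v : sqint u -> sqint v -> sqint (fun x => u x + v x).
Proof.
move=> su sv; have iuv := sqint_mul_integrable su sv.
have [mu_ iu] := su; have [mv iv] := sv.
split; first exact: measurable_funD.
have := integrableD mD (integrableD mD iu iv) (integrableD mD iuv iuv).
apply: eq_integrable => // x _ /=; rewrite -!EFinD; congr (_%:E); ring.
Qed.

Lemma sqintZ (c : R) v : sqint v -> sqint (fun x => c * v x).
Proof.
move=> [mv iv]; split; first exact: measurable_funM.
have := integrableZl mD (c ^+ 2) iv.
by apply: eq_integrable => // x _ /=; rewrite exprMn.
Qed.

Lemma sqintB u v : sqint u -> sqint v -> sqint (fun x => u x - v x).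
Proof.
move=> su sv; apply: eq_sqint (sqintD su (sqintZ (-1) sv)) => x _.
by rewrite mulN1r.
Qed.

Lemma sqint_sum I (s : seq I) (f : I -> T -> R) : (forall i, sqint (f i)) ->
  sqint (fun x => \sum_(i <- s) f i x).
Proof.
move=> sf; elim: s => [|i s IH].
  by apply: eq_sqint (sqint_cst 0) => x _; rewrite big_nil.
by apply: eq_sqint (sqintD (sf i) IH) => x _; rewrite big_cons.
Qed.

Lemma sqint_sqr v : sqint v -> mu.-integrable D (EFin \o (fun x => v x ^+ 2)).
Proof. by case. Qed.

(** The Cauchy-Schwarz inequality in the form of Young's inequality: choosing
    the weight e replaces square roots. *)
Lemma Rintegral_mul_le u v (e : R) : 0 < e -> sqint u -> sqint v ->
  `|\int[mu]_(x in D) (u x * v x)| <=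
  e * \int[mu]_(x in D) u x ^+ 2 + e^-1 * \int[mu]_(x in D) v x ^+ 2.
Proof.
move=> e0 su sv; have iuv := sqint_mul_integrable su sv.
have iu := sqint_sqr su; have iv := sqint_sqr sv.
apply: le_trans (le_normr_Rintegral mD iuv) _.
rewrite -RintegralZl// -RintegralZl// -RintegralD//; last 2 first.
- exact: (integrableZl mD e iu).
- exact: (integrableZl mD e^-1 iv).
apply: le_Rintegral => //.
- exact: (integrable_norm iuv).
- exact: (integrableD mD (integrableZl mD e iu) (integrableZl mD e^-1 iv)).
move=> x _; rewrite normrM -(real_normK (num_real (u x))) -(real_normK (num_real (v x))).
set a := `|u x|; set b := `|v x|.
have a0 : 0 <= a by exact: normr_ge0.
have b0 : 0 <= b by exact: normr_ge0.
have -> : e * a ^+ 2 + e^-1 * b ^+ 2 = e^-1 * (e * a - b) ^+ 2 + 2 * (a * b).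
  by field; rewrite gt_eqF.
have : 0 <= e^-1 * (e * a - b) ^+ 2 by rewrite mulr_ge0 ?sqr_ge0// invr_ge0 ltW.
have : 0 <= a * b by exact: mulr_ge0.
lra.
Qed.

Lemma sum_half_pow n : \sum_(0 <= k < n) (2^-1 : R) ^+ k <= 2.
Proof.
suff -> : \sum_(0 <= k < n) (2^-1 : R) ^+ k = 2 - 2 * 2^-1 ^+ n.
  by rewrite gerBl mulr_ge0// exprn_ge0.
elim: n => [|n IH]; first by rewrite big_geq// expr0; ring.
by rewrite big_nat_recr//= IH exprS; field.
Qed.

Lemma abs_summable_cvg (h : nat -> R) :
  (\sum_(0 <= k <oo) `|h k|%:E < +oo)%E -> cvgn (series h).
Proof.
move=> hoo; apply: normed_cvg; apply: nondecreasing_is_cvgn.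
  by apply: nondecreasing_series => k _ _; exact: normr_ge0.
exists (fine (\sum_(0 <= k <oo) `|h k|%:E)%E) => _ [n _ <-] /=.
rewrite -lee_fin fineK; last first.
  by rewrite ge0_fin_numE//; apply: nneseries_ge0 => k _ _; rewrite lee_fin.
rewrite /series/= -sumEFin; apply: nneseries_lim_ge => k _ _.
by rewrite lee_fin.
Qed.

(** The increments have mean absolute value O(2^-k), because
    |h| <= 2^-(k+1) + 2^(k-1) h^2; by monotone convergence their sum is finite
    almost everywhere, and the telescoping series converges there. *)
Lemma ae_limit_sqint (f : nat -> T -> R) : (forall n, sqint (f n)) ->
  (forall k, \int[mu]_(x in D) (f k.+1 x - f k x) ^+ 2 <= (4^-1) ^+ k) ->
  exists w, measurable_fun D w /\
    {ae mu, forall x, D x -> f ^~ x @ \oo --> w x}.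
Proof.
move=> sf hf; pose h k x := f k.+1 x - f k x.
have sh k : sqint (h k) by exact: sqintB.
pose c : R := (fine (mu D) + 1) / 2.
have mh k : measurable_fun D (fun x => `|h k x|%:E).
  by apply/measurable_EFinP; apply: measurableT_comp => //; case: (sh k).
have hk k : (\int[mu]_(x in D) `|h k x|%:E <= (c * 2^-1 ^+ k)%:E)%E.
  have iN : mu.-integrable D (EFin \o (fun x => `|h k x|)).
    exact: (integrable_norm (sqint_integrable (sh k))).
  have -> : (\int[mu]_(x in D) `|h k x|%:E)%E = (\int[mu]_(x in D) `|h k x|)%:E.
    by rewrite fineK//; exact: integrable_fin_num.
  rewrite lee_fin.
  have i1 : mu.-integrable D (EFin \o (fun=> 2^-1 * 2^-1 ^+ k : R)).
    exact: sqint_integrable (sqint_cst _).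
  have i2 := integrableZl mD (2^-1 * 2 ^+ k) (sqint_sqr (sh k)).
  apply: (@le_trans _ _ (\int[mu]_(x in D)
      (2^-1 * 2^-1 ^+ k + 2^-1 * 2 ^+ k * h k x ^+ 2))).
    apply: le_Rintegral => //; first exact: (integrableD mD i1 i2).
    move=> x _; rewrite -(real_normK (num_real (h k x))); set a := `|h k x|.
    have p0 : 0 < (2 : R) ^+ k by rewrite exprn_gt0.
    have -> : 2^-1 * 2^-1 ^+ k + 2^-1 * 2 ^+ k * a ^+ 2 =
        a + 2^-1 * 2^-1 ^+ k * (1 - 2 ^+ k * a) ^+ 2.
      by rewrite exprVn; field; rewrite gt_eqF.
    rewrite lerDl; apply: mulr_ge0; last exact: sqr_ge0.
    by apply: mulr_ge0; [|apply: exprn_ge0]; rewrite invr_ge0 ler0n.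
  rewrite RintegralD// Rintegral_cst// RintegralZl//; last exact: sqint_sqr.
  have hf2 : \int[mu]_(x in D) h k x ^+ 2 <= (2^-1 ^+ k) ^+ 2.
    apply: le_trans (hf k) _; rewrite (_ : 4^-1 = 2^-1 ^+ 2); last by field.
    by rewrite -!exprM mulnC.
  have p0 : 0 < (2 : R) ^+ k by rewrite exprn_gt0.
  have := ler_wpM2l (ltW p0) hf2.
  have -> : (2 : R) ^+ k * (2^-1 ^+ k) ^+ 2 = 2^-1 ^+ k.
    by rewrite exprVn; field; rewrite gt_eqF.
  rewrite /c; lra.
have sumoo : (\int[mu]_(x in D) \sum_(0 <= k <oo) `|h k x|%:E < +oo)%E.
  rewrite (@integral_nneseries _ _ _ _ _ _ (fun k x => `|h k x|%:E))//.
  apply: (@le_lt_trans _ _ (c * 2)%:E); last exact: ltry.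
  apply: lime_le.
    by apply: is_cvg_nneseries => k _ _; apply: integral_ge0.
  apply: nearW => n; apply: le_trans (lee_sum _ (fun k _ => hk k)) _.
  rewrite sumEFin lee_fin -mulr_sumr; apply: ler_wpM2l; last exact: sum_half_pow.
  by rewrite /c divr_ge0// addr_ge0// fine_ge0.
have iS : mu.-integrable D (fun x => \sum_(0 <= k <oo) `|h k x|%:E)%E.
  apply/integrableP; split.
    by apply: ge0_emeasurable_sum => // k x _ _; rewrite lee_fin.
  under eq_integral do rewrite gee0_abs ?nneseries_ge0//.
  by [].
(* An upper limit is measurable without any convergence assumption. *)
exists (fun x => fine (limn_esup (fun n => (f n x)%:E))); split.
  apply: (@measurableT_comp _ _ _ _ _ _ fine); first exact: fine_measurable.
  by apply: measurable_fun_limn_esup => n; apply/measurable_EFinP; case: (sf n).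
have := integrable_ae mD iS; apply: filterS => x /[apply] hx.
have /abs_summable_cvg cS : (\sum_(0 <= k <oo) `|h k x|%:E < +oo)%E.
  by move: hx; rewrite fin_numElt => /andP[].
have cf : f ^~ x @ \oo --> f 0%N x + limn (series (h ^~ x)).
  rewrite (_ : f ^~ x = fun n => f 0%N x + series (h ^~ x) n).
    by apply: cvgD => //; exact: cvg_cst.
  apply/funext => n; rewrite /series/= telescope_sumr// /h; ring.
have : (fun n => (f n x)%:E) @ \oo --> (f 0%N x + limn (series (h ^~ x)))%:E.
  by apply: cvg_EFin => //; exact: nearW.
by move=> /cvg_limn_einf_sup[_ ->].
Qed.

(** A Cauchy sequence has a subsequence whose increments are summable, hence an
    almost everywhere limit w; the lemma of Fatou, applied to
    (f_n - f_(n_j))^2 as j grows, bounds the distance from f_n to w. *)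
Theorem sqint_complete (f : nat -> T -> R) : (forall n, sqint (f n)) ->
  (forall e : R, 0 < e -> exists N, forall m n, (N <= m)%N -> (N <= n)%N ->
    \int[mu]_(x in D) (f m x - f n x) ^+ 2 <= e) ->
  exists w, sqint w /\ forall e : R, 0 < e -> exists N, forall n, (N <= n)%N ->
    \int[mu]_(x in D) (f n x - w x) ^+ 2 <= e.
Proof.
move=> sf cf.
have /choice[N hN] : forall k, exists N, forall m n, (N <= m)%N -> (N <= n)%N ->
    \int[mu]_(x in D) (f m x - f n x) ^+ 2 <= 4^-1 ^+ k.
  by move=> k; apply: cf; rewrite exprn_gt0.
(* The sum makes n_ j >= N k for every k <= j, not only for k = j. *)
pose n_ k := (\sum_(i < k.+1) N i)%N.
have n_N k j : (k <= j)%N -> (N k <= n_ j)%N.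
  by move=> kj; rewrite /n_ (bigD1 (Ordinal (kj : (k < j.+1)%N)))//= leq_addr.
have [w [mw cw]] : exists w, measurable_fun D w /\
    {ae mu, forall x, D x -> (fun k => f (n_ k) x) @ \oo --> w x}.
  apply: (@ae_limit_sqint (fun k => f (n_ k))) => // k.
  by apply: hN; rewrite ?n_N.
have mfn n : measurable_fun D (f n) by case: (sf n).
have msq n : measurable_fun D (fun x => ((f n x - w x) ^+ 2)%:E).
  by apply/measurable_EFinP; apply: measurable_funX; exact: measurable_funB.
have close k n : (N k <= n)%N ->
    (\int[mu]_(x in D) ((f n x - w x) ^+ 2)%:E <= (4^-1 ^+ k)%:E)%E.
  move=> kn; pose F j x := ((f n x - f (n_ (j + k)%N) x) ^+ 2)%:E.
  have mF j : measurable_fun D (F j).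
    by apply/measurable_EFinP; apply: measurable_funX; exact: measurable_funB.
  have F0 j x : D x -> (0 <= F j x)%E by move=> _; rewrite lee_fin sqr_ge0.
  have iF j : (\int[mu]_(x in D) F j x <= (4^-1 ^+ k)%:E)%E.
    rewrite -[leLHS]fineK; last first.
      by apply: integrable_fin_num => //; apply: sqint_sqr; exact: sqintB.
    by rewrite lee_fin; apply: hN => //; rewrite n_N// leq_addl.
  have -> : (\int[mu]_(x in D) ((f n x - w x) ^+ 2)%:E =
             \int[mu]_(x in D) limn_einf (F ^~ x))%E.
    apply: ae_eq_integral => //.
      apply: (emeasurable_fun_cvg (fun n x => einfs (F ^~ x) n)).
        by move=> i; exact: measurable_fun_einfs.
      by move=> x _; rewrite limn_einf_lim; exact: is_cvg_einfs.
    apply: filterS cw => x /[apply] cx.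
    have : F ^~ x @ \oo --> ((f n x - w x) ^+ 2)%:E.
      apply: cvg_EFin; first exact: nearW.
      have c2 : (fun j => f n x - f (n_ (j + k)%N) x) @ \oo --> f n x - w x.
        apply: cvgB; first exact: cvg_cst.
        by have := cx; rewrite -(cvg_shiftn k).
      by have := cvgM c2 c2; apply.
    by move=> /cvg_limn_einf_sup[-> _].
  apply: le_trans (fatou mu mD mF F0) _.
  rewrite limn_einf_lim; apply: lime_le; first exact: is_cvg_einfs.
  apply: nearW => j; apply: le_trans (iF j).
  by apply: ereal_inf_lbound; exists j => //=.
have sw n : (N 0%N <= n)%N -> sqint (fun x => f n x - w x).
  move=> Nn; split; first exact: measurable_funB.
  apply/integrableP; split; first exact: msq.
  under eq_integral do rewrite gee0_abs ?lee_fin ?sqr_ge0//.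
  by apply: le_lt_trans (close _ _ Nn) _; exact: ltry.
exists w; split.
  apply: eq_sqint (sqintB (sf (N 0%N)) (sw _ (leqnn _))) => x _; ring.
move=> e e0; have [k ke] : exists k, 4^-1 ^+ k <= e :> R.
  have : (fun k => 4^-1 ^+ k : R) @ \oo --> (0 : R).
    by apply: cvg_expr; rewrite ger0_norm ?invr_ge0// invf_lt1// ltr1n.
  move=> /cvgrPdist_le /(_ _ e0) [k _ /(_ k (leqnn k))].
  by rewrite /= sub0r normrN ger0_norm ?exprn_ge0 ?invr_ge0// => ?; exists k.
exists (maxn (N k) (N 0%N)) => n; rewrite geq_max => /andP[nk n0].
rewrite -lee_fin fineK; last first.
  by apply: integrable_fin_num => //; apply: sqint_sqr; exact: sw.
by apply: le_trans (close _ _ nk) _; rewrite lee_fin.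
Qed.

End square_integrable_functions.

(** * Polynomial approximation of a step function *)

Section step_functions.
Variable R : realType.

Lemma Bernoulli_lower (y : R) n : 0 <= y <= 1 -> 1 - n%:R * y <= (1 - y) ^+ n.
Proof.
move=> /andP[y0 y1]; elim: n => [|n IH]; first by rewrite mul0r subr0 expr0.
rewrite exprS; have h : 0 <= 1 - y by lra.
have := ler_wpM2l h IH; have n0 : 0 <= n%:R :> R by exact: ler0n.
have := mulr_ge0 n0 (sqr_ge0 y); rewrite -natr1; lra.
Qed.

(** Bernoulli's inequality for the inverse, (1 - y)^-n >= 1 + n y, without the
    division. *)
Lemma Bernoulli_upper (y : R) n : 0 <= y <= 1 -> (1 - y) ^+ n * (1 + n%:R * y) <= 1.
Proof.
move=> /andP[y0 y1]; elim: n => [|n IH]; first by rewrite expr0 mul0r addr0 mul1r.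
apply: le_trans IH; rewrite exprSr -mulrA; apply: ler_wpM2l.
  by apply: exprn_ge0; lra.
have n0 : 0 <= n%:R :> R by exact: ler0n.
have := mulr_ge0 n0 (sqr_ge0 y); have := sqr_ge0 y; rewrite -natr1; lra.
Qed.

Lemma cvg_nat_expr (r : R) : 0 <= r < 1 -> (fun n => n%:R * r ^+ n) @ \oo --> (0 : R).
Proof.
move=> /andP[r0 r1]; set q := Num.sqrt r.
have q0 : 0 <= q by exact: sqrtr_ge0.
have q1 : q < 1 by rewrite -sqrtr1 ltr_sqrt.
have qq : r = q * q by rewrite -expr2 sqr_sqrtr.
have cq : (fun n => (1 - q)^-1 * q ^+ n) @ \oo --> (0 : R).
  rewrite -[X in _ --> X](mulr0 (1 - q)^-1); apply: cvgMr.
  by apply: cvg_expr; rewrite ger0_norm.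
apply: (squeeze_cvgr _ (cvg_cst (0 : R)) cq); apply: nearW => n.
rewrite mulr_ge0 ?exprn_ge0//= qq exprMn mulrA; apply: ler_wpM2r.
  exact: exprn_ge0.
rewrite -[leRHS]mul1r ler_pdivlMr ?subr_gt0//.
have := @Bernoulli_upper (1 - q) n; rewrite subKr => h.
have {}h : q ^+ n * (1 + n%:R * (1 - q)) <= 1 by apply: h; apply/andP; lra.
have := exprn_ge0 n q0; lra.
Qed.

(** On [0, 1] these polynomials converge boundedly to the indicator of
    [0, 1/2[: by Bernoulli's inequality they are at least 1 - n (2 s)^n and at
    most 1 / (1 + n (2 s)^n).  The factor n in the exponent makes the limit 0
    at s = 1/2 as well. *)
Definition step (n : nat) (s : R) : R := (1 - s ^+ n) ^+ (n * 2 ^ n).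

Lemma step_bound n (s : R) : 0 <= s <= 1 -> 0 <= step n s <= 1.
Proof.
move=> /andP[s0 s1]; have sn0 := exprn_ge0 n s0; have sn1 := exprn_ile1 n s0 s1.
by rewrite /step exprn_ge0 ?subr_ge0//= exprn_ile1 ?subr_ge0// gerBl.
Qed.

Lemma step_cvg (s : R) : 0 <= s <= 1 ->
  step ^~ s @ \oo --> (if s < 2^-1 then 1 else 0 : R).
Proof.
move=> s01; have /andP[s0 s1] := s01.
have sn n : 0 <= s ^+ n <= 1 by rewrite exprn_ge0// exprn_ile1.
have e2 n : (n * 2 ^ n)%N%:R * s ^+ n = n%:R * (2 * s) ^+ n.
  by rewrite natrM natrX -mulrA exprMn.
case: ltP => hs.
- have c1 : (fun n => 1 - n%:R * (2 * s) ^+ n) @ \oo --> (1 : R).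
    rewrite -[X in _ --> X]subr0; apply: cvgB; first exact: cvg_cst.
    apply: cvg_nat_expr; apply/andP; lra.
  apply: (squeeze_cvgr _ c1 (cvg_cst (1 : R))); apply: nearW => n.
  have /andP[_ ->] := step_bound n s01; rewrite andbT -e2.
  exact: Bernoulli_lower.
- have c0 : (fun n => (1 + n%:R)^-1 : R) @ \oo --> (0 : R).
    have := @cvg_harmonic R; rewrite /harmonic.
    by under eq_fun do rewrite -nat1r.
  apply: (squeeze_cvgr _ (cvg_cst (0 : R)) c0); apply: nearW => n.
  have /andP[-> _] := step_bound n s01.
  rewrite /= -[leRHS]mul1r ler_pdivlMr ?ltr_pwDl//.
  apply: le_trans (Bernoulli_upper (n * 2 ^ n) (sn n)).
  apply: ler_wpM2l; first by have /andP[] := step_bound n s01.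
  rewrite e2 lerD2l ler_peMr//; apply: exprn_ege1; lra.
Qed.

End step_functions.

(** * Completeness of the characters *)

Section uniqueness.
Variables (R : realType) (d : nat).
Local Notation mu := (@lebesgue_tuple R d).
Local Notation Cell := (@cell R d).
Local Notation pi := (@pi R).
Variable v : Rspace R d -> R.
Hypothesis iv : mu.-integrable Cell (EFin \o v).
Implicit Types phi psi : Rspace R d -> R.

Let mC : measurable Cell. Proof. exact: (@measurable_cell R d). Qed.

Definition bounded_on_cell phi : Prop :=
  measurable_fun Cell phi /\ exists C : R, forall x, Cell x -> `|phi x| <= C.

Lemma bounded_on_cellM phi psi :
  bounded_on_cell phi -> bounded_on_cell psi ->
  bounded_on_cell (fun x => phi x * psi x).
Proof.
move=> [mp [C hC]] [mq [C' hC']]; split; first exact: measurable_funM.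
exists (C * C') => x cx; rewrite normrM.
by apply: ler_pM => //; [exact: hC|exact: hC'].
Qed.

Lemma bounded_on_cellD phi psi :
  bounded_on_cell phi -> bounded_on_cell psi ->
  bounded_on_cell (fun x => phi x + psi x).
Proof.
move=> [mp [C hC]] [mq [C' hC']]; split; first exact: measurable_funD.
exists (C + C') => x cx; rewrite (le_trans (ler_normD _ _))//.
by apply: lerD; [exact: hC|exact: hC'].
Qed.

Lemma bounded_on_cell_cst (c : R) : bounded_on_cell (fun=> c).
Proof. by split; [exact: measurable_cst|exists `|c|]. Qed.

Lemma bounded_on_cell_cos (xi : freq d) (theta : R) :
  bounded_on_cell (fun x => cos (dot xi x + theta)).
Proof.
split; first by apply: measurable_funTS; exact: measurable_cos_phase.
by exists 1 => x _; exact: cos_max.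
Qed.

Lemma integrable_mul_bounded phi : bounded_on_cell phi ->
  mu.-integrable Cell (EFin \o (fun x => v x * phi x)).
Proof.
move=> [mp [C hC]].
have := integrableMl mC iv mp; apply.
exists C; split; first exact: num_real.
by move=> y Cy x cx /=; rewrite (le_trans (hC x cx))// ltW.
Qed.

(** Orthogonality of v phi to all the characters; the phase theta accounts for
    both sines and cosines. *)
Definition annihilates phi : Prop := forall (xi : freq d) (theta : R),
  \int[mu]_(x in Cell) (v x * (phi x * cos (dot xi x + theta))) = 0.

(** Multiplication by psi preserves orthogonality to the characters.  This class
    is an algebra by construction, which would fail for the class of psi such
    that v psi has integral 0, and it is closed under bounded limits. *)
Definition multiplier psi : Prop := bounded_on_cell psi /\
  forall phi, bounded_on_cell phi -> annihilates phi ->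
    annihilates (fun x => psi x * phi x).

Lemma eq_multiplier psi psi' : (forall x, Cell x -> psi x = psi' x) ->
  multiplier psi -> multiplier psi'.
Proof.
move=> e [[mp [C hC]] mpsi]; split.
  split; last by exists C => x cx; rewrite -e// hC.
  by apply: eq_measurable_fun mp => x; rewrite inE; exact: e.
move=> phi bphi aphi xi theta; rewrite -[RHS](mpsi phi bphi aphi xi theta).
by apply: eq_Rintegral => x; rewrite inE => cx; rewrite e.
Qed.

Lemma multiplier_cst c : multiplier (fun=> c).
Proof.
split; first exact: bounded_on_cell_cst.
move=> phi bphi aphi xi theta; rewrite -[RHS](mulr0 c) -[in RHS](aphi xi theta).
rewrite -RintegralZl//; first by apply: eq_Rintegral => x _; ring.
by apply: integrable_mul_bounded; apply: bounded_on_cellM => //; exact: bounded_on_cell_cos.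
Qed.

Lemma multiplierM psi psi' : multiplier psi -> multiplier psi' ->
  multiplier (fun x => psi x * psi' x).
Proof.
move=> [b m] [b' m']; split; first exact: bounded_on_cellM.
move=> phi bphi aphi xi theta.
rewrite -[RHS](m _ (bounded_on_cellM b' bphi) (m' _ bphi aphi) xi theta).
by apply: eq_Rintegral => x _; ring.
Qed.

Lemma multiplierD psi psi' : multiplier psi -> multiplier psi' ->
  multiplier (fun x => psi x + psi' x).
Proof.
move=> [b m] [b' m']; split; first exact: bounded_on_cellD.
move=> phi bphi aphi xi theta.
rewrite -[RHS]addr0 -{1}[in RHS](m _ bphi aphi xi theta) -[X in _ + X](m' _ bphi aphi xi theta).
rewrite -RintegralD//; first by apply: eq_Rintegral => x _; ring.
- by apply: integrable_mul_bounded; do 2?apply: bounded_on_cellM => //; exact: bounded_on_cell_cos.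
- by apply: integrable_mul_bounded; do 2?apply: bounded_on_cellM => //; exact: bounded_on_cell_cos.
Qed.

Lemma multiplierX psi n : multiplier psi -> multiplier (fun x => psi x ^+ n).
Proof.
move=> mpsi; elim: n => [|n IH].
  by apply: eq_multiplier (multiplier_cst 1) => x _; rewrite expr0.
by apply: eq_multiplier (multiplierM mpsi IH) => x _; rewrite exprS.
Qed.

Lemma multiplier1B psi : multiplier psi -> multiplier (fun x => 1 - psi x).
Proof.
move=> mpsi; apply: eq_multiplier
  (multiplierD (multiplier_cst 1) (multiplierM (multiplier_cst (-1)) mpsi)) => x _.
by rewrite mulN1r.
Qed.

Definition freq_shift (i : 'I_d) (k : int) (xi : freq d) : freq d :=
  [tuple tnth xi j + (if j == i then k else 0) | j < d].

Lemma dot_freq_shift i k xi (x : Rspace R d) :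
  dot (freq_shift i k xi) x = dot xi x + k%:~R * tnth x i.
Proof.
rewrite /dot (eq_bigr (fun j => (tnth xi j)%:~R * tnth x j +
   (if j == i then k%:~R * tnth x j else 0))); last first.
  move=> j _; rewrite tnth_mktuple rmorphD/= mulrDl; congr (_ + _).
  by case: (j == i); rewrite ?mulr0z ?mul0r.
by rewrite big_split/= -big_mkcond big_pred1_eq.
Qed.

(** By the product formula, multiplication by cos (x_i - c) turns a character
    into the mean of two characters whose i-th frequencies are shifted by 1 and
    by -1. *)
Lemma multiplier_cos (i : 'I_d) (c : R) : multiplier (fun x => cos (tnth x i - c)).
Proof.
have e1 (x : Rspace R d) : cos (tnth x i - c) = cos (dot (freq_shift i 1 (freq0 d)) x + - c).
  by rewrite dot_freq_shift dot_freq0 mul1r add0r.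
split.
  rewrite (_ : (fun x => _) = fun x => cos (dot (freq_shift i 1 (freq0 d)) x + - c)).
    exact: bounded_on_cell_cos.
  by apply/funext => x.
move=> phi bphi aphi xi theta.
have h1 := aphi (freq_shift i 1 xi) (theta - c).
have h2 := aphi (freq_shift i (-1) xi) (theta + c).
rewrite -[RHS](mulr0 2^-1) -[X in _ = _ * X]addr0 -{1}h1 -h2.
have ih k t : mu.-integrable Cell (EFin \o
    (fun x => v x * (phi x * cos (dot (freq_shift i k xi) x + t)))).
  by apply: integrable_mul_bounded; apply: bounded_on_cellM => //; exact: bounded_on_cell_cos.
rewrite -RintegralD// -RintegralZl//; last exact: (integrableD mC (ih _ _) (ih _ _)).
apply: eq_Rintegral => x _; rewrite !dot_freq_shift mul1r rmorphN1 mulN1r.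
have -> : dot xi x + tnth x i + (theta - c) = (dot xi x + theta) + (tnth x i - c) by ring.
have -> : dot xi x - tnth x i + (theta + c) = (dot xi x + theta) - (tnth x i - c) by ring.
by set A := dot xi x + theta; set B := tnth x i - c; rewrite (cosD A B) (cosB A B); field.
Qed.

Lemma multiplier_lim (psi_ : nat -> Rspace R d -> R) psi (C : R) :
  (forall n, multiplier (psi_ n)) ->
  (forall n x, Cell x -> `|psi_ n x| <= C) ->
  (forall x, Cell x -> psi_ ^~ x @ \oo --> psi x) ->
  multiplier psi.
Proof.
move=> mpsi hC hl.
have mp n : measurable_fun Cell (psi_ n) by case: (mpsi n) => -[].
have mlim : measurable_fun Cell psi by apply: (measurable_fun_cvg mp).
have bpsi : bounded_on_cell psi.
  split => //; exists C => x cx.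
  have cn : (fun n => `|psi_ n x|) @ \oo --> `|psi x| by apply: cvg_norm; exact: hl.
  rewrite -(cvg_lim _ cn)//; apply: limr_le; first by apply/cvg_ex; exists `|psi x|.
  by apply: nearW => n; exact: hC.
split => // phi bphi aphi xi theta.
have bpc : bounded_on_cell (fun x => phi x * cos (dot xi x + theta)).
  by apply: bounded_on_cellM => //; exact: bounded_on_cell_cos.
pose w x := v x * (phi x * cos (dot xi x + theta)).
have iw : mu.-integrable Cell (EFin \o w) by exact: integrable_mul_bounded.
have mw : measurable_fun Cell w by apply/measurable_EFinP; exact: measurable_int iw.
have [|||||_ _] := @dominated_convergence _ _ R mu Cell mC
   (fun n x => (psi_ n x * w x)%:E) (fun x => (psi x * w x)%:E) (fun x => C%:E * (`|w x|)%:E)%E.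
- by move=> n; apply/measurable_EFinP; exact: measurable_funM.
- by apply/measurable_EFinP; exact: measurable_funM.
- apply: aeW => x cx; apply: cvg_EFin; first exact: nearW.
  by apply: cvgMl; exact: hl.
- by apply: integrableZl => //; exact: (integrable_norm iw).
- apply: aeW => x n cx; rewrite -EFinM/= lee_fin normrM.
  by apply: ler_wpM2r => //; exact: hC.
have -> : [sequence (\int[mu]_(x in Cell) (psi_ n x * w x)%:E)%E]_n = fun=> 0%E.
  apply/funext => n /=.
  have ipw : mu.-integrable Cell (EFin \o (fun x => psi_ n x * w x)).
    have b : bounded_on_cell (fun x => psi_ n x * (phi x * cos (dot xi x + theta))).
      by apply: bounded_on_cellM => //; case: (mpsi n).
    by apply: eq_integrable (integrable_mul_bounded b) => // x _; rewrite /= /w mulrCA.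
  rewrite -[LHS]fineK; last exact: (integrable_fin_num mC ipw).
  have [_ mn] := mpsi n.
  transitivity ((\int[mu]_(x in Cell) (v x * (psi_ n x * phi x * cos (dot xi x + theta))))%:E).
    congr (_%:E).
    by apply: eq_Rintegral => x _; rewrite /w; ring.
  by rewrite mn.
move=> /cvg_lim h; have {}h := h (@ereal_hausdorff R); rewrite lim_cst// in h.
rewrite (_ : 0 = fine 0%E)// h; congr fine; apply: eq_integral => x _; congr (_%:E).
by rewrite /w; ring.
Qed.

(** For -pi < a < pi, the set x_i < a is an arc of the circle with centre
    c = (a - pi) / 2 and half-width h = (a + pi) / 2, since x_i > -pi = c - h.
    It is thus described by cos (x_i - c) > cos h, and the steps of an affine
    function of cos (x_i - c) approximate its indicator. *)
Lemma multiplier_step (i : 'I_d) (a : R) :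
  multiplier (\1_[set x : Rspace R d | tnth x i < a]).
Proof.
have indE x : \1_[set x : Rspace R d | tnth x i < a] x = (if tnth x i < a then 1 else 0 : R).
  by rewrite indicE; case: ifPn => h; [rewrite mem_set|rewrite memNset// => /=; exact/negP].
have [api|pia] := leP a (- pi).
  apply: eq_multiplier (multiplier_cst 0) => x /(_ i) /andP[x1 _].
  by rewrite indE ltNge (le_trans api (ltW x1)).
have [pia2|api2] := leP pi a.
  apply: eq_multiplier (multiplier_cst 1) => x /(_ i) /andP[_ x2].
  by rewrite indE (lt_le_trans x2 pia2).
pose c : R := (a - pi) / 2; pose h : R := (a + pi) / 2.
(* An affine function of the cosine with values in [0, 1], below 1/2 exactly
   on the arc. *)
pose s (x : Rspace R d) : R := 2^-1 + 4^-1 * (cos h - cos (tnth x i - c)).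
have s01 x : 0 <= s x <= 1.
  have := cos_le1 h; have := cos_geN1 h.
  have := cos_le1 (tnth x i - c); have := cos_geN1 (tnth x i - c).
  by rewrite /s => *; apply/andP; lra.
have ms : multiplier s.
  apply: eq_multiplier (multiplierD (multiplier_cst (2^-1 + 4^-1 * cos h))
    (multiplierM (multiplier_cst (- 4^-1)) (multiplier_cos i c))) => x _.
  by rewrite /s; ring.
apply: (@multiplier_lim (fun n x => step n (s x)) _ 1).
- by move=> n; apply: multiplierX; apply: multiplier1B; exact: multiplierX.
- by move=> n x _; have /andP[p1 p2] := step_bound n (s01 x); rewrite ger0_norm.
- move=> x /(_ i) /andP[x1 x2]; rewrite indE.
  suff <- : (s x < 2^-1) = (tnth x i < a) by exact: step_cvg.
  have -> : (s x < 2^-1) = (cos h < cos (tnth x i - c)).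
    by rewrite /s; apply/idP/idP; lra.
  have h0 : 0 <= h <= pi by rewrite /h; apply/andP; lra.
  have mono y : 0 <= y <= pi -> (cos h < cos y) = (y < h).
    by move=> y0; rewrite ltr_cos// in_itv.
  set y := tnth x i - c.
  have y1 : - h < y by rewrite /y /h /c; lra.
  have y2 : y < 2 * pi - h by rewrite /y /h /c; lra.
  have -> : (tnth x i < a) = (y < h) by rewrite /y /h /c; apply/idP/idP; lra.
  have [yneg|ypos] := leP y 0.
    rewrite -[cos y]cosN mono; last by apply/andP; lra.
    by apply/idP/idP; lra.
  have [ypi|ypi] := leP y pi; first by rewrite mono// ypi ltW.
  have -> : cos y = cos (2 * pi - y).
    rewrite -[RHS]cosN -(cosD2pi (- _)) -mulr_natr; congr cos; ring.
  rewrite mono; last by apply/andP; lra.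
  by apply/idP/idP; lra.
Qed.

Definition multiplier_sets : set (set (Rspace R d)) :=
  [set E | measurable E /\ multiplier \1_E].

Lemma sigma_algebra_multiplier_sets : sigma_algebra setT multiplier_sets.
Proof.
split.
- split => //; apply: eq_multiplier (multiplier_cst 0) => x _.
  by rewrite indicE in_set0.
- move=> E [mE ME]; split; first by rewrite setTD; exact: measurableC.
  apply: eq_multiplier (multiplier1B ME) => x _.
  by rewrite setTD !indicE in_setC; case: (x \in E); rewrite ?subrr ?subr0.
- move=> F MF; split; first by apply: bigcupT_measurable => k; case: (MF k).
  (* The products of the indicators of the complements decrease to the
     indicator of the complement of the union. *)
  pose P n x : R := \prod_(k < n) (1 - \1_(F k) x).
  have PE n x : P n x = (~~ [exists k : 'I_n, x \in F k])%:R.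
    rewrite /P; case: (boolP [exists k : 'I_n, x \in F k]) => [/existsP[k xk]|].
      by rewrite (bigD1 k)//= indicE xk subrr mul0r.
    rewrite negb_exists => /forallP nx; apply: big1 => k _.
    by rewrite indicE (negbTE (nx k)) subr0.
  have MP n : multiplier (P n).
    rewrite /P; elim: n => [|n IH].
      by apply: eq_multiplier (multiplier_cst 1) => x _; rewrite big_ord0.
    have M1 := multiplier1B (MF n).2.
    by apply: eq_multiplier (multiplierM IH M1) => x _; rewrite big_ord_recr.
  have ML : multiplier (fun x => 1 - \1_(\bigcup_k F k) x).
    apply: (@multiplier_lim P _ 1) => //.
      by move=> n x _; rewrite PE; case: [exists _, _]; rewrite ?normr0 ?normr1.
    move=> x _; rewrite indicE; case: (boolP (x \in _)) => xU.
      have [k _ Fk] : (\bigcup_k F k) x by rewrite -inE.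
      rewrite subrr; apply: (@cvg_near_cst _ _ _ _ _ _ ).
      exists k.+1 => // n /= kn; rewrite PE.
      suff -> : [exists k : 'I_n, x \in F k] by [].
      by apply/existsP; exists (Ordinal kn); rewrite inE.
    rewrite subr0; apply: (@cvg_near_cst _ _ _ _ _ _ ).
    apply: nearW => n; rewrite PE.
    suff -> : [exists k : 'I_n, x \in F k] = false by [].
    apply/existsP => -[k]; rewrite inE => Fk; move: xU; rewrite notin_setE; apply.
    by exists k.
  by apply: eq_multiplier (multiplier1B ML) => x _; rewrite subKr.
Qed.

(** The sets whose indicator is a multiplier form a sigma-algebra that contains
    the half-spaces x_i < a, which generate the measurable sets. *)
Lemma measurable_multiplier (E : set (Rspace R d)) : measurable E -> multiplier \1_E.
Proof.
suff : @measurable _ (Rspace R d) `<=` multiplier_sets by move=> + mE => /(_ E mE)[].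
apply: smallest_sub; first exact: sigma_algebra_multiplier_sets.
rewrite -bigcup_seq => F [i _ [A mA <-]]; rewrite setTI.
have gen : <<s @ocitv R >> = <<s @RGenInftyO.G R >> := RGenInftyO.measurableE R.
have {mA} : <<s @ocitv R >> A := mA.
rewrite gen; move: A.
have sig : sigma_algebra setT
    [set A : set (measurableTypeR R) | multiplier_sets ((fun x => tnth x i) @^-1` A)].
  have [S0 SC SU] := sigma_algebra_multiplier_sets; split => /=.
  - by rewrite preimage_set0.
  - by move=> A SA; have := SC _ SA; rewrite !setTD preimage_setC.
  - by move=> A SA; rewrite preimage_bigcup; exact: SU.
apply: (smallest_sub sig) => _ [a ->] /=; split.
  by rewrite -[X in measurable X]setTI; apply: measurable_tnth => //; exact: measurable_itv.
rewrite (_ : _ @^-1` _ = [set x : Rspace R d | tnth x i < a]); first exact: multiplier_step.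
by apply/seteqP; split => x /=; rewrite in_itv.
Qed.

(** Completeness of the characters: the constant 1 annihilates, hence so does
    the indicator of every measurable set E, and the frequency 0 yields that the
    integral of v over E vanishes. *)
Lemma annihilated_ae0 : annihilates (fun=> 1) -> ae_eq mu Cell (EFin \o v) (cst 0%E).
Proof.
move=> a1; apply: integral_ae_eq => // E EC mE; rewrite integral0.
have [bE mulE] := measurable_multiplier mE.
have : \int[mu]_(x in Cell) (v \_ E) x = 0.
  rewrite -[RHS](mulE _ (bounded_on_cell_cst 1) a1 (freq0 d) 0).
  apply: eq_Rintegral => x _; rewrite patchE indicE.
  rewrite dot_freq0 add0r cos0 mulr1.
  by case: (x \in E); rewrite ?mulr1 ?mulr0.
rewrite -Rintegral_mkcondr setIidr// /Rintegral => vE.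
rewrite -[LHS]fineK ?vE//; apply: integrable_fin_num => //.
exact: (integrableS mC mE EC iv).
Qed.

End uniqueness.

(** * Trigonometric sums and the Bessel inequality *)

Section fourier_series.
Variables (R : realType) (d : nat).
Local Notation mu := (@lebesgue_tuple R d).
Local Notation Cell := (@cell R d).
Local Notation pi := (@pi R).
Local Notation sq := (@sqint _ _ R mu Cell).
Implicit Types (v w : Rspace R d -> R) (xi eta : freq d) (c : freq d -> R[i]).

Let mC : measurable Cell. Proof. exact: (@measurable_cell R d). Qed.
Let Coo : (mu Cell < +oo)%E.
Proof. by rewrite (@cell_measure R d) ltry. Qed.

Definition vol : R := (2 * pi) ^+ d.

Lemma vol_gt0 : 0 < vol.
Proof. by rewrite exprn_gt0// mulr_gt0// pi_gt0. Qed.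

Let vol_neq0 : vol != 0. Proof. exact/lt0r_neq0/vol_gt0. Qed.

(** The real and imaginary parts of the coefficients and of the partial sums are
    handled separately, since the integral of a complex function is defined by
    its two parts. *)
Definition cos_coef v xi : R := \int[mu]_(x in Cell) (v x * cos (dot xi x)).
Definition sin_coef v xi : R := \int[mu]_(x in Cell) (v x * sin (dot xi x)).

Lemma sqint_cos xi (theta : R) : sq (fun x => cos (dot xi x + theta)).
Proof.
apply: (@bounded_sqint _ _ _ _ _ mC Coo _ 1).
  by apply: measurable_funTS; exact: measurable_cos_phase.
by move=> x _; exact: cos_max.
Qed.

Lemma sqint_cos_dot xi : sq (fun x => cos (dot xi x)).
Proof. by apply: (eq_sqint mC _ (sqint_cos xi 0)) => x _; rewrite addr0. Qed.

Lemma sqint_sin_dot xi : sq (fun x => sin (dot xi x)).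
Proof. by apply: (eq_sqint mC _ (sqint_cos xi (- (pi / 2)))) => x _; rewrite cosBpihalf. Qed.

Lemma fourierE v xi : sq v -> fourier v xi = cos_coef v xi -i* sin_coef v xi.
Proof.
move=> sv; rewrite /fourier /cintegral; congr (_ +i* _).
  by apply: eq_Rintegral => x _; rewrite /= mul0r subr0 cosN.
rewrite /sin_coef -mulN1r -RintegralZl//; last exact: (sqint_mul_integrable mC sv (sqint_sin_dot xi)).
by apply: eq_Rintegral => x _; rewrite /= mul0r addr0 sinN mulN1r mulrN.
Qed.

Lemma integral_cos_dot xi : \int[mu]_(x in Cell) cos (dot xi x) =
  if xi == freq0 d then vol else 0.
Proof.
have := integral_cos_cell xi (0 : R); rewrite cos0 mulr1 => <-.
by apply: eq_Rintegral => x _; rewrite addr0.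
Qed.

Lemma integral_sin_dot xi : \int[mu]_(x in Cell) sin (dot xi x) = 0.
Proof.
have := integral_cos_cell xi (- (pi / 2)).
rewrite cosN cos_pihalf mulr0 if_same => <-.
by apply: eq_Rintegral => x _; rewrite cosBpihalf.
Qed.

Definition freq_opp xi : freq d := [tuple - tnth xi i | i < d].
Definition freq_sub xi eta : freq d := [tuple tnth xi i - tnth eta i | i < d].

Lemma dot_opp xi x : @dot R d (freq_opp xi) x = - dot xi x.
Proof.
rewrite /dot -sumrN; apply: eq_bigr => i _.
by rewrite tnth_mktuple rmorphN/= mulNr.
Qed.

Lemma dot_sub xi eta x : @dot R d (freq_sub xi eta) x = dot xi x - dot eta x.
Proof.
rewrite /dot -sumrB; apply: eq_bigr => i _.
by rewrite tnth_mktuple rmorphB/= mulrBl.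
Qed.

Lemma freq_sub_eq0 xi eta : (freq_sub xi eta == freq0 d) = (xi == eta).
Proof.
apply/eqP/eqP => [h|->]; apply/eq_from_tnth => i; last by rewrite !tnth_mktuple subrr.
by have := congr1 (fun t => tnth t i) h; rewrite !tnth_mktuple => /eqP; rewrite subr_eq0 => /eqP.
Qed.

Lemma freq_oppK : involutive freq_opp.
Proof. by move=> xi; apply/eq_from_tnth => i; rewrite !tnth_mktuple opprK. Qed.

Lemma integral_trig_dot (a b : R) xi :
  \int[mu]_(x in Cell) (a * cos (dot xi x) + b * sin (dot xi x)) =
  if xi == freq0 d then a * vol else 0.
Proof.
have ic := sqint_integrable mC Coo (sqint_cos_dot xi).
have is_ := sqint_integrable mC Coo (sqint_sin_dot xi).
rewrite RintegralD//; last 2 first.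
- exact: (integrableZl mC a ic).
- exact: (integrableZl mC b is_).
rewrite !RintegralZl// integral_cos_dot integral_sin_dot mulr0 addr0.
by case: eqP => // _; rewrite mulr0.
Qed.

Definition wave_re (z : R[i]) xi (x : Rspace R d) : R :=
  complex.Re z * cos (dot xi x) - complex.Im z * sin (dot xi x).
Definition wave_im (z : R[i]) xi (x : Rspace R d) : R :=
  complex.Re z * sin (dot xi x) + complex.Im z * cos (dot xi x).
Definition sum_re c (s : seq (freq d)) x : R := vol^-1 * \sum_(xi <- s) wave_re (c xi) xi x.
Definition sum_im c (s : seq (freq d)) x : R := vol^-1 * \sum_(xi <- s) wave_im (c xi) xi x.
Definition abs2 (z : R[i]) : R := complex.Re z ^+ 2 + complex.Im z ^+ 2.

Lemma abs2_ge0 z : 0 <= abs2 z.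
Proof. by rewrite addr_ge0 ?sqr_ge0. Qed.

Lemma sq_wave_re z xi : sq (wave_re z xi).
Proof. by apply: sqintB => //; apply: sqintZ => //; [exact: sqint_cos_dot|exact: sqint_sin_dot]. Qed.

Lemma sq_wave_im z xi : sq (wave_im z xi).
Proof. by apply: sqintD => //; apply: sqintZ => //; [exact: sqint_sin_dot|exact: sqint_cos_dot]. Qed.

Lemma sq_sum_re c s : sq (sum_re c s).
Proof. by apply: sqintZ => //; apply: sqint_sum => // xi; exact: sq_wave_re. Qed.

Lemma sq_sum_im c s : sq (sum_im c s).
Proof. by apply: sqintZ => //; apply: sqint_sum => // xi; exact: sq_wave_im. Qed.

Lemma partial_sumE c (F : {fset (freq d)}) x :
  fourier_partial_sum c F x = sum_re c F x +i* sum_im c F x.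
Proof.
rewrite /fourier_partial_sum; have -> : \sum_(xi <- F) c xi * expi (dot xi x) =
    (\sum_(xi <- F) wave_re (c xi) xi x) +i* (\sum_(xi <- F) wave_im (c xi) xi x).
  elim/big_ind3 : _ => //.
    by move=> a1 b1 z1 a2 b2 z2 -> ->.
  by move=> xi _; case: (c xi).
by rewrite /sum_re /sum_im -/vol; apply/eqP; rewrite eq_complex/= !mul0r subr0 addr0 !eqxx.
Qed.

Lemma trig_sum_sqr c s x :
  (\sum_(xi <- s) wave_re (c xi) xi x) ^+ 2 + (\sum_(xi <- s) wave_im (c xi) xi x) ^+ 2 =
  \sum_(xi <- s) \sum_(eta <- s)
    ((complex.Re (c xi) * complex.Re (c eta) + complex.Im (c xi) * complex.Im (c eta))
       * cos (dot (freq_sub xi eta) x)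
     + (complex.Re (c xi) * complex.Im (c eta) - complex.Im (c xi) * complex.Re (c eta))
       * sin (dot (freq_sub xi eta) x)).
Proof.
rewrite !expr2 !mulr_suml -big_split; apply: eq_bigr => xi _ /=.
rewrite !mulr_sumr -big_split; apply: eq_bigr => eta _ /=.
by rewrite /wave_re /wave_im dot_sub cosB sinB; ring.
Qed.

Lemma integral_sum_sqr c s : uniq s ->
  \int[mu]_(x in Cell) (sum_re c s x ^+ 2 + sum_im c s x ^+ 2) =
  vol^-1 * \sum_(xi <- s) abs2 (c xi).
Proof.
move=> us.
have ii (a b : R) xi : mu.-integrable Cell (EFin \o
    (fun x => a * cos (dot xi x) + b * sin (dot xi x))).
  apply: (sqint_integrable mC Coo); apply: sqintD => //; apply: sqintZ => //.
    exact: sqint_cos_dot.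
  exact: sqint_sin_dot.
pose G xi eta x :=
    (complex.Re (c xi) * complex.Re (c eta) + complex.Im (c xi) * complex.Im (c eta))
       * cos (dot (freq_sub xi eta) x)
     + (complex.Re (c xi) * complex.Im (c eta) - complex.Im (c xi) * complex.Re (c eta))
       * sin (@dot R d (freq_sub xi eta) x).
transitivity (\int[mu]_(x in Cell) (vol^-1 ^+ 2 * \sum_(xi <- s) \sum_(eta <- s) G xi eta x)).
  apply: eq_Rintegral => x _; rewrite -trig_sum_sqr /sum_re /sum_im; ring.
rewrite RintegralZl//; last first.
  by apply: integrable_bigsum => // xi; apply: integrable_bigsum => // eta; exact: ii.
rewrite Rintegral_sum//; last first.
  by move=> xi; apply: integrable_bigsum => // eta; exact: ii.
rewrite (eq_big_seq (fun xi => vol * abs2 (c xi))); last first.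
  move=> xi xis; rewrite Rintegral_sum//; last by move=> eta; exact: ii.
  rewrite (bigD1_seq xi)//= integral_trig_dot freq_sub_eq0 eqxx big1 ?addr0.
    by rewrite mulrC /abs2 !expr2.
  by move=> eta ne; rewrite integral_trig_dot freq_sub_eq0 eq_sym (negbTE ne).
by rewrite -mulr_sumr; field.
Qed.

Lemma integral_mul_sum_re v s : sq v ->
  \int[mu]_(x in Cell) (v x * sum_re (fourier v) s x) =
  vol^-1 * \sum_(xi <- s) abs2 (fourier v xi).
Proof.
move=> sv.
have iw xi : mu.-integrable Cell (EFin \o (fun x => v x * wave_re (fourier v xi) xi x)).
  by apply: sqint_mul_integrable => //; exact: sq_wave_re.
transitivity (\int[mu]_(x in Cell)
   (vol^-1 * \sum_(xi <- s) (v x * wave_re (fourier v xi) xi x))).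
  by apply: eq_Rintegral => x _; rewrite /sum_re -mulr_sumr; ring.
rewrite RintegralZl//; last exact: integrable_bigsum.
congr (_ * _); rewrite Rintegral_sum//; apply: eq_bigr => xi _.
rewrite /wave_re; set al := complex.Re _; set be := complex.Im _.
have i1 := sqint_mul_integrable mC sv (sqint_cos_dot xi).
have i2 := sqint_mul_integrable mC sv (sqint_sin_dot xi).
transitivity (\int[mu]_(x in Cell)
   (al * (v x * cos (dot xi x)) - be * (v x * sin (dot xi x)))).
  by apply: eq_Rintegral => x _; ring.
rewrite RintegralB//; last 2 first.
- exact: (integrableZl mC al i1).
- exact: (integrableZl mC be i2).
rewrite !RintegralZl// -/(cos_coef v xi) -/(sin_coef v xi).
by rewrite /al /be fourierE// /abs2/= !expr2; ring.
Qed.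

(** The mean-square error of the partial sum, without its cross terms: the
    partial sum is an orthogonal projection of v. *)
Lemma integral_sqr_error v s : sq v -> uniq s ->
  \int[mu]_(x in Cell)
    ((v x - sum_re (fourier v) s x) ^+ 2 + sum_im (fourier v) s x ^+ 2) =
  \int[mu]_(x in Cell) v x ^+ 2 - vol^-1 * \sum_(xi <- s) abs2 (fourier v xi).
Proof.
move=> sv us; set c := fourier v.
have sr := sq_sum_re c s; have si := sq_sum_im c s.
have i1 := sqint_sqr sv; have i2 := sqint_mul_integrable mC sv sr.
have i3 := integrableD mC (sqint_sqr sr) (sqint_sqr si).
transitivity (\int[mu]_(x in Cell) (v x ^+ 2 - 2 * (v x * sum_re c s x) +
    (sum_re c s x ^+ 2 + sum_im c s x ^+ 2))).
  by apply: eq_Rintegral => x _; ring.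
have i2' := integrableZl mC 2 i2.
rewrite RintegralD//; last exact: (integrableB mC i1 i2').
rewrite RintegralB// RintegralZl// integral_mul_sum_re// integral_sum_sqr//.
by rewrite -/c; ring.
Qed.

Lemma Bessel v s : sq v -> uniq s ->
  vol^-1 * \sum_(xi <- s) abs2 (fourier v xi) <= \int[mu]_(x in Cell) v x ^+ 2.
Proof.
move=> sv us; rewrite -subr_ge0 -integral_sqr_error//.
by apply: Rintegral_ge0 => x _; rewrite addr_ge0// sqr_ge0.
Qed.

End fourier_series.

(** * The Riesz-Fischer theorem and the Parseval identity *)

Section Riesz_Fischer.
Variables (R : realType) (d : nat).
Local Notation mu := (@lebesgue_tuple R d).
Local Notation Cell := (@cell R d).
Local Notation pi := (@pi R).
Local Notation sq := (@sqint _ _ R mu Cell).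
Implicit Types (v w : Rspace R d -> R) (xi eta : freq d) (c : freq d -> R[i]).

Let mC : measurable Cell. Proof. exact: (@measurable_cell R d). Qed.
Let Coo : (mu Cell < +oo)%E.
Proof. by rewrite (@cell_measure R d) ltry. Qed.

Let vol_neq0 : vol R d != 0. Proof. exact/lt0r_neq0/vol_gt0. Qed.

Lemma le_eps (a b : R) : (forall e, 0 < e -> a <= b + e) -> a <= b.
Proof. by move=> h; apply/ler_addgt0Pr => e; exact: h. Qed.

(** Testing against a fixed function is continuous for the mean-square
    convergence, by the Cauchy-Schwarz inequality. *)
Lemma integral_mul_lim (f : nat -> Rspace R d -> R) w g (l : R) N0 :
  (forall n, sq (f n)) -> sq w -> sq g ->
  (forall e : R, 0 < e -> exists N, forall n, (N <= n)%N ->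
    \int[mu]_(x in Cell) (f n x - w x) ^+ 2 <= e) ->
  (forall n, (N0 <= n)%N -> \int[mu]_(x in Cell) (f n x * g x) = l) ->
  \int[mu]_(x in Cell) (w x * g x) = l.
Proof.
move=> sf sw sg fw fl; apply/eqP; rewrite -subr_eq0 -normr_le0; apply: le_eps => e e0.
rewrite add0r; set G := \int[mu]_(x in Cell) g x ^+ 2.
have G0 : 0 <= G by apply: Rintegral_ge0 => x _; exact: sqr_ge0.
pose k := 2 * (G + 1) / e.
have k0 : 0 < k by rewrite divr_gt0// mulr_gt0// ltr_wpDl.
have [N hN] := fw (e / (2 * k)) ltac:(by rewrite divr_gt0// mulr_gt0).
pose n := maxn N N0.
have sfw := sqintB mC (sf n) sw.
have -> : \int[mu]_(x in Cell) (w x * g x) - l =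
   - \int[mu]_(x in Cell) ((f n x - w x) * g x).
  rewrite -(fl n) ?leq_maxr//.
  have i1 := sqint_mul_integrable mC (sf n) sg.
  have i2 := sqint_mul_integrable mC sw sg.
  rewrite -opprB -RintegralB//; congr (- _); apply: eq_Rintegral => x _; ring.
rewrite normrN; apply: le_trans (Rintegral_mul_le mC k0 sfw sg) _.
have h1 := hN n (leq_maxl _ _).
have h2 := ler_wpM2l (ltW k0) h1.
have h3 : k^-1 * G <= e / 2.
  have -> : k^-1 = e / (2 * (G + 1)) by rewrite /k invf_div.
  rewrite mulrAC ler_pdivrMr ?mulr_gt0 ?ltr_wpDl//.
  have := mulr_ge0 (ltW e0) G0; lra.
have h4 : k * (e / (2 * k)) = e / 2 by field; rewrite gt_eqF.
rewrite -/G; lra.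
Qed.

Lemma big_seq_sub (f : freq d -> R) (s t : seq (freq d)) :
  uniq s -> uniq t -> {subset s <= t} ->
  \sum_(xi <- t) f xi =
  \sum_(xi <- s) f xi + \sum_(xi <- [seq xi <- t | xi \notin s]) f xi.
Proof.
move=> us ut st; rewrite (bigID (mem s))/= big_filter; congr (_ + _).
rewrite -big_filter; apply: perm_big; apply: uniq_perm => //.
  exact: filter_uniq.
by move=> xi; rewrite mem_filter; apply: andb_idr; exact: st.
Qed.

(** An exhaustion of the frequencies by finite sets, along an enumeration. *)
Definition first_freqs (n : nat) : seq (freq d) := undup (pmap choice.unpickle (iota 0 n)).

Lemma first_freqs_uniq n : uniq (first_freqs n). Proof. exact: undup_uniq. Qed.

Lemma first_freqs_sub m n : (m <= n)%N -> {subset first_freqs m <= first_freqs n}.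
Proof.
move=> mn xi; rewrite !mem_undup !mem_pmap => /mapP[k]; rewrite mem_iota => /andP[_ km] e.
by apply/mapP; exists k => //; rewrite mem_iota/= (leq_trans km).
Qed.

Lemma mem_first_freqs xi n : (choice.pickle xi < n)%N -> xi \in first_freqs n.
Proof.
move=> xn; rewrite mem_undup mem_pmap; apply/mapP; exists (choice.pickle xi).
  by rewrite mem_iota.
by rewrite choice.pickleK.
Qed.

Lemma integral_cos_cos xi eta : \int[mu]_(x in Cell) (cos (dot xi x) * cos (dot eta x)) =
  vol R d / 2 * ((xi == eta)%:R + (xi == freq_opp eta)%:R).
Proof.
have ic k : mu.-integrable Cell (EFin \o (fun x => cos (@dot R d k x))).
  by apply: (sqint_integrable mC Coo); exact: sqint_cos_dot.
transitivity (\int[mu]_(x in Cell)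
   (2^-1 * (cos (dot (freq_sub xi eta) x) + cos (dot (freq_sub xi (freq_opp eta)) x)))).
  by apply: eq_Rintegral => x _; rewrite !dot_sub dot_opp opprK cosB cosD; field.
rewrite RintegralZl//; last exact: (integrableD mC (ic _) (ic _)).
rewrite RintegralD// !integral_cos_dot !freq_sub_eq0.
by case: (xi == eta); case: (xi == freq_opp eta) => /=; field.
Qed.

Lemma integral_sin_sin xi eta : \int[mu]_(x in Cell) (sin (dot xi x) * sin (dot eta x)) =
  vol R d / 2 * ((xi == eta)%:R - (xi == freq_opp eta)%:R).
Proof.
have ic k : mu.-integrable Cell (EFin \o (fun x => cos (@dot R d k x))).
  by apply: (sqint_integrable mC Coo); exact: sqint_cos_dot.
transitivity (\int[mu]_(x in Cell)
   (2^-1 * (cos (dot (freq_sub xi eta) x) - cos (dot (freq_sub xi (freq_opp eta)) x)))).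
  by apply: eq_Rintegral => x _; rewrite !dot_sub dot_opp opprK cosB cosD; field.
rewrite RintegralZl//; last exact: (integrableB mC (ic _) (ic _)).
rewrite RintegralB// !integral_cos_dot !freq_sub_eq0.
by case: (xi == eta); case: (xi == freq_opp eta) => /=; field.
Qed.

Lemma integral_sin_cos xi eta :
  \int[mu]_(x in Cell) (sin (dot xi x) * cos (dot eta x)) = 0.
Proof.
have ic k : mu.-integrable Cell (EFin \o (fun x => sin (@dot R d k x))).
  by apply: (sqint_integrable mC Coo); exact: sqint_sin_dot.
transitivity (\int[mu]_(x in Cell)
   (2^-1 * (sin (dot (freq_sub xi eta) x) + sin (dot (freq_sub xi (freq_opp eta)) x)))).
  by apply: eq_Rintegral => x _; rewrite !dot_sub dot_opp opprK sinB sinD; field.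
rewrite RintegralZl//; last exact: (integrableD mC (ic _) (ic _)).
by rewrite RintegralD// !integral_sin_dot addr0 mulr0.
Qed.

Lemma sum_pick (f : freq d -> R) (s : seq (freq d)) eta : uniq s -> eta \in s ->
  \sum_(xi <- s) f xi * (xi == eta)%:R = f eta.
Proof.
move=> us es; rewrite (bigD1_seq eta)//= eqxx mulr1 big1 ?addr0// => xi /negbTE ->.
by rewrite mulr0.
Qed.

Section symmetric_coefficients.
Variable c : freq d -> R[i].
Hypothesis c_sym : forall xi, c (freq_opp xi) = (c xi)^*%C.

Let Re_opp xi : complex.Re (c (freq_opp xi)) = complex.Re (c xi).
Proof. by rewrite c_sym; case: (c xi). Qed.
Let Im_opp xi : complex.Im (c (freq_opp xi)) = - complex.Im (c xi).
Proof. by rewrite c_sym; case: (c xi). Qed.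

Lemma integral_sum_re_cos s eta : uniq s -> eta \in s -> freq_opp eta \in s ->
  \int[mu]_(x in Cell) (sum_re c s x * cos (dot eta x)) = complex.Re (c eta).
Proof.
move=> us es os.
have sc := @sqint_cos_dot R d; have ss := @sqint_sin_dot R d.
have i1 xi := sqint_mul_integrable mC (sc xi) (sc eta).
have i2 xi := sqint_mul_integrable mC (ss xi) (sc eta).
have i3 xi : mu.-integrable Cell (EFin \o (fun x => wave_re (c xi) xi x * cos (dot eta x))).
  by apply: sqint_mul_integrable => //; exact: sq_wave_re.
transitivity (\int[mu]_(x in Cell)
   ((vol R d)^-1 * \sum_(xi <- s) (wave_re (c xi) xi x * cos (dot eta x)))).
  by apply: eq_Rintegral => x _; rewrite /sum_re -mulr_suml mulrA.
rewrite RintegralZl//; last exact: integrable_bigsum.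
rewrite Rintegral_sum//.
transitivity ((vol R d)^-1 * \sum_(xi <- s) (vol R d / 2 *
    (complex.Re (c xi) * (xi == eta)%:R + complex.Re (c xi) * (xi == freq_opp eta)%:R))).
  congr (_ * _); apply: eq_bigr => xi _; rewrite /wave_re.
  set al := complex.Re _; set be := complex.Im _.
  transitivity (\int[mu]_(x in Cell) (al * (cos (dot xi x) * cos (dot eta x)) -
      be * (sin (dot xi x) * cos (dot eta x)))).
    by apply: eq_Rintegral => x _; ring.
  rewrite RintegralB//; last 2 first.
  - exact: (integrableZl mC al (i1 xi)).
  - exact: (integrableZl mC be (i2 xi)).
  by rewrite !RintegralZl// integral_cos_cos integral_sin_cos; ring.
rewrite -mulr_sumr big_split/= !sum_pick// Re_opp; field.
exact: vol_neq0.
Qed.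

Lemma integral_sum_re_sin s eta : uniq s -> eta \in s -> freq_opp eta \in s ->
  \int[mu]_(x in Cell) (sum_re c s x * sin (dot eta x)) = - complex.Im (c eta).
Proof.
move=> us es os.
have sc := @sqint_cos_dot R d; have ss := @sqint_sin_dot R d.
have i1 xi := sqint_mul_integrable mC (sc xi) (ss eta).
have i2 xi := sqint_mul_integrable mC (ss xi) (ss eta).
have i3 xi : mu.-integrable Cell (EFin \o (fun x => wave_re (c xi) xi x * sin (dot eta x))).
  by apply: sqint_mul_integrable => //; exact: sq_wave_re.
transitivity (\int[mu]_(x in Cell)
   ((vol R d)^-1 * \sum_(xi <- s) (wave_re (c xi) xi x * sin (dot eta x)))).
  by apply: eq_Rintegral => x _; rewrite /sum_re -mulr_suml mulrA.
rewrite RintegralZl//; last exact: integrable_bigsum.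
rewrite Rintegral_sum//.
transitivity ((vol R d)^-1 * \sum_(xi <- s) (- (vol R d / 2) *
    (complex.Im (c xi) * (xi == eta)%:R - complex.Im (c xi) * (xi == freq_opp eta)%:R))).
  congr (_ * _); apply: eq_bigr => xi _; rewrite /wave_re.
  set al := complex.Re _; set be := complex.Im _.
  transitivity (\int[mu]_(x in Cell) (al * (sin (dot eta x) * cos (dot xi x)) -
      be * (sin (dot xi x) * sin (dot eta x)))).
    by apply: eq_Rintegral => x _; ring.
  have i1' : mu.-integrable Cell (EFin \o (fun x => sin (dot eta x) * cos (dot xi x))).
    by apply: eq_integrable (i1 xi) => // x _; rewrite /= mulrC.
  rewrite RintegralB//; last 2 first.
  - exact: (integrableZl mC al i1').
  - exact: (integrableZl mC be (i2 xi)).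
  by rewrite !RintegralZl// integral_sin_sin integral_sin_cos; ring.
rewrite -mulr_sumr sumrB !sum_pick// Im_opp; field.
exact: vol_neq0.
Qed.

(** A finite set s of frequencies need not be symmetric, and its partial sum may
    be complex; by the symmetry of c, the real part of this sum has the
    coefficient c eta as soon as s contains eta and its opposite.  These real
    parts over the first frequencies form a Cauchy sequence, since the integrals of
    their squared increments are at most the corresponding parts of the
    convergent series of |c|^2, up to the factor vol. *)
Theorem Riesz_Fischer (B : R) :
  (forall s, uniq s -> \sum_(xi <- s) abs2 (c xi) <= B) ->
  exists w, [/\ sq w, (forall xi, fourier w xi = c xi) &
    forall e : R, 0 < e -> exists N, forall n, (N <= n)%N ->
      \int[mu]_(x in Cell) (sum_re c (first_freqs n) x - w x) ^+ 2 <= e].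
Proof.
move=> cB; pose a n := \sum_(xi <- first_freqs n) abs2 (c xi).
have fu := first_freqs_uniq.
have a_sub m n : (m <= n)%N -> a n = a m +
    \sum_(xi <- [seq xi <- first_freqs n | xi \notin first_freqs m]) abs2 (c xi).
  by move=> mn; apply: big_seq_sub => //; exact: first_freqs_sub.
have a_nd : nondecreasing_seq a.
  move=> m n mn; rewrite (a_sub m n)// lerDl.
  by apply: sumr_ge0 => xi _; exact: abs2_ge0.
have a_cvg : cvgn a.
  by apply: nondecreasing_is_cvgn => //; exists B => _ [n _ <-]; exact: cB.
have v0 := vol_gt0 R d.
have a_cauchy e : 0 < e -> exists N, forall m n, (N <= m)%N -> (m <= n)%N ->
    (vol R d)^-1 * (a n - a m) <= e.
  move=> e0; have ve : 0 < vol R d * e by exact: mulr_gt0.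
  have /cvgrPdist_le /(_ _ ve) [N _ hN] := a_cvg.
  exists N => m n Nm mn; rewrite mulrC ler_pdivrMr// mulrC.
  have := hN m Nm; have := nondecreasing_cvgn_le a_nd a_cvg n.
  have := nondecreasing_cvgn_le a_nd a_cvg m => h1 h2.
  by rewrite /= ger0_norm ?subr_ge0//; lra.
pose f n := sum_re c (first_freqs n).
have sf n : sq (f n) by exact: sq_sum_re.
have f_diff m n : (m <= n)%N ->
    \int[mu]_(x in Cell) (f n x - f m x) ^+ 2 <= (vol R d)^-1 * (a n - a m).
  move=> mn; pose s := [seq xi <- first_freqs n | xi \notin first_freqs m].
  have us : uniq s by exact: filter_uniq.
  have -> : a n - a m = \sum_(xi <- s) abs2 (c xi) by rewrite (a_sub m n)// addrC addKr.
  rewrite -integral_sum_sqr//.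
  have ire := sqint_sqr (sq_sum_re c s); have iim := sqint_sqr (sq_sum_im c s).
  have fs x : f n x - f m x = sum_re c s x.
    rewrite /f /sum_re -mulrBr; congr (_ * _).
    rewrite (big_seq_sub (fun xi => wave_re (c xi) xi x) (fu m) (fu n) (first_freqs_sub mn)).
    by rewrite addrC addKr.
  apply: le_Rintegral => //.
  - by have [] := sqintB mC (sf n) (sf m).
  - exact: (integrableD mC ire iim).
  - by move=> x _; rewrite fs lerDl sqr_ge0.
have f_cauchy e : 0 < e -> exists N, forall m n, (N <= m)%N -> (N <= n)%N ->
    \int[mu]_(x in Cell) (f m x - f n x) ^+ 2 <= e.
  move=> e0; have [N hN] := a_cauchy _ e0; exists N => m n Nm Nn.
  have [mn|/ltnW nm] := leqP m n; last exact: le_trans (f_diff _ _ nm) (hN _ _ Nn nm).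
  apply: le_trans (hN _ _ Nm mn); apply: le_trans (f_diff _ _ mn).
  rewrite le_eqVlt; apply/orP; left; apply/eqP; apply: eq_Rintegral => x _; ring.
have [w [sw fw]] := sqint_complete mC Coo sf f_cauchy.
exists w; split => // xi.
(* From this index on, the coefficients of the partial sums at xi are
   exactly c xi. *)
have mem n : (maxn (choice.pickle xi).+1 (choice.pickle (freq_opp xi)).+1 <= n)%N ->
    xi \in first_freqs n /\ freq_opp xi \in first_freqs n.
  by rewrite geq_max => /andP[h1 h2]; split; exact: mem_first_freqs.
rewrite fourierE// /cos_coef /sin_coef.
rewrite (integral_mul_lim sf sw (@sqint_cos_dot R d xi) fw (l := complex.Re (c xi))
  (N0 := maxn (choice.pickle xi).+1 (choice.pickle (freq_opp xi)).+1)); last first.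
  by move=> n /mem[m1 m2]; exact: integral_sum_re_cos.
rewrite (integral_mul_lim sf sw (@sqint_sin_dot R d xi) fw (l := - complex.Im (c xi))
  (N0 := maxn (choice.pickle xi).+1 (choice.pickle (freq_opp xi)).+1)); last first.
  by move=> n /mem[m1 m2]; exact: integral_sum_re_sin.
by rewrite opprK; case: (c xi).
Qed.

End symmetric_coefficients.

Lemma fourier_sym v xi : sq v -> fourier v (freq_opp xi) = (fourier v xi)^*%C.
Proof.
move=> sv; rewrite !fourierE//= opprK; congr (_ +i* _).
  by apply: eq_Rintegral => x _; rewrite dot_opp cosN.
rewrite /sin_coef -mulN1r -RintegralZl//; last first.
  by apply: sqint_mul_integrable => //; exact: sqint_sin_dot.
by apply: eq_Rintegral => x _; rewrite dot_opp sinN; ring.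
Qed.

(** The difference annihilates all the characters. *)
Lemma fourier_inj v w : sq v -> sq w -> (forall xi, fourier v xi = fourier w xi) ->
  v = w %[ae mu in Cell].
Proof.
move=> sv sw vw; have svw := sqintB mC sv sw.
have ivw := sqint_integrable mC Coo svw.
have coefs xi : cos_coef v xi = cos_coef w xi /\ sin_coef v xi = sin_coef w xi.
  by have := vw xi; rewrite !fourierE// => -[-> /oppr_inj ->].
have : annihilates (fun x => v x - w x) (fun=> 1).
  move=> xi theta.
  have ic v' : sq v' -> mu.-integrable Cell (EFin \o (fun x => v' x * cos (dot xi x))).
    by move=> sv'; apply: sqint_mul_integrable => //; exact: sqint_cos_dot.
  have is_ v' : sq v' -> mu.-integrable Cell (EFin \o (fun x => v' x * sin (dot xi x))).
    by move=> sv'; apply: sqint_mul_integrable => //; exact: sqint_sin_dot.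
  have [e1 e2] := coefs xi; rewrite /cos_coef in e1; rewrite /sin_coef in e2.
  transitivity (\int[mu]_(x in Cell)
     (cos theta * ((v x * cos (dot xi x)) - (w x * cos (dot xi x)))
      - sin theta * ((v x * sin (dot xi x)) - (w x * sin (dot xi x))))).
    by apply: eq_Rintegral => x _; rewrite cosD; ring.
  have i1 := integrableB mC (ic _ sv) (ic _ sw).
  have i2 := integrableB mC (is_ _ sv) (is_ _ sw).
  rewrite RintegralB//; last 2 first.
  - exact: (integrableZl mC (cos theta) i1).
  - exact: (integrableZl mC (sin theta) i2).
  by rewrite !RintegralZl// !RintegralB// ?e1 ?e2 ?subrr ?mulr0 ?subr0; auto.
move=> /(annihilated_ae0 ivw); apply: filterS => x /[apply] -[/eqP].
by rewrite subr_eq0 => /eqP.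
Qed.

(** Let w be the function with the same coefficients as v that the Riesz-Fischer
    theorem provides as a mean-square limit of partial sums.  By completeness
    of the characters w = v, so that v is a limit of its own partial sums. *)
Theorem Parseval v (e : R) : sq v -> 0 < e -> exists s0 : seq (freq d),
  forall s, uniq s -> {subset s0 <= s} ->
    \int[mu]_(x in Cell) v x ^+ 2 - (vol R d)^-1 * \sum_(xi <- s) abs2 (fourier v xi) <= e.
Proof.
move=> sv e0; have v0 := vol_gt0 R d.
have cB s : uniq s -> \sum_(xi <- s) abs2 (fourier v xi) <=
    vol R d * \int[mu]_(x in Cell) v x ^+ 2.
  by move=> us; rewrite mulrC -ler_pdivrMr// mulrC; exact: Bessel.
have [w [sw wv fw]] := Riesz_Fischer (fun xi => fourier_sym xi sv) cB.
have aevw : v = w %[ae mu in Cell] by apply: fourier_inj => // xi; rewrite wv.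
set V := \int[mu]_(x in Cell) v x ^+ 2.
have V0 : 0 <= V by apply: Rintegral_ge0 => x _; exact: sqr_ge0.
pose k := e / (2 * (V + 1)).
have k0 : 0 < k by rewrite divr_gt0// mulr_gt0// ltr_wpDl.
have [N hN] := fw (e / 2 * k) ltac:(by rewrite mulr_gt0// divr_gt0).
exists (first_freqs N) => s us sub.
set f := sum_re (fourier v) (first_freqs N).
have sf : sq f by exact: sq_sum_re.
have sfv := sqintB mC sv sf.
have ae2 : \int[mu]_(x in Cell) (v x - f x) ^+ 2 = \int[mu]_(x in Cell) (f x - w x) ^+ 2.
  congr fine; apply: ae_eq_integral => //.
  - by apply: measurable_int; exact: (sqint_sqr sfv).
  - by apply: measurable_int; exact: (sqint_sqr (sqintB mC sf sw)).
  - by apply: filterS aevw => x /[apply] ->; congr (_%:E); ring.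
have mono : \sum_(xi <- first_freqs N) abs2 (fourier v xi) <= \sum_(xi <- s) abs2 (fourier v xi).
  rewrite (big_seq_sub _ (first_freqs_uniq N) us sub) lerDl.
  by apply: sumr_ge0 => xi _; exact: abs2_ge0.
have iN : 0 <= (vol R d)^-1 by rewrite invr_ge0 ltW.
have := ler_wpM2l iN mono.
rewrite -(integral_mul_sum_re (first_freqs N) sv) -/f => mono'.
suff : V - \int[mu]_(x in Cell) (v x * f x) <= e by lra.
have -> : V - \int[mu]_(x in Cell) (v x * f x) = \int[mu]_(x in Cell) (v x * (v x - f x)).
  have i2 := sqint_mul_integrable mC sv sf.
  rewrite -RintegralB//; last exact: sqint_sqr.
  by apply: eq_Rintegral => x _; ring.
apply: le_trans (ler_norm _) _; apply: le_trans (Rintegral_mul_le mC k0 sv sfv) _.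
rewrite -/V ae2.
have h1 : k * V <= e / 2.
  rewrite /k mulrAC ler_pdivrMr ?mulr_gt0 ?ltr_wpDl//; have := mulr_ge0 (ltW e0) V0; lra.
have ik0 : 0 <= k^-1 by rewrite invr_ge0 ltW.
have h2 := ler_wpM2l ik0 (hN N (leqnn N)).
have h3 : k^-1 * (e / 2 * k) = e / 2 by field; rewrite gt_eqF.
rewrite -/f in h2; lra.
Qed.

End Riesz_Fischer.

(** * Fourier series and the norm of L^2 *)

Section L2_norms.
Variables (R : realType) (d : nat).
Local Notation mu := (@lebesgue_tuple R d).
Local Notation Cell := (@cell R d).
Local Notation sq := (@sqint _ _ R mu Cell).
Implicit Types (v w : Rspace R d -> R).

Let mC : measurable Cell. Proof. exact: (@measurable_cell R d). Qed.

Lemma integral_cell_sqr v : sq v ->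
  (\int[mu]_x `|(v \_ Cell) x|%:E `^ 2 = (\int[mu]_(x in Cell) v x ^+ 2)%:E)%E.
Proof.
move=> sv; rewrite fineK; last by apply: integrable_fin_num => //; exact: sqint_sqr.
rewrite [RHS]integral_mkcond; apply: eq_integral => x _.
rewrite poweR_EFin !patchE; case: ifP => _.
  by rewrite powR_mulrn// -normrX ger0_norm ?sqr_ge0.
by rewrite normr0 powR0// pnatr_eq0.
Qed.

Lemma L2normE v : sq v -> L2norm v = (Num.sqrt (\int[mu]_(x in Cell) v x ^+ 2))%:E.
Proof.
move=> sv; rewrite /L2norm unlock.
rewrite /= (integral_cell_sqr sv).
rewrite poweR_EFin powR12_sqrt//.
by apply: Rintegral_ge0 => x _; exact: sqr_ge0.
Qed.

Lemma in_L2P v : in_L2 v <-> sq v.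
Proof.
split=> [hv|sv].
  have := Lfun2_integrable_sqr hv.
  move: hv; rewrite /in_L2 inE => /andP[]; rewrite inE/= => mv _ iv.
  have mv' : measurable_fun Cell v := (measurable_restrictT v mC).2 mv.
  split => //; apply: (integrable_mkcond _ mC).2.
  apply: eq_integrable iv => // x _; rewrite /= !patchE.
  by case: ifP => //; rewrite expr0n.
rewrite /in_L2 inE; apply/andP; split; rewrite inE/=.
  by apply: (measurable_restrictT v mC).1; case: sv.
by rewrite /finite_norm; have := L2normE sv; rewrite /L2norm => ->; exact: ltry.
Qed.

Lemma L2norm_eq v w : (forall x, Cell x -> v x = w x) -> L2norm v = L2norm w.
Proof.
move=> vw; rewrite /L2norm; congr Lnorm; apply/funext => x /=; congr (_%:E).
by rewrite !patchE; case: ifPn => //; rewrite inE; exact: vw.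
Qed.

Lemma fourier_eq v w xi : (forall x, Cell x -> v x = w x) -> fourier v xi = fourier w xi.
Proof.
move=> vw; rewrite /fourier /cintegral; congr (_ +i* _);
  by apply: eq_Rintegral => x; rewrite inE => cx; rewrite vw.
Qed.

Lemma sqint_sqrt v : measurable_fun Cell v -> (forall x, 0 <= v x) ->
  mu.-integrable Cell (EFin \o v) -> sq (fun x => Num.sqrt (v x)).
Proof.
move=> mv v0 iv; split.
  apply: (@measurableT_comp _ _ _ _ _ _ (@Num.sqrt R)) => //.
  by apply: continuous_measurable_fun; exact: sqrt_continuous.
by apply: eq_integrable iv => // x _ /=; rewrite sqr_sqrtr.
Qed.

Lemma mean_zeroP v : sq v -> mean_zero v <-> fourier v (freq0 d) = 0.
Proof.
move=> sv; have c0 : cos_coef v (freq0 d) = \int[mu]_(x in Cell) v x.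
  by apply: eq_Rintegral => x _; rewrite dot_freq0 cos0 mulr1.
have s0 : sin_coef v (freq0 d) = 0.
  rewrite /sin_coef (_ : 0 = \int[mu]_(x in Cell) (0 : R)); last first.
    by rewrite Rintegral_cst// mul0r.
  by apply: eq_Rintegral => x _; rewrite dot_freq0 sin0 mulr0.
rewrite fourierE// c0 s0 oppr0 /mean_zero; split=> [->//|].
by move=> /eqP; rewrite eq_complex/= => /andP[/eqP].
Qed.

(** The squared distance from v to a partial sum is the Parseval defect, which
    is small along all finite sets that contain a suitable one. *)
Lemma fourier_series v : sq v -> is_fourier_series v (fourier v).
Proof.
move=> sv; rewrite /is_fourier_series.
have v0 := vol_gt0 R d.
pose err (F : {fset (freq d)}) : R := \int[mu]_(x in Cell) v x ^+ 2 -
  (vol R d)^-1 * \sum_(xi <- F) abs2 (fourier v xi).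
have errE F : L2norm (fun x =>
    ComplexField.Normc.normc ((v x)%:C - fourier_partial_sum (fourier v) F x)) =
    (Num.sqrt (err F))%:E.
  have sr := sq_sum_re (fourier v) F; have si := sq_sum_im (fourier v) F.
  have svr := sqintB mC sv sr.
  pose h x := (v x - sum_re (fourier v) F x) ^+ 2 + sum_im (fourier v) F x ^+ 2.
  have h0 x : 0 <= h x by rewrite addr_ge0 ?sqr_ge0.
  have ih : mu.-integrable Cell (EFin \o h).
    exact: (integrableD mC (sqint_sqr svr) (sqint_sqr si)).
  have mh : measurable_fun Cell h by apply/measurable_EFinP; exact: measurable_int ih.
  have sh := sqint_sqrt mh h0 ih.
  rewrite (@L2norm_eq _ (fun x => Num.sqrt (h x))); last first.
    by move=> x _; rewrite partial_sumE /h /= sub0r sqrrN.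
  rewrite L2normE//; congr ((Num.sqrt _)%:E).
  rewrite /err -integral_sqr_error// ?fset_uniq//.
  by apply: eq_Rintegral => x _; rewrite sqr_sqrtr.
under eq_fun do rewrite errE.
have totallyF := @summability.totally_filter (freq d).
apply: cvg_EFin; first exact: nearW.
apply/cvgrPdist_le => e e0.
have [s0 hs0] := Parseval sv (exprn_gt0 2 e0).
exists [fset xi in s0]%fset => // F sF.
rewrite /= sub0r normrN ger0_norm ?sqrtr_ge0//.
rewrite -ler_sqr ?nnegrE ?sqrtr_ge0 ?(ltW e0)// sqr_sqrtr; last first.
  by rewrite subr_ge0; apply: Bessel => //; exact: fset_uniq.
apply: hs0; first exact: fset_uniq.
by move=> xi xs; apply: (fsubsetP sF); rewrite in_fset.
Qed.

End L2_norms.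

(** * The saddle-point system at one frequency *)

Section saddle_point_matrix.
Variables (R : realType) (d : nat).
Variables (l D q : R) (b : 'cV[R]_d).
Hypotheses (l_neq0 : l != 0) (q_neq0 : q != 0).
Hypothesis qE : q = \sum_(i < d) b i ord0 ^+ 2 + D * l.
Local Notation C := R[i].
Local Notation B := (map_mx (real_complex R) b).

Let lC : l%:C != 0 :> C. Proof. by rewrite fmorph_eq0. Qed.
Let qC : q%:C != 0 :> C. Proof. by rewrite fmorph_eq0. Qed.
Let ii : 'i * 'i = -1 :> C. Proof. by rewrite -expr2 sqr_i. Qed.

(** A block computation in which b^T b = q - D l is the only relation used. *)
Lemma saddle_mulV :
  block_mx (l%:C%:M) ('i *: B) ('i *: B^T) (D%:C)%:M *m
  block_mx (l%:C^-1 *: (1%:M - q%:C^-1 *: (B *m B^T)))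
    ((- 'i / q%:C) *: B) ((- 'i / q%:C) *: B^T) ((l / q)%:C)%:M = 1%:M :> 'M[C]_(d + 1).
Proof.
have BB : B^T *m B = (q%:C - D%:C * l%:C)%:M :> 'M[C]_1.
  apply/matrixP => i j; rewrite !ord1 !mxE eqxx mulr1n qE rmorphD rmorphM/= addrK rmorph_sum/=.
  by apply: eq_bigr => k _; rewrite !mxE expr2 rmorphM.
have lqC : (l / q)%:C = l%:C / q%:C :> C by rewrite rmorphM fmorphV.
rewrite mulmx_block [RHS]scalar_mx_block lqC.
congr block_mx.
- rewrite mul_scalar_mx scalerA divff// scale1r -scalemxAl -scalemxAr scalerA.
  rewrite mulrA mulrN ii opprK mul1r; exact: subrK.
- rewrite mul_scalar_mx mul_mx_scalar !scalerA -scalerDl.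
  rewrite (_ : _ + _ = 0) ?scale0r//; field; exact: qC.
- have e : B^T *m (1%:M - q%:C^-1 *: (B *m B^T)) = (D%:C * l%:C / q%:C) *: B^T.
    rewrite mulmxBr mulmx1 -scalemxAr mulmxA BB mul_scalar_mx scalerA.
    rewrite -[X in X - _]scale1r -scalerBl; congr (_ *: _); field; exact: qC.
  rewrite -scalemxAl -scalemxAr e mul_scalar_mx !scalerA -scalerDl.
  rewrite (_ : _ + _ = 0) ?scale0r//; field; exact/andP.
- rewrite -scalemxAl -scalemxAr BB -scalar_mxM.
  rewrite scalerA !scale_scalar_mx -raddfD/=; congr (_%:M).
  have -> : 'i * (- 'i / q%:C) = q%:C^-1 by rewrite mulrA mulrN ii opprK mul1r.
  field; exact: qC.
Qed.

Definition bdot (x : 'I_d -> R) : R := \sum_(i < d) b i ord0 * x i.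

(** The components of the solution are written with real and imaginary parts so
    that norms and conjugates can be read off. *)
Definition u_sol (F : 'cV[C]_d) (G : C) (i : 'I_d) : C :=
  (l^-1 * (complex.Re (F i ord0) - q^-1 * (b i ord0 * bdot (fun j => complex.Re (F j ord0))))
    + q^-1 * (b i ord0 * complex.Im G)) +i*
  (l^-1 * (complex.Im (F i ord0) - q^-1 * (b i ord0 * bdot (fun j => complex.Im (F j ord0))))
    - q^-1 * (b i ord0 * complex.Re G)).

Definition p_sol (F : 'cV[C]_d) (G : C) : C :=
  (q^-1 * bdot (fun j => complex.Im (F j ord0)) + l / q * complex.Re G) +i*
  (- (q^-1 * bdot (fun j => complex.Re (F j ord0))) + l / q * complex.Im G).

Lemma sol_momentum F G i :
  l%:C * u_sol F G i + 'i * p_sol F G * (b i ord0)%:C = F i ord0.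
Proof.
rewrite /u_sol /p_sol; set X := bdot _; set Y := bdot _.
apply/eqP; rewrite eq_complex /= !mul0r !mul1r !mulr0 !subr0 !addr0 ?add0r ?sub0r.
by case: (F i ord0) (G) => x y [s t] /=; apply/andP; split; apply/eqP; field; exact/andP.
Qed.

Lemma bdotB x y : bdot (fun i => x i - y i) = bdot x - bdot y.
Proof. by rewrite /bdot -sumrB; apply: eq_bigr => i _; rewrite mulrBr. Qed.

Lemma bdotD x y : bdot (fun i => x i + y i) = bdot x + bdot y.
Proof. by rewrite /bdot -big_split; apply: eq_bigr => i _; rewrite mulrDr. Qed.

Lemma bdotZ a x : bdot (fun i => a * x i) = a * bdot x.
Proof. by rewrite /bdot mulr_sumr; apply: eq_bigr => i _; rewrite mulrCA. Qed.

Lemma bdot_b a : bdot (fun i => b i ord0 * a) = (q - D * l) * a.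
Proof. by rewrite qE addrK mulr_suml; apply: eq_bigr => i _; rewrite mulrA expr2. Qed.

Lemma sol_divergence F G :
  'i * (\sum_(i < d) (b i ord0)%:C * u_sol F G i) + D%:C * p_sol F G = G.
Proof.
have -> : \sum_(i < d) (b i ord0)%:C * u_sol F G i =
    bdot (fun i => complex.Re (u_sol F G i)) +i* bdot (fun i => complex.Im (u_sol F G i)).
  rewrite /bdot; elim/big_ind3 : _ => //.
    by move=> a1 b1 z1 a2 b2 z2 -> ->.
  by move=> i _; apply/eqP; rewrite eq_complex /= !mul0r subr0 addr0 !eqxx.
rewrite /u_sol /p_sol /= bdotD bdotB !bdotZ !bdotB !bdotZ !bdot_b.
set X := bdot _; set Y := bdot _.
apply/eqP; rewrite eq_complex /= !mul0r !mul1r.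
by case: G => s t /=; apply/andP; split; apply/eqP; field; exact/andP.
Qed.

End saddle_point_matrix.

(** * Bounds on the solution at one frequency *)

Section solution_bounds.
Variables (R : realType) (d : nat).
Variables (l D q K : R) (b : 'cV[R]_d).
Hypothesis qE : q = \sum_(i < d) b i ord0 ^+ 2 + D * l.
Hypotheses (l_ge : 1 / 16 <= l) (q_gt0 : 0 < q) (Dl_ge0 : 0 <= D * l).
Hypotheses (K_ge : 16 <= K) (qK : q^-1 <= K) (lqK : l / q <= K).
Local Notation bdot := (bdot b).

Let bb_le : \sum_(i < d) b i ord0 ^+ 2 <= q. Proof. by rewrite qE lerDl. Qed.
Let iq_gt0 : 0 < q^-1. Proof. by rewrite invr_gt0. Qed.

Lemma bdot_sqr_le (x : 'I_d -> R) : bdot x ^+ 2 <= q * \sum_i x i ^+ 2.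
Proof.
apply: le_trans (sum_Cauchy_Schwarz _ _) _; apply: ler_wpM2r => //.
by apply: sumr_ge0 => i _; exact: sqr_ge0.
Qed.

(** The matrix I - b b^T / q is a contraction, because |b|^2 <= q. *)
Lemma projection_le (x : 'I_d -> R) :
  \sum_(i < d) (x i - q^-1 * (b i ord0 * bdot x)) ^+ 2 <= \sum_(i < d) x i ^+ 2.
Proof.
set X := bdot x.
have -> : \sum_(i < d) (x i - q^-1 * (b i ord0 * X)) ^+ 2 =
   \sum_(i < d) x i ^+ 2 - 2 * q^-1 * X * (\sum_(i < d) b i ord0 * x i)
     + (\sum_(i < d) b i ord0 ^+ 2) * (q^-1 * X) ^+ 2.
  rewrite mulr_sumr mulr_suml -sumrB -big_split /=.
  by apply: eq_bigr => i _; ring.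
rewrite -/(bdot x) -/X.
have : (\sum_(i < d) b i ord0 ^+ 2) * (q^-1 * X) ^+ 2 <= q * (q^-1 * X) ^+ 2.
  by apply: ler_wpM2r => //; exact: sqr_ge0.
have -> : q * (q^-1 * X) ^+ 2 = q^-1 * X * X by field; rewrite gt_eqF.
have : 0 <= q^-1 * X * X by rewrite -mulrA mulr_ge0 ?(ltW iq_gt0)// -expr2 sqr_ge0.
lra.
Qed.

Lemma sqrD_le (x y : R) : (x + y) ^+ 2 <= 2 * x ^+ 2 + 2 * y ^+ 2.
Proof. by have := sqr_ge0 (x - y); rewrite sqrrB sqrrD; lra. Qed.

(** The second term is harmless because |b|^2 / q^2 <= 1 / q. *)
Lemma component_le (x : 'I_d -> R) (y : R) :
  \sum_(i < d) (l^-1 * (x i - q^-1 * (b i ord0 * bdot x)) + q^-1 * (b i ord0 * y)) ^+ 2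
  <= 2 * K ^+ 2 * (\sum_(i < d) x i ^+ 2) + 2 * K ^+ 2 * y ^+ 2.
Proof.
have l_gt0 : 0 < l by apply: lt_le_trans l_ge; rewrite divr_gt0.
have il : l^-1 <= K.
  by apply: le_trans K_ge; rewrite -[leLHS]mul1r ler_pdivrMr//; have := l_ge; lra.
have il0 : 0 <= l^-1 by rewrite invr_ge0 ltW.
apply: le_trans (ler_sum _ (fun i _ => sqrD_le _ _)) _.
rewrite big_split/= -!mulr_sumr; apply: lerD.
  rewrite -mulrA; apply: ler_wpM2l => //.
  rewrite (eq_bigr _ (fun i _ => exprMn 2 _ _)) -mulr_sumr; apply: ler_pM; rewrite ?exprn_ge0//.
  - by apply: sumr_ge0 => i _; exact: sqr_ge0.
  - by rewrite ler_sqr// nnegrE (le_trans il0).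
  - exact: projection_le.
rewrite -mulrA; apply: ler_wpM2l => //.
rewrite (eq_bigr (fun i => b i ord0 ^+ 2 * (q^-1 * y) ^+ 2)); last first.
  by move=> i _; ring.
rewrite -mulr_suml exprMn mulrA; apply: ler_wpM2r; first exact: sqr_ge0.
apply: (@le_trans _ _ (q * q^-1 ^+ 2)); first by apply: ler_wpM2r => //; exact: sqr_ge0.
have -> : q * q^-1 ^+ 2 = q^-1 by field; rewrite gt_eqF.
by apply: le_trans qK _; rewrite expr2 ler_peMl//; have := K_ge; lra.
Qed.

Lemma u_sol_le (F : 'cV[R[i]]_d) (G : R[i]) :
  \sum_(i < d) abs2 (u_sol l q b F G i) <=
  2 * K ^+ 2 * (\sum_(i < d) abs2 (F i ord0) + abs2 G).
Proof.
rewrite /abs2 !big_split/= /u_sol /=.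
have h1 := component_le (fun i => complex.Re (F i ord0)) (complex.Im G).
have h2 := component_le (fun i => complex.Im (F i ord0)) (- complex.Re G).
rewrite sqrrN in h2.
have -> : \sum_(i < d) (l^-1 * (complex.Im (F i ord0) -
      q^-1 * (b i ord0 * bdot (fun j => complex.Im (F j ord0)))) -
      q^-1 * (b i ord0 * complex.Re G)) ^+ 2 =
  \sum_(i < d) (l^-1 * (complex.Im (F i ord0) -
      q^-1 * (b i ord0 * bdot (fun j => complex.Im (F j ord0)))) +
      q^-1 * (b i ord0 * - complex.Re G)) ^+ 2.
  by apply: eq_bigr => i _; ring.
lra.
Qed.

Lemma pressure_le (x : 'I_d -> R) (y : R) :
  (q^-1 * bdot x + l / q * y) ^+ 2 <=
  2 * K ^+ 2 * (\sum_(i < d) x i ^+ 2) + 2 * K ^+ 2 * y ^+ 2.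
Proof.
have h1 : (q^-1 * bdot x) ^+ 2 <= K ^+ 2 * \sum_(i < d) x i ^+ 2.
  rewrite exprMn; apply: (@le_trans _ _ (q^-1 ^+ 2 * (q * \sum_(i < d) x i ^+ 2))).
    by apply: ler_wpM2l; [exact: sqr_ge0|exact: bdot_sqr_le].
  rewrite mulrA; apply: ler_wpM2r.
    by apply: sumr_ge0 => i _; exact: sqr_ge0.
  have -> : q^-1 ^+ 2 * q = q^-1 by field; rewrite gt_eqF.
  by apply: le_trans qK _; rewrite expr2 ler_peMl//; have := K_ge; lra.
have h2 : (l / q * y) ^+ 2 <= K ^+ 2 * y ^+ 2.
  rewrite exprMn; apply: ler_wpM2r; first exact: sqr_ge0.
  have lq0 : 0 <= l / q by rewrite mulr_ge0 ?(ltW iq_gt0)//; have := l_ge; lra.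
  by rewrite ler_sqr// nnegrE (le_trans lq0).
have := sqrD_le (q^-1 * bdot x) (l / q * y); lra.
Qed.

Lemma p_sol_le (F : 'cV[R[i]]_d) (G : R[i]) :
  abs2 (p_sol l q b F G) <=
  2 * K ^+ 2 * (\sum_(i < d) abs2 (F i ord0) + abs2 G).
Proof.
rewrite /abs2 big_split/= /p_sol /=.
have h1 := pressure_le (fun i => complex.Im (F i ord0)) (complex.Re G).
have h2 := pressure_le (fun i => complex.Re (F i ord0)) (- complex.Im G).
have e X Y : (- (q^-1 * X) + l / q * Y) ^+ 2 = (q^-1 * X + l / q * - Y) ^+ 2 by ring.
rewrite e; rewrite sqrrN in h2; lra.
Qed.

End solution_bounds.

(** * Periodic extension and parity of the multipliers *)

Section periodic_extension.
Variables (R : realType) (d : nat).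
Local Notation pi := (@pi R).

(** The representative of t modulo 2 pi in [-pi, pi[. *)
Definition wrap1 (t : R) : R := t - 2 * pi * (Num.floor ((t + pi) / (2 * pi)))%:~R.

Let pi2_gt0 : 0 < 2 * pi. Proof. by rewrite mulr_gt0// pi_gt0. Qed.

Lemma wrap1_id t : - pi < t < pi -> wrap1 t = t.
Proof.
move=> /andP[t1 t2]; rewrite /wrap1 (@floor_def _ _ 0) ?mulr0z ?mulr0 ?subr0//.
rewrite add0r mulr1z divr_ge0 ?(ltW pi2_gt0)//=; last by lra.
by rewrite ltr_pdivrMr//; lra.
Qed.

Lemma wrap1_period t (k : int) : wrap1 (t + 2 * pi * k%:~R) = wrap1 t.
Proof.
rewrite /wrap1.
have -> : (t + 2 * pi * k%:~R + pi) / (2 * pi) = (t + pi) / (2 * pi) + k%:~R.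
  have gen (p : R) : p != 0 -> (t + 2 * p * k%:~R + p) / (2 * p) = (t + p) / (2 * p) + k%:~R.
    by move=> p0; field.
  exact/gen/lt0r_neq0/pi_gt0.
set y := (t + pi) / (2 * pi).
rewrite (@floor_def _ (y + k%:~R) (Num.floor y + k)).
  by rewrite rmorphD/=; ring.
have /andP[h1 h2] := floor_itv y.
by rewrite addrAC !(rmorphD _ _ k)/= lerD2r ltrD2r h1.
Qed.

Definition wrap (x : Rspace R d) : Rspace R d := [tuple wrap1 (tnth x i) | i < d].

Lemma wrap_id x : cell x -> wrap x = x.
Proof. by move=> cx; apply/eq_from_tnth => i; rewrite tnth_mktuple wrap1_id. Qed.

Lemma wrap_periodic T (w : Rspace R d -> T) : cell_periodic (w \o wrap).
Proof.
move=> k x /=; congr w; apply/eq_from_tnth => i.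
by rewrite !tnth_mktuple wrap1_period.
Qed.

End periodic_extension.

Section multiplier_parity.
Variables (R : realType) (d : nat).
Local Notation mu := (@lebesgue_tuple R d).
Variables (delta : R) (om omt omh : R -> R) (m M : R).
Hypothesis delta_gt0 : 0 < delta.
Hypothesis hK : kernel_assumption d delta om omt omh m M.

Lemma lambda_opp (xi : freq d) : lambda_ delta om (freq_opp xi) = lambda_ delta om xi.
Proof. by apply: eq_Rintegral => x _; rewrite dot_opp cosN. Qed.

Lemma c_opp (xi : freq d) : c_ delta omt (freq_opp xi) = c_ delta omt xi.
Proof. by apply: eq_Rintegral => x _; rewrite dot_opp cosN. Qed.

Lemma b_opp (xi : freq d) : b_ delta omh (freq_opp xi) = - b_ delta omh xi.
Proof.
apply/matrixP => i j; rewrite (ord1 j) -[0]/(@ord0 0) [RHS]mxE.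
rewrite !(bE delta_gt0 hK) -mulN1r -RintegralZl//.
  apply: eq_Rintegral => x _.
  by rewrite -![lform (freqR _ _) x]/(dot _ x) dot_opp sinN; ring.
exact: (b_integrable delta_gt0 hK).
Qed.

Lemma q_opp (xi : freq d) : q_ delta om omt omh (freq_opp xi) = q_ delta om omt omh xi.
Proof.
rewrite /q_ lambda_opp c_opp b_opp !vnorm_sqr; congr (_ + _).
by apply: eq_bigr => i _; rewrite mxE sqrrN.
Qed.

Lemma freq_opp_eq0 (xi : freq d) : (freq_opp xi == freq0 d) = (xi == freq0 d).
Proof.
have opp0 : freq_opp (freq0 d) = freq0 d.
  by apply/eq_from_tnth => i; rewrite !tnth_mktuple oppr0.
by apply/eqP/eqP => [h|->//]; rewrite -(freq_oppK xi) h opp0.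
Qed.

End multiplier_parity.

(** * The nonlocal Stokes system *)

Section norms_of_families.
Variables (R : realType) (d : nat).
Local Notation mu := (@lebesgue_tuple R d).
Local Notation Cell := (@cell R d).
Local Notation sq := (@sqint _ _ R mu Cell).

Let mC : measurable Cell. Proof. exact: (@measurable_cell R d). Qed.

(** Bounds on the coefficients of a vector field concern the sum over its
    components at each frequency, whence the common finite set s in the
    hypothesis. *)
Lemma Parseval_le (I : finType) (w : I -> Rspace R d -> R) (B : R) :
  (forall i, sq (w i)) ->
  (forall s, uniq s ->
     (vol R d)^-1 * \sum_(xi <- s) \sum_i abs2 (fourier (w i) xi) <= B) ->
  \sum_i \int[mu]_(x in Cell) w i x ^+ 2 <= B.
Proof.
move=> sw hB; apply: le_eps => e e0.
have e1 : 0 < e / (#|I|%:R + 1) by rewrite divr_gt0// ltr_wpDl.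
have /choice[s0 hs0] := fun i => Parseval (sw i) e1.
pose s := undup (flatten [seq s0 i | i <- enum I]).
have us : uniq s by exact: undup_uniq.
have sub i : {subset s0 i <= s}.
  move=> xi xis; rewrite mem_undup; apply/flattenP; exists (s0 i) => //.
  by apply: map_f; rewrite mem_enum.
apply: (@le_trans _ _ (\sum_i ((vol R d)^-1 * \sum_(xi <- s) abs2 (fourier (w i) xi)
   + e / (#|I|%:R + 1)))).
  by apply: ler_sum => i _; have := hs0 i s us (sub i); lra.
rewrite big_split/= sumr_const -mulr_sumr exchange_big/=; apply: lerD; first exact: hB.
rewrite -[leLHS]mulr_natr mulrAC ler_pdivrMr ?ltr_wpDl//.
by rewrite mulrDr mulr1 lerDl ltW.
Qed.

Lemma L2normvE (u : Rspace R d -> 'cV[R]_d) : (forall i, sq (vcomp u i)) ->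
  L2normv u = (Num.sqrt (\sum_i \int[mu]_(x in Cell) vcomp u i x ^+ 2))%:E.
Proof.
move=> su; pose h x := \sum_i vcomp u i x ^+ 2.
have iu i : mu.-integrable Cell (EFin \o (fun x => vcomp u i x ^+ 2)).
  exact: sqint_sqr.
have ih : mu.-integrable Cell (EFin \o h) by exact: integrable_bigsum.
have h0 x : 0 <= h x by apply: sumr_ge0 => i _; exact: sqr_ge0.
have mh : measurable_fun Cell h by apply/measurable_EFinP; exact: measurable_int ih.
rewrite /L2normv L2normE; last exact: (sqint_sqrt mh h0 ih).
rewrite -Rintegral_sum//; congr ((Num.sqrt _)%:E).
by apply: eq_Rintegral => x _ /=; rewrite vnorm_sqr.
Qed.

Lemma sqrt_energy_le (K x y z : R) : 0 <= K -> 0 <= x -> 0 <= y ->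
  z <= 2 * K ^+ 2 * (x + y) -> Num.sqrt z <= 2 * K * (Num.sqrt x + Num.sqrt y).
Proof.
move=> K0 x0 y0 hz.
have h0 : 0 <= 2 * K * (Num.sqrt x + Num.sqrt y).
  by rewrite !mulr_ge0// addr_ge0 ?sqrtr_ge0.
rewrite -(ger0_norm h0) -sqrtr_sqr; apply: ler_wsqrtr; apply: le_trans hz _.
have -> : (2 * K * (Num.sqrt x + Num.sqrt y)) ^+ 2 =
    4 * K ^+ 2 * (Num.sqrt x ^+ 2 + Num.sqrt y ^+ 2 + 2 * (Num.sqrt x * Num.sqrt y)).
  by ring.
rewrite !sqr_sqrtr//; have h3 : 0 <= Num.sqrt x * Num.sqrt y by rewrite mulr_ge0 ?sqrtr_ge0.
have h1 := mulr_ge0 (sqr_ge0 K) h3.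
have h2 := mulr_ge0 (sqr_ge0 K) x0; have h4 := mulr_ge0 (sqr_ge0 K) y0; nra.
Qed.

End norms_of_families.

Section Stokes_system.
Variables (R : realType) (d : nat).
Local Notation mu := (@lebesgue_tuple R d).
Local Notation Cell := (@cell R d).
Local Notation sq := (@sqint _ _ R mu Cell).
Local Notation C := R[i].
Variables (delta : R) (om omt omh : R -> R) (m M : R).
Hypothesis d_gt1 : (1 < d)%N.
Hypothesis d_le3 : (d <= 3)%N.
Hypothesis delta_gt0 : 0 < delta.
Hypothesis delta_le1 : delta <= 1.
Hypothesis m_gt0 : 0 < m.
Hypothesis hK : kernel_assumption d delta om omt omh m M.
Variables (f : Rspace R d -> 'cV[R]_d) (g : Rspace R d -> R).
Hypothesis f_sq : forall i, sq (vcomp f i).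
Hypothesis g_sq : sq g.
Hypothesis f_mean : mean_zerov f.
Hypothesis g_mean : mean_zero g.

Let mC : measurable Cell. Proof. exact: (@measurable_cell R d). Qed.

Local Notation l := (lambda_ delta om).
Local Notation b := (b_ delta omh).
Local Notation c := (c_ delta omt).
Local Notation q := (q_ delta om omt omh).
Local Notation A := (A_ delta om omt omh).

(** The bound on 1 / q and lambda / q; it also exceeds 1 / lambda. *)
Definition K_ : R := 16 * (1 + 288 / m).

Lemma K_ge16 : 16 <= K_.
Proof.
have : 0 <= 288 / m by apply: divr_ge0; [exact: ler0n|exact: ltW].
by rewrite /K_; lra.
Qed.

Lemma qE xi : q xi = \sum_(i < d) b xi i ord0 ^+ 2 + (delta ^+ 2 * c xi) * l xi.
Proof. by rewrite /q_ vnorm_sqr. Qed.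

Let bounds xi : xi <> freq0 d ->
  [/\ 1 / 16 <= l xi, 0 < q xi, (q xi)^-1 <= K_ & l xi / q xi <= K_].
Proof. exact: (multiplier_bounds d_gt1 delta_gt0 m_gt0 hK). Qed.

Let l_neq0 xi : xi <> freq0 d -> l xi != 0.
Proof. by move=> /bounds[l16 _ _ _]; rewrite gt_eqF// (lt_le_trans _ l16)// divr_gt0. Qed.

Let q_neq0 xi : xi <> freq0 d -> q xi != 0.
Proof. by move=> /bounds[_ q0 _ _]; rewrite gt_eqF. Qed.

Lemma A_mul_Ainv xi : xi <> freq0 d -> A xi *m Ainv_ delta om omt omh xi = 1%:M.
Proof. by move=> xi0; apply: saddle_mulV; [exact: l_neq0|exact: q_neq0|exact: qE]. Qed.

Lemma A_unit xi : xi <> freq0 d -> A xi \in unitmx.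
Proof. by move=> /A_mul_Ainv /mulmx1_unit[]. Qed.

Lemma invmx_A xi : xi <> freq0 d -> invmx (A xi) = Ainv_ delta om omt omh xi.
Proof.
move=> xi0; rewrite -[RHS](mulKmx (A_unit xi0)).
by rewrite A_mul_Ainv// mulmx1.
Qed.

Lemma system_matrix (u : Rspace R d -> 'cV[R]_d) (p : Rspace R d -> R) xi :
  - opL delta om u xi + opG delta omh p xi = fourierv f xi ->
  opD delta omh u xi - (delta ^+ 2)%:C * opR delta omt p xi = fourier g xi ->
  A xi *m col_mx (fourierv u xi) (fourier p xi)%:M =
    col_mx (fourierv f xi) (fourier g xi)%:M.
Proof.
move=> e1 e2; rewrite /A_ mul_block_col; congr col_mx.
  rewrite -e1 /opL /opG opprK mul_scalar_mx mul_mx_scalar scalerA.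
  by rewrite [in RHS]mulrC.
apply/matrixP => i j; rewrite !ord1 [RHS]mxE eqxx mulr1n -e2 /opD /opR mulrN opprK.
rewrite [LHS]mxE; congr (_ + _).
  by rewrite -scalemxAl mxE; congr (_ * _); rewrite !ord1.
by rewrite -scalar_mxM mxE eqxx mulr1n rmorphM mulrA.
Qed.

(** The coefficient 0 at the frequency 0 is the mean-value condition. *)
Definition u_hat (i : 'I_d) (xi : freq d) : C :=
  if xi == freq0 d then 0
  else u_sol (l xi) (q xi) (b xi) (fourierv f xi) (fourier g xi) i.

Definition p_hat (xi : freq d) : C :=
  if xi == freq0 d then 0
  else p_sol (l xi) (q xi) (b xi) (fourierv f xi) (fourier g xi).

Lemma fourierv_opp xi i :
  fourierv f (freq_opp xi) i ord0 = (fourierv f xi i ord0)^*%C.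
Proof. by rewrite !mxE; exact: fourier_sym. Qed.

Lemma bdot_opp xi (F F' : 'I_d -> R) : (forall i, F i = F' i) ->
  bdot (b (freq_opp xi)) F = - bdot (b xi) F'.
Proof.
move=> FF; rewrite /bdot -sumrN; apply: eq_bigr => i _.
by rewrite (b_opp delta_gt0 hK) mxE FF mulNr.
Qed.

(** The solution is real: its coefficients inherit the conjugation symmetry of
    those of f and g, since lambda and q are even in xi and b is odd. *)
Lemma u_hat_sym i xi : u_hat i (freq_opp xi) = (u_hat i xi)^*%C.
Proof.
rewrite /u_hat freq_opp_eq0; case: eqP => [_|xi0]; first by rewrite /= oppr0.
rewrite /u_sol (lambda_opp delta om) (q_opp delta_gt0 hK) fourier_sym// fourierv_opp.
rewrite (@bdot_opp xi _ (fun j => complex.Re (fourierv f xi j ord0))); last first.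
  by move=> j; rewrite fourierv_opp; case: (fourierv f xi j ord0).
rewrite (@bdot_opp xi _ (fun j => - complex.Im (fourierv f xi j ord0))); last first.
  by move=> j; rewrite fourierv_opp; case: (fourierv f xi j ord0).
have -> : b (freq_opp xi) i ord0 = - b xi i ord0 by rewrite (b_opp delta_gt0 hK) mxE.
have -> : bdot (b xi) (fun j => - complex.Im (fourierv f xi j ord0)) =
    - bdot (b xi) (fun j => complex.Im (fourierv f xi j ord0)).
  by rewrite /bdot -sumrN; apply: eq_bigr => j _; rewrite mulrN.
case: (fourier g xi) (fourierv f xi i ord0) => s t [x y] /=.
by apply/eqP; rewrite eq_complex/=; apply/andP; split; apply/eqP; ring.
Qed.

Lemma p_hat_sym xi : p_hat (freq_opp xi) = (p_hat xi)^*%C.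
Proof.
rewrite /p_hat freq_opp_eq0; case: eqP => [_|xi0]; first by rewrite /= oppr0.
rewrite /p_sol (lambda_opp delta om) (q_opp delta_gt0 hK) fourier_sym//.
rewrite (@bdot_opp xi _ (fun j => - complex.Im (fourierv f xi j ord0))); last first.
  by move=> j; rewrite fourierv_opp; case: (fourierv f xi j ord0).
rewrite (@bdot_opp xi _ (fun j => complex.Re (fourierv f xi j ord0))); last first.
  by move=> j; rewrite fourierv_opp; case: (fourierv f xi j ord0).
have -> : bdot (b xi) (fun j => - complex.Im (fourierv f xi j ord0)) =
    - bdot (b xi) (fun j => complex.Im (fourierv f xi j ord0)).
  by rewrite /bdot -sumrN; apply: eq_bigr => j _; rewrite mulrN.
case: (fourier g xi) => s t /=.
by apply/eqP; rewrite eq_complex/=; apply/andP; split; apply/eqP; ring.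
Qed.

Definition energy : R :=
  \sum_i \int[mu]_(x in Cell) vcomp f i x ^+ 2 + \int[mu]_(x in Cell) g x ^+ 2.

Let data_abs2 xi := \sum_i abs2 (fourier (vcomp f i) xi) + abs2 (fourier g xi).

Let data_abs2_ge0 xi : 0 <= data_abs2 xi.
Proof.
by rewrite addr_ge0 ?abs2_ge0//; apply: sumr_ge0 => i _; exact: abs2_ge0.
Qed.

Let KK_ge0 : 0 <= 2 * K_ ^+ 2. Proof. by rewrite mulr_ge0 ?sqr_ge0. Qed.

Let Dl_ge0 (xi : freq d) : 0 <= delta ^+ 2 * c xi * l xi.
Proof.
rewrite mulr_ge0 ?(lambda_ge0 delta_gt0 hK)// mulr_ge0 ?sqr_ge0//.
exact: (c_ge0 delta_gt0 hK).
Qed.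

Lemma u_hat_le xi : \sum_i abs2 (u_hat i xi) <= 2 * K_ ^+ 2 * data_abs2 xi.
Proof.
rewrite /u_hat; case: eqP => [_|xi0].
  rewrite big1; first by rewrite mulr_ge0.
  by move=> i _; rewrite /abs2/= expr0n addr0.
have [l16 q0 qK lqK] := bounds xi0.
have := u_sol_le (qE xi) l16 q0 (Dl_ge0 xi) K_ge16 qK (fourierv f xi) (fourier g xi).
rewrite /data_abs2; congr (_ <= _ * (_ + _)).
by apply: eq_bigr => i _; rewrite mxE.
Qed.

Lemma p_hat_le xi : abs2 (p_hat xi) <= 2 * K_ ^+ 2 * data_abs2 xi.
Proof.
rewrite /p_hat; case: eqP => [_|xi0].
  by rewrite /abs2/= expr0n addr0 mulr_ge0.
have [l16 q0 qK lqK] := bounds xi0.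
have := p_sol_le (qE xi) l16 q0 (Dl_ge0 xi) K_ge16 qK lqK (fourierv f xi) (fourier g xi).
rewrite /data_abs2; congr (_ <= _ * (_ + _)).
by apply: eq_bigr => i _; rewrite mxE.
Qed.

Lemma sum_data_abs2 s : uniq s -> (vol R d)^-1 * \sum_(xi <- s) data_abs2 xi <= energy.
Proof.
move=> us; rewrite big_split/= exchange_big/= mulrDr mulr_sumr; apply: lerD.
  by apply: ler_sum => i _; exact: Bessel.
exact: Bessel.
Qed.

Let vol_bound (h : freq d -> R) : (forall xi, h xi <= 2 * K_ ^+ 2 * data_abs2 xi) ->
  forall s, uniq s -> (vol R d)^-1 * \sum_(xi <- s) h xi <= 2 * K_ ^+ 2 * energy.
Proof.
move=> hle s us; apply: le_trans (ler_wpM2l KK_ge0 (sum_data_abs2 us)).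
rewrite mulrCA; apply: ler_wpM2l; first by rewrite invr_ge0 ltW// vol_gt0.
by rewrite mulr_sumr; apply: ler_sum => xi _; exact: hle.
Qed.

Let unscale (h : freq d -> R) s (B : R) :
  (vol R d)^-1 * \sum_(xi <- s) h xi <= B -> \sum_(xi <- s) h xi <= vol R d * B.
Proof.
by move=> h1; rewrite mulrC -ler_pdivrMr ?vol_gt0// mulrC.
Qed.

(** The coefficients are square summable by the bounds at each frequency and the
    Bessel inequality for the data; the Riesz-Fischer theorem turns them into
    functions. *)
Lemma solution_exists : exists (w : 'I_d -> Rspace R d -> R) (r : Rspace R d -> R),
  [/\ forall i, sq (w i), sq r,
      forall i xi, fourier (w i) xi = u_hat i xi,
      forall xi, fourier r xi = p_hat xi &
      \sum_i \int[mu]_(x in Cell) w i x ^+ 2 <= 2 * K_ ^+ 2 * energy /\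
      \int[mu]_(x in Cell) r x ^+ 2 <= 2 * K_ ^+ 2 * energy].
Proof.
have ub i s : uniq s -> \sum_(xi <- s) abs2 (u_hat i xi) <= vol R d * (2 * K_ ^+ 2 * energy).
  move=> us; apply: unscale; apply: vol_bound us => xi.
  apply: le_trans (u_hat_le xi); rewrite (bigD1 i)//= lerDl.
  by apply: sumr_ge0 => j _; exact: abs2_ge0.
have pb s : uniq s -> \sum_(xi <- s) abs2 (p_hat xi) <= vol R d * (2 * K_ ^+ 2 * energy).
  by move=> us; apply: unscale; apply: vol_bound us; exact: p_hat_le.
have /choice[w hw] : forall i, exists w, sq w /\ forall xi, fourier w xi = u_hat i xi.
  by move=> i; have [w [sw wE _]] := Riesz_Fischer (u_hat_sym i) (ub i); exists w.
have [r [sr rE _]] := Riesz_Fischer p_hat_sym pb.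
exists w, r; split => //.
- by move=> i; case: (hw i).
- by move=> i; case: (hw i).
split.
  apply: Parseval_le; first by move=> i; case: (hw i).
  move=> s us; apply: vol_bound us => xi; apply: le_trans (u_hat_le xi).
  by rewrite le_eqVlt; apply/orP; left; apply/eqP; apply: eq_bigr => i _; case: (hw i) => _ ->.
have := @Parseval_le R d unit (fun=> r) (2 * K_ ^+ 2 * energy) (fun=> sr).
rewrite big_const card_unit /= addr0; apply=> s us; apply: vol_bound us => xi.
by rewrite big_const card_unit/= addr0 rE; exact: p_hat_le.
Qed.

Lemma hat_momentum i xi :
  (l xi)%:C * u_hat i xi + 'i * p_hat xi * (b xi i ord0)%:C = fourierv f xi i ord0.
Proof.
rewrite /u_hat /p_hat; case: eqP => [->|xi0].
  rewrite mulr0 mulr0 mul0r addr0 mxE; apply/esym/mean_zeroP => //.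
by apply: sol_momentum; [exact: l_neq0|exact: q_neq0].
Qed.

Lemma hat_divergence xi :
  'i * (\sum_(i < d) (b xi i ord0)%:C * u_hat i xi) + (delta ^+ 2 * c xi)%:C * p_hat xi =
  fourier g xi.
Proof.
rewrite /u_hat /p_hat; case: eqP => [->|xi0].
  rewrite mulr0 addr0 big1 ?mulr0; last by move=> i _; rewrite mulr0.
  by apply/esym/mean_zeroP.
by apply: sol_divergence; [exact: l_neq0|exact: q_neq0|exact: qE].
Qed.

(** The functions built from the coefficients matter on the cell only; they are
    extended by periodicity.  Every solution has the coefficients that the
    inverse matrix prescribes, and vanishing ones at the frequency 0, so that
    two solutions agree almost everywhere. *)
Lemma Stokes_well_posed :
  exists (u : Rspace R d -> 'cV[R]_d) (p : Rspace R d -> R),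
  [/\ solution delta om omt omh f g u p,
      forall (u' : Rspace R d -> 'cV[R]_d) (p' : Rspace R d -> R),
        solution delta om omt omh f g u' p' ->
        u' = u %[ae lebesgue_tuple R d in @cell R d] /\
        p' = p %[ae lebesgue_tuple R d in @cell R d],
      (forall i, is_fourier_series (vcomp u i) (fourier (vcomp u i))) /\
      is_fourier_series p (fourier p),
      forall xi : freq d, xi <> freq0 d ->
        [/\ lambda_ delta om xi != 0,
            q_ delta om omt omh xi != 0,
            A_ delta om omt omh xi \in unitmx,
            invmx (A_ delta om omt omh xi) = Ainv_ delta om omt omh xi &
            col_mx (fourierv u xi) (fourier p xi)%:M =
            invmx (A_ delta om omt omh xi) *m
              col_mx (fourierv f xi) (fourier g xi)%:M] &
      (L2normv u <= (2 * K_)%:E * (L2normv f + L2norm g))%E /\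
      (L2norm p <= (2 * K_)%:E * (L2normv f + L2norm g))%E].
Proof.
have [w [r [sw sr wE rE [w_le r_le]]]] := solution_exists.
pose u (x : Rspace R d) : 'cV[R]_d := \col_i w i (wrap x).
pose p := r \o @wrap R d.
have uw i x : Cell x -> vcomp u i x = w i x by move=> cx; rewrite /vcomp mxE wrap_id.
have pr x : Cell x -> p x = r x by move=> cx; rewrite /p /= wrap_id.
have su i : sq (vcomp u i).
  by apply: (eq_sqint mC _ (sw i)) => x; rewrite inE => cx; rewrite uw.
have sp : sq p by apply: (eq_sqint mC _ sr) => x; rewrite inE => cx; rewrite pr.
have uE i xi : fourier (vcomp u i) xi = u_hat i xi by rewrite -wE; apply: fourier_eq; exact: uw.
have pE xi : fourier p xi = p_hat xi by rewrite -rE; exact: fourier_eq.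
have sol : solution delta om omt omh f g u p.
  split.
  - by split; [exact: (wrap_periodic (fun y => \col_i w i y))|exact: wrap_periodic].
  - by split; [move=> i; exact/in_L2P|exact/in_L2P].
  - split; first by move=> i; apply/mean_zeroP => //; rewrite uE /u_hat eqxx.
    by apply/mean_zeroP => //; rewrite pE /p_hat eqxx.
  move=> xi; split.
    apply/matrixP => i j; rewrite (ord1 j) -[0]/(@ord0 0) -hat_momentum /opL /opG opprK.
    by rewrite [LHS]mxE; congr (_ + _); rewrite [LHS]mxE ?pE; congr (_ * _); rewrite mxE ?uE.
  rewrite -hat_divergence /opD /opR mulrN opprK mulrA -rmorphM pE; congr ('i * _ + _).
  by rewrite mxE; apply: eq_bigr => i _; rewrite !mxE uE.
have matrix_form u' p' xi : solution delta om omt omh f g u' p' -> xi <> freq0 d ->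
    col_mx (fourierv u' xi) (fourier p' xi)%:M =
    invmx (A xi) *m col_mx (fourierv f xi) (fourier g xi)%:M.
  move=> [_ _ _ /(_ xi)[e1 e2]] xi0.
  by rewrite -(system_matrix e1 e2) mulKmx// A_unit.
exists u, p; split => //.
- move=> u' p' sol'.
  have [_ [hu hp] [zu zp] _] := sol'; have [_ _ [zu0 zp0] _] := sol.
  have su' i : sq (vcomp u' i) by apply/in_L2P; exact: hu.
  have sp' : sq p' by exact/in_L2P.
  have eqs xi : fourierv u' xi = fourierv u xi /\ fourier p' xi = fourier p xi.
    have [->|/eqP xi0] := eqVneq xi (freq0 d).
      split; last by rewrite (mean_zeroP sp').1// (mean_zeroP sp).1.
      apply/matrixP => i j; rewrite !mxE.
      by rewrite (mean_zeroP (su' i)).1// (mean_zeroP (su i)).1.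
    have := matrix_form _ _ _ sol' xi0; rewrite -(matrix_form _ _ _ sol xi0).
    by move=> /eq_col_mx[-> /matrixP/(_ ord0 ord0)]; rewrite !mxE eqxx !mulr1n.
  split; last by apply: fourier_inj => // xi; case: (eqs xi).
  have : forall i, \forall x \ae mu, Cell x -> vcomp u' i x = vcomp u i x.
    move=> i; apply: fourier_inj => // xi.
    by have [/matrixP/(_ i ord0)] := eqs xi; rewrite !mxE.
  move=> /filter_forall; apply: filterS => x hx cx.
  by apply/matrixP => i j; rewrite (ord1 j); exact: hx.
- by split; [move=> i; exact: fourier_series|exact: fourier_series].
- move=> xi xi0; split; [exact: l_neq0|exact: q_neq0|exact: A_unit|exact: invmx_A|].
  exact: matrix_form.
- have nu : \sum_i \int[mu]_(x in Cell) vcomp u i x ^+ 2 <= 2 * K_ ^+ 2 * energy.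
    apply: le_trans w_le; rewrite le_eqVlt; apply/orP; left; apply/eqP.
    by apply: eq_bigr => i _; apply: eq_Rintegral => x; rewrite inE => cx; rewrite uw.
  have np : \int[mu]_(x in Cell) p x ^+ 2 <= 2 * K_ ^+ 2 * energy.
    apply: le_trans r_le; rewrite le_eqVlt; apply/orP; left; apply/eqP.
    by apply: eq_Rintegral => x; rewrite inE => cx; rewrite pr.
  rewrite !L2normvE// !L2normE// -!EFinD -!EFinM !lee_fin.
  have f0 : 0 <= \sum_i \int[mu]_(x in Cell) vcomp f i x ^+ 2.
    by apply: sumr_ge0 => i _; apply: Rintegral_ge0 => x _; exact: sqr_ge0.
  have g0 : 0 <= \int[mu]_(x in Cell) g x ^+ 2.
    by apply: Rintegral_ge0 => x _; exact: sqr_ge0.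
  have K0 : 0 <= K_ by have := K_ge16; lra.
  by split; exact: sqrt_energy_le.
Qed.

End Stokes_system.

Theorem theorem3p5 (R : realType) (m : R) (hm : 0 < m) :
  exists2 C : R, 0 < C &
  forall (d : nat) (hd : d = 2%N \/ d = 3%N)
    (M : R) (hM : m < M) (delta : R) (hdelta : 0 < delta < 1)
    (om omt omh : R -> R) (hK : kernel_assumption d delta om omt omh m M)
    (f : Rspace R d -> 'cV[R]_d) (g : Rspace R d -> R)
    (f_per : cell_periodic f) (g_per : cell_periodic g)
    (f_L2 : in_L2v f) (g_L2 : in_L2 g)
    (f_mean : mean_zerov f) (g_mean : mean_zero g),
  exists (u : Rspace R d -> 'cV[R]_d) (p : Rspace R d -> R),
  [/\ solution delta om omt omh f g u p,
      forall (u' : Rspace R d -> 'cV[R]_d) (p' : Rspace R d -> R),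
        solution delta om omt omh f g u' p' ->
        u' = u %[ae lebesgue_tuple R d in @cell R d] /\
        p' = p %[ae lebesgue_tuple R d in @cell R d],
      (forall i, is_fourier_series (vcomp u i) (fourier (vcomp u i))) /\
      is_fourier_series p (fourier p),
      forall xi : freq d, xi <> freq0 d ->
        [/\ lambda_ delta om xi != 0,
            q_ delta om omt omh xi != 0,
            A_ delta om omt omh xi \in unitmx,
            invmx (A_ delta om omt omh xi) = Ainv_ delta om omt omh xi &
            col_mx (fourierv u xi) (fourier p xi)%:M =
            invmx (A_ delta om omt omh xi) *m
              col_mx (fourierv f xi) (fourier g xi)%:M] &
      (L2normv u <= C%:E * (L2normv f + L2norm g))%E /\
      (L2norm p <= C%:E * (L2normv f + L2norm g))%E].
Proof.
have K16 := K_ge16 hm; exists (2 * K_ m); first by lra.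
move=> d hd M _ delta /andP[delta0 delta1] om omt omh hK f g _ _ fL2 gL2 f0 g0.
have [d1 d3] : (1 < d)%N /\ (d <= 3)%N by case: hd => ->.
apply: (Stokes_well_posed d1 d3 delta0 _ hm hK) => //; first exact: ltW.
  by move=> i; apply/in_L2P; exact: fL2.
exact/in_L2P.
Qed.
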